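(* Let $d\ge 1$ and let $X=(X^1,\dots,X^d)$ be an $\mathbb R^d$-valued random field on $T$ over $(\Omega_X,\mathcal F_X,P_X)$ such that, for each $l=1,\dots,d$, the component $X^l$ is a homogeneous random field with $E_X[|X^l(0)|^2]<\infty$ and $\mathrm{Var}_X[X^l(0)\mid \mathcal I^l_X]>0$ with $P_X$-probability 1. For each $l$ let $\{T_n^l\}_{n\ge1}$ be a pointwise averaging sequence of sets in $T$, let $k_n\in\mathbb N$, $k_n\uparrow\infty$, and let $\tau^l_{n,i}$ ($1\le i\le k_n$, $1\le l\le d$) be the randomizing points, uniformly distributed on $T_n^l$, described in the context. Let $Z=(Z^1,\dots,Z^d)$ be a vector of independent standard normal random variables. Then, as $n\to\infty$, $$\left(\frac{\sum_{i=1}^{k_n}(X^1(\tau^1_{n,i})-M_n^1)}{k_n^{1/2}(V^1_n)^{1/2}},\dots,\frac{\sum_{i=1}^{k_n}(X^d(\tau^d_{n,i})-M_n^d)}{k_n^{1/2}(V^d_n)^{1/2}}\right)\Longrightarrow Z$$ in distribution with respect to $P_{X,\tau}$. If all $X^l$ are ergodic, then $$\left(\frac{\sum_{i=1}^{k_n}(X^1(\tau^1_{n,i})-M_n^1)}{k_n^{1/2}\sigma^1},\dots,\frac{\sum_{i=1}^{k_n}(X^d(\tau^d_{n,i})-M_n^d)}{k_n^{1/2}\sigma^d}\right)\Longrightarrow Z$$ in distribution with respect to $P_{X,\tau}$, where $\sigma^l=(\mathrm{Var}_X[X^l(0)])^{1/2}$.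
   Context: $T=\mathbb R^m$ or $T=\mathbb Z^m$, $m\ge1$; $\mathcal B$ is the Borel $\sigma$-field of $T$ (all subsets if $T=\mathbb Z^m$); $\lambda$ is Lebesgue measure on $\mathbb R^m$, resp. counting measure on $\mathbb Z^m$. A random field is a family $X(t)$, $t\in T$, of random vectors on a probability space $(\Omega_X,\mathcal F_X,P_X)$ (expectation $E_X$); when $T=\mathbb R^m$ the map $(t,\omega)\mapsto X(t,\omega)$ is assumed $\mathcal B\otimes\mathcal F_X$-measurable. A field is homogeneous if all its finite-dimensional distributions are invariant under shifts of $T$. For a homogeneous field $Y$, $\mathcal I_Y$ denotes the $\sigma$-field of events $\{Y\in A\}$, $A$ in the product $\sigma$-field of the space of functions on $T$, with $P_X(\{Y\in A\}\triangle\{Y(\cdot+t)\in A\})=0$ for all $t\in T$; $Y$ is ergodic if every event of $\mathcal I_Y$ has probability $0$ or $1$. $\mathcal I^l_X:=\mathcal I_{X^l}$. $\mathrm{Var}_X[\cdot\mid\mathcal I]$ is the conditional variance. Pointwise averaging: a sequence $\{T_n\}$ of bounded Borel subsets of $T$ with $\lambda(T_n)>0$, $\lambda(T_n)\to\infty$, is pointwise averaging if for every scalar homogeneous random field $Y$ on $T$ (over any probability space) and every measurable $f:\mathbb R\to\mathbb R$ with $E[|f(Y(0))|]<\infty$, with probability 1, $\lim_{n}\frac1{\lambda(T_n)}\int_{T_n}f(Y(t))\lambda(dt)=E[f(Y(0))\mid\mathcal I_Y]$. Randomizing points: on a probability space $(\Omega_\tau,\mathcal F_\tau,P_\tau)$,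 for each $n$ there are $d$ mutually independent vectors $\tau_n^l=(\tau^l_{n,1},\dots,\tau^l_{n,k_n})$, $l=1,\dots,d$, where $\tau^l_{n,1},\dots,\tau^l_{n,k_n}$ are i.i.d. $T$-valued, uniformly distributed on $T_n^l$ (with respect to $\lambda$). The $\tau$'s are independent of $X$: everything is considered on the product space $(\Omega_X\times\Omega_\tau,\mathcal F_X\otimes\mathcal F_\tau,P_{X,\tau})$, $P_{X,\tau}:=P_X\times P_\tau$. $M_n^l:=\frac1{\lambda(T_n^l)}\int_{T_n^l}X^l(t)\lambda(dt)$, $V_n^l:=\frac1{\lambda(T_n^l)}\int_{T_n^l}(X^l(t)-M_n^l)^2\lambda(dt)$ (functions of $\omega\in\Omega_X$). A quotient with zero denominator is set to $0$. *)

(* Defs.v *)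
From HB Require Import structures.
From mathcomp Require Import all_boot all_order all_algebra.
From mathcomp Require Import all_classical all_reals all_analysis.
From mathcomp Require Import measurable_realfun.

Set Implicit Arguments.
Unset Strict Implicit.
Unset Printing Implicit Defensive.

Import Order.TTheory GRing.Theory Num.Theory.
Import numFieldNormedType.Exports.

Local Open Scope classical_set_scope.
Local Open Scope ring_scope.

(* n-fold product measure, iterated along the isomorphism E^(n+1) = E * E^n;
   Lebesgue measure on R^n is the product of one-dimensional ones, which
   tuple_measure_box below evaluates on boxes. *)
Section cons_measure.
Context d (E : measurableType d) (R : realType) (n : nat).
Variables (mu : {sigma_finite_measure set E -> \bar R})
  (nu : {sigma_finite_measure set (n.-tuple E) -> \bar R}).

Definition tuple_cons (p : E * n.-tuple E) : n.+1.-tuple E :=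
  [the n.+1.-tuple E of p.1 :: p.2].

Lemma measurable_tuple_cons : measurable_fun [set: E * n.-tuple E] tuple_cons.
Proof. by apply: measurable_cons. Qed.

Definition cons_measure : set (n.+1.-tuple E) -> \bar R :=
  pushforward (mu \x nu)%E tuple_cons.

Let cons_measure0 : cons_measure set0 = 0%E.
Proof. by rewrite /cons_measure /pushforward preimage_set0 measure0. Qed.

Let cons_measure_ge0 A : (0 <= cons_measure A)%E.
Proof. by rewrite /cons_measure /pushforward. Qed.

Let cons_measure_sigma_additive : semi_sigma_additive cons_measure.
Proof.
move=> F mF tF mUF; rewrite /cons_measure /pushforward preimage_bigcup.
apply: measure_semi_sigma_additive.
- by move=> i; rewrite -[X in measurable X]setTI; exact: measurable_tuple_cons.
- apply/trivIsetP => /= i j _ _ ij; rewrite -preimage_setI.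
  by move/trivIsetP : tF => /(_ _ _ _ _ ij) ->//; rewrite preimage_set0.
- rewrite -preimage_bigcup -[X in measurable X]setTI.
  exact: measurable_tuple_cons.
Qed.

HB.instance Definition _ := isMeasure.Build _ _ _ cons_measure
  cons_measure0 cons_measure_ge0 cons_measure_sigma_additive.

Lemma cons_measure_sigma_finite : sigma_finite setT cons_measure.
Proof.
have /sigma_finiteP[F [FT ndF Foo]] := sigma_finiteT mu.
have /sigma_finiteP[G [GT ndG Goo]] := sigma_finiteT nu.
pose g (t : n.+1.-tuple E) : E * n.-tuple E :=
  (tnth t ord0, [tuple of behead t]).
have mg : measurable_fun [set: n.+1.-tuple E] g.
  apply: measurable_fun_pair; first exact: measurable_tnth.
  exact: measurable_behead.
have gK : cancel tuple_cons g.
  by move=> [x v]; rewrite /g /tuple_cons; congr pair; exact/val_inj.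
exists (fun k => g @^-1` (F k `*` G k)).
  apply/esym/seteqP; split => // t _.
  have : setT (g t).1 by []. rewrite FT => -[i _ Fi].
  have : setT (g t).2 by []. rewrite GT => -[j _ Gj].
  exists (maxn i j) => //; split.
    by move: Fi; exact/subsetPset/ndF/leq_maxl.
  by move: Gj; exact/subsetPset/ndG/leq_maxr.
move=> k; have [mF Fk] := Foo k; have [mG Gk] := Goo k; split.
  by rewrite -[X in measurable X]setTI; apply: mg => //; exact: measurableX.
rewrite /cons_measure /pushforward -comp_preimage.
rewrite (_ : g \o tuple_cons = id); last by apply/funext => x /=; rewrite gK.
by rewrite product_measure1E// lte_mul_pinfty// ge0_fin_numE.
Qed.

HB.instance Definition _ := Measure_isSigmaFinite.Build _ _ _ cons_measure
  cons_measure_sigma_finite.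

End cons_measure.

Fixpoint tuple_measure d (E : measurableType d) (R : realType)
    (mu : {sigma_finite_measure set E -> \bar R}) (n : nat) :
    {sigma_finite_measure set (n.-tuple E) -> \bar R} :=
  match n with
  | 0 => [the {sigma_finite_measure set (0.-tuple E) -> \bar R}
            of \d_([tuple] : 0.-tuple E)]
  | n'.+1 => [the {sigma_finite_measure set (n'.+1.-tuple E) -> \bar R}
            of cons_measure mu (tuple_measure mu n')]
  end.

Lemma tuple_measure_box d (E : measurableType d) (R : realType)
    (mu : {sigma_finite_measure set E -> \bar R}) (n : nat)
    (A : 'I_n -> set E) : (forall i, measurable (A i)) ->
  tuple_measure mu n [set t | forall i, A i (tnth t i)] =
  (\prod_(i < n) mu (A i))%E.
Proof.
elim: n A => [|n IH] A mA.
  rewrite big_ord0 /= /dirac indicE mem_set//= => -[].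
  by [].
rewrite big_ord_recl /=.
have mB : measurable [set t : n.-tuple E | forall i, A (lift ord0 i) (tnth t i)].
  rewrite (_ : [set t | _] =
      \bigcap_(i in [set: 'I_n]) ((@tnth n E ^~ i) @^-1` A (lift ord0 i))); last first.
    by apply/seteqP; split => t /= h i => [_|]; exact: h.
  apply: fin_bigcap_measurable => // i _.
  by rewrite -[X in measurable X]setTI; exact: measurable_tnth.
rewrite /cons_measure /pushforward.
rewrite (_ : _ @^-1` _ = A ord0 `*`
    [set t : n.-tuple E | forall i, A (lift ord0 i) (tnth t i)]); last first.
  apply/seteqP; split => -[x v] /=.
    by move=> h; split => [|i]; [exact: (h ord0)|have := h (lift ord0 i); rewrite tnthS].
  move=> [Ax Av] i; case: (unliftP ord0 i) => [j ->|->//].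
  by rewrite tnthS; exact: Av.
rewrite product_measure1E//; congr (_ * _)%E.
by rewrite (IH (fun i => A (lift ord0 i))).
Qed.

(* Z^m, equipped with the discrete sigma-field. *)
Definition int_lattice (m : nat) := m.-tuple int.

HB.instance Definition _ m := Countable.on (int_lattice m).
HB.instance Definition _ m :=
  isPointed.Build (int_lattice m) [tuple 0 | _ < m].
HB.instance Definition _ m := @isMeasurable.Build default_measure_display
  (int_lattice m) discrete_measurable discrete_measurable0
  discrete_measurableC discrete_measurableU.

Section lattice_measure.
Context (R : realType) (m : nat).

Definition lattice_measure : set (int_lattice m) -> \bar R := counting.

HB.instance Definition _ := Measure.on lattice_measure.

Let lattice_measure_sigma_finite : sigma_finite setT lattice_measure.
Proof.
exists (fun n => [set t | (pickle t <= n)%N]).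
  by apply/esym/seteqP; split => // t _; exists (pickle t) => /=.
move=> n; split => //; rewrite /lattice_measure /counting asboolT ?ltry//.
apply: (@sub_finite_set _ _ (pickle @^-1` `I_n.+1)) => //.
apply: finite_preimage; last exact: finite_II.
by move=> x y _ _; exact: (pcan_inj pickleK).
Qed.

HB.instance Definition _ := Measure_isSigmaFinite.Build _ _ _ lattice_measure
  lattice_measure_sigma_finite.

End lattice_measure.

(* The data of the index set T that enter the definitions below;
   td_continuous tells whether random fields are required to be jointly
   measurable. *)
Record time_domain (R : realType) := TimeDomain {
  td_display : measure_display;
  td_sort :> measurableType td_display;
  td_zero : td_sort;
  td_add : td_sort -> td_sort -> td_sort;
  td_bounded : set (set td_sort);
  td_measure : {sigma_finite_measure set td_sort -> \bar R};
  td_continuous : bool }.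

(* The product sigma-field carried by m.-tuple (measurableTypeR R) is the Borel
   sigma-field of R^m. *)
Definition real_domain (R : realType) (m : nat) : time_domain R :=
  {| td_sort := m.-tuple (measurableTypeR R);
     td_zero := [tuple (0 : R) | _ < m];
     td_add := fun s t => [tuple (tnth s i : R) + (tnth t i : R) | i < m];
     td_bounded := [set A | exists M : R,
       forall t, A t -> forall i, `|tnth t i : R| <= M];
     td_measure := tuple_measure (@lebesgue_measure R) m;
     td_continuous := true |}.

Definition int_domain (R : realType) (m : nat) : time_domain R :=
  {| td_sort := int_lattice m;
     td_zero := [tuple 0 | _ < m];
     td_add := fun s t => [tuple tnth s i + tnth t i | i < m];
     td_bounded := [set A | exists M : int,
       forall t, A t -> forall i, `|tnth t i| <= M];
     td_measure := @lattice_measure R m;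
     td_continuous := false |}.

Section conditional_expectation.
Context d (O : measurableType d) (R : realType) (P : probability O R).
Implicit Types (G : set (set O)) (xi g : O -> R).

Definition is_cond_exp G xi g :=
  [/\ forall B, measurable B -> G (g @^-1` B),
      P.-integrable setT (EFin \o g) &
      forall A, G A ->
        (\int[P]_(w in A) (g w)%:E = \int[P]_(w in A) (xi w)%:E)%E].

(* An arbitrary version of E[xi | G]; see cond_expP for its existence. *)
Definition cond_exp G xi : O -> R := xget (cst 0) [set g | is_cond_exp G xi g].

Definition cond_var G xi : O -> R :=
  cond_exp G (fun w => (xi w - cond_exp G xi w) ^+ 2).

Lemma cond_expP G xi : sigma_algebra setT G -> G `<=` measurable ->
  P.-integrable setT (EFin \o xi) -> is_cond_exp G xi (cond_exp G xi).
Proof.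
move=> sG Gm ixi; rewrite /cond_exp; case: xgetP => [//|noG].
exfalso.
pose OG := g_sigma_algebraType G.
have GE : @measurable _ OG = G by exact: sigma_algebra_id.
pose i : O -> OG := idfun.
have mi : measurable_fun setT i.
  by move=> _ A; rewrite GE setTI => /Gm.
pose im := isMeasurableFun.Build _ _ _ _ _ mi.
pose iM : {mfun O >-> OG} := MeasurableFun.Pack (MeasurableFun.Class im).
pose mu : probability OG R := distribution P iM.
pose nu_ := [the {charge set OG -> \bar R} of pushforward (induced_charge ixi) i].
pose nu := nu_ mi.
have dom : nu `<< mu.
  apply/null_content_dominatesP => A mA muA.
  have mA' : @measurable _ O A by apply: Gm; rewrite -GE.
  apply: (@null_set_integral _ O R P A (EFin \o xi)) => //.
  by apply: measurable_funTS; exact: measurable_int ixi.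
pose D : OG -> \bar R := Radon_Nikodym nu mu.
have Dfin x : D x \is a fin_num by exact: Radon_Nikodym_fin_num.
have Dint : mu.-integrable setT D by exact: Radon_Nikodym_integrable.
have mD : measurable_fun setT D by exact: measurable_int Dint.
have DE : EFin \o (fine \o D) = D by apply/funext => x /=; rewrite fineK.
have PD : P.-integrable setT (D : O -> \bar R).
  apply/integrableP; split.
    by move=> _ B mB; rewrite setTI; apply: Gm; rewrite -GE -[X in _ X]setTI; exact: mD.
  case/integrableP : Dint => _.
  by rewrite ge0_integral_pushforward//; exact: measurableT_comp.
apply: (noG (fine \o D)); split.
- move=> B mB; rewrite -GE -[X in _ X]setTI.
  by apply: measurableT_comp => //; exact: measurable_fine.
- by rewrite DE.
- move=> A GA; have mA : @measurable _ OG A by rewrite GE.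
  transitivity (nu A) => //.
  rewrite (Radon_Nikodym_integral dom mA) integral_pushforward//.
    by apply: eq_integral => x _; rewrite /= fineK.
  by apply: integrableS PD => //; exact: Gm.
Qed.

End conditional_expectation.

Section random_fields.
Context (R : realType) (T : time_domain R).
Context dO (O : measurableType dO) (P : probability O R).

Definition random_field dE (E : measurableType dE) (X : T -> O -> E) : Prop :=
  (forall t, measurable_fun [set: O] (X t)) /\
  (td_continuous T -> measurable_fun [set: T * O] (fun p => X p.1 p.2)).

Definition homogeneous (Y : T -> O -> R) : Prop :=
  forall (k : nat) (t : 'I_k -> T) (h : T) (B : set (k.-tuple R)),
    measurable B ->
    P [set w | B [tuple Y (td_add (t i) h) w | i < k]] =
    P [set w | B [tuple Y (t i) w | i < k]].

Definition path_measurable : set (set (T -> R)) :=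
  <<s [set A | exists (t : T) (B : set R),
         measurable B /\ A = [set y : T -> R | B (y t)]] >>.

Definition invariant_sigma (Y : T -> O -> R) : set (set O) :=
  [set E | exists A : set (T -> R),
     [/\ path_measurable A,
         E = [set w | A (fun s => Y s w)] &
         forall t : T,
           P (E `+` [set w | A (fun s => Y (td_add s t) w)]) = 0%E]].

Definition ergodic (Y : T -> O -> R) : Prop :=
  forall E, invariant_sigma Y E -> P E = 0%E \/ P E = 1%E.

End random_fields.

Section averages.
Context (R : realType) (T : time_domain R).
Implicit Types (A : set T) (x : T -> R).
Local Notation lambda := (td_measure T).

(* Sample paths that are not integrable over A form a null set in the cases of
   interest; the integral then has an irrelevant default value. *)
Definition average A x : R := (fine (lambda A))^-1 * \int[lambda]_(t in A) x t.

Definition average_var A x : R := average A (fun t => (x t - average A x) ^+ 2).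

Definition pointwise_averaging (A : nat -> set T) : Prop :=
  [/\ forall n, [/\ measurable (A n), td_bounded (A n) & (0 < lambda (A n))%E],
      lambda (A n) @[n --> \oo] --> +oo%E &
      forall (dO : measure_display) (O : measurableType dO)
        (P : probability O R) (Y : T -> O -> R) (f : R -> R),
        random_field Y -> homogeneous P Y -> measurable_fun [set: R] f ->
        ('E_P[fun w => `|f (Y (td_zero T) w)|%R] < +oo)%E ->
        {ae P, forall w, average (A n) (fun t => f (Y t w)) @[n --> \oo] -->
           cond_exp P (invariant_sigma P Y) (fun w' => f (Y (td_zero T) w')) w}].

End averages.

(* As the index set is finite and the sets A i may be taken to be the whole
   space, the product rule covers all subfamilies. *)
Definition mutually_independent dO (O : measurableType dO) (R : realType)
    (P : probability O R) dE (E : measurableType dE) (I : finType)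
    (X : I -> O -> E) : Prop :=
  forall A : I -> set E, (forall i, measurable (A i)) ->
    P [set w | forall i, A i (X i w)] = (\prod_(i : I) P (X i @^-1` A i))%E.

Definition uniformly_distributed (R : realType) (T : time_domain R)
    dO (O : measurableType dO) (P : probability O R)
    (A : set T) (u : O -> T) : Prop :=
  forall B : set T, measurable B ->
    P (u @^-1` B) =
    (((fine (td_measure T A))^-1)%:E * td_measure T (A `&` B))%E.

Definition randomizing_points (R : realType) (T : time_domain R)
    dO (O : measurableType dO) (P : probability O R) (d : nat)
    (A : 'I_d -> nat -> set T) (k : nat -> nat)
    (tau : forall n, 'I_d -> 'I_(k n) -> O -> T) : Prop :=
  forall n,
    [/\ forall l i, measurable_fun [set: O] (tau n l i),
        forall l i, uniformly_distributed P (A l n) (tau n l i),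
        forall l, mutually_independent P (tau n l) &
        mutually_independent P (fun l w => [tuple tau n l i w | i < k n])].

(* Convergence in distribution of R^d-valued random vectors. *)
Definition cvg_in_distribution (R : realType) (d : nat)
    dO (O : measurableType dO) (P : probability O R) (S : nat -> O -> 'rV[R]_d)
    dQ (O' : measurableType dQ) (Q : probability O' R) (Z : O' -> 'rV[R]_d) :
    Prop :=
  forall f : 'rV[R]_d -> R, continuous f -> (exists M, forall x, `|f x| <= M) ->
    ('E_P[fun w => f (S n w)] @[n --> \oo] --> 'E_Q[fun w => f (Z w)])%E.

Definition standard_normal (R : realType) dO (O : measurableType dO)
    (P : probability O R) (Z : O -> R) : Prop :=
  measurable_fun [set: O] Z /\
  forall B : set R, measurable B -> P (Z @^-1` B) = normal_prob 0 1 B.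

(* Main.v *)
Require Import Defs.
From HB Require Import structures.
From mathcomp Require Import all_boot all_order all_algebra.
From mathcomp Require Import all_classical all_reals all_analysis.
From mathcomp Require Import measurable_realfun.
From mathcomp Require Import ring lra.
Import Order.TTheory GRing.Theory Num.Theory.
Import numFieldNormedType.Exports.
Local Open Scope classical_set_scope.
Local Open Scope ring_scope.
Set Implicit Arguments.
Unset Strict Implicit.
Unset Printing Implicit Defensive.

(* For almost every path of [X], the averaging property applied to X^l, (X^l)^2 and
   (X^l)^2 1_{|X^l| > a} shows that [M_n^l] and [V_n^l] tend to E[X^l(0) | I^l] and to
   Var[X^l(0) | I^l] > 0, and that the truncated second moments are eventually
   small.  With the path fixed, the l-th sum is a row sum of i.i.d. variables that
   satisfy Lindeberg's condition, hence is asymptotically normal; as the d sums are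
   independent given the path, the probability of a box tends to the product of its
   normal probabilities.  Dominated convergence over the paths gives the same limit
   under P_{X,tau}, and convergence on boxes implies convergence in distribution.

   The central limit theorem uses Lindeberg's replacement without Gaussian
   summands: u(s, y) = Phi((a - y) / sqrt s) solves u_s = u_yy / 2, so that adding
   an independent centred summand of variance h to y changes E[u] as much as adding
   h to s, up to third-order terms; as s decreases to 0, u becomes the indicator of
   y <= a. *)

(** The hypothesis on the conditional variance concerns a version of E[(X^l(0) - m)^2 | I^l] with m
    = E[X^l(0) | I^l], whereas the averages along a path converge to m and to s = E[X^l(0)^2 | I^l].
    That s - m^2 > 0 is therefore a step of its own: the space is cut into events of I^l on which m
    is nearly constant, so that m never has to be taken out of a conditional expectation. No moment
    beyond the second is available, which shapes the Taylor estimate: its remainder is bounded by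
    min(x^2, |x|^3), the cubic bound serving the bulk of a summand and the quadratic one its tail.
    The truncation level a is chosen path by path; as it ranges over the positive integers, the
    exceptional paths still form a null set. The replacement stops at a time c > 0, where the
    derivatives of u are still bounded; c is made small at the end, independently of n. The
    normalizer is left as an arbitrary sequence c_n tending to sqrt(s - m^2) along almost every
    path. The square root of V_n^l and, in the ergodic case, the constant sigma^l are two instances,
    so that one limit theorem gives both assertions. *)

(* [is_derive] as a plain proposition, out of reach of instance resolution. *)
Definition has_deriv (R : realType) (f : R -> R) (x a : R) : Prop :=
  is_derive x 1 f a.

(** * Rules of differentiation and second-order Taylor remainders *)

(** The mean value theorem between 0 and [b]. The derivative is asked for on that segment only,
    described by [|t| <= |b|] and [0 <= t * b] whatever the sign of [b], because in the time
    variable the heat functions are differentiated at positive times only. *)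
Lemma derive_bound_power (R : realType) (f f' : R -> R) (C b : R) (n : nat) :
  f 0 = 0 ->
  (forall t : R, `|t| <= `|b| -> 0 <= t * b -> has_deriv f t (f' t)) ->
  (forall t, `|t| <= `|b| -> 0 <= t * b -> `|f' t| <= C * `|t| ^+ n) ->
  `|f b| <= C * `|b| ^+ n.+1.
Proof.
move=> f0 df bf.
have C0 : 0 <= C * `|b| ^+ n.
  by apply: (le_trans (normr_ge0 (f' b))); apply: bf; rewrite ?lexx// -expr2 sqr_ge0.
have Cle t : `|t| <= `|b| -> 0 <= t * b -> `|f' t| <= C * `|b| ^+ n.
  move=> tb tb0; apply: (le_trans (bf _ tb tb0)).
  have [C0'|C0'] := leP 0 C; first by rewrite ler_wpM2l// lerXn2r// nnegrE.
  have b0 : `|b| ^+ n = 0.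
    by apply/eqP; rewrite eq_le exprn_ge0// andbT -(nmulr_rge0 _ C0').
  rewrite b0 mulr0 nmulr_rle0// exprn_ge0//.
rewrite exprS mulrCA mulrC.
have [b0|b0|b0] := ltgtP b 0.
- have inb t : t \in `[b, 0] -> `|t| <= `|b| /\ 0 <= t * b.
    rewrite in_itv/= => /andP[bt t0]; rewrite !ler0_norm ?(ltW b0)//; split; first lra.
    by rewrite mulr_le0// ltW.
  have [] := @MVT R f f' b 0 b0.
  + by move=> x /subset_itv_oo_cc /inb[? ?]; exact: df.
  + apply: derivable_within_continuous => x /inb[h1 h2].
    by have [] := df _ h1 h2.
  + move=> c /subset_itv_oo_cc /inb[h1 h2]; rewrite f0 !sub0r => /eqP.
    rewrite mulrN eqr_opp => /eqP ->; rewrite normrM ler_wpM2r//; exact: Cle.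
- have inb t : t \in `[0, b] -> `|t| <= `|b| /\ 0 <= t * b.
    rewrite in_itv/= => /andP[bt t0]; rewrite !ger0_norm ?(ltW b0)//; split=> //.
    by rewrite mulr_ge0// ltW.
  have [] := @MVT R f f' 0 b b0.
  + by move=> x /subset_itv_oo_cc /inb[? ?]; exact: df.
  + apply: derivable_within_continuous => x /inb[h1 h2].
    by have [] := df _ h1 h2.
  + move=> c /subset_itv_oo_cc /inb[h1 h2]; rewrite f0 !subr0 => ->.
    rewrite normrM ler_wpM2r//; exact: Cle.
- by rewrite b0 f0 normr0 mulr0.
Qed.

Section derive_rules.
Context {R : realType}.
Implicit Types (f g : R -> R) (x a b : R).

Lemma has_deriv_eq f x a b : has_deriv f x a -> a = b -> has_deriv f x b.
Proof. by move=> df <-. Qed.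

Lemma has_deriv_cst x b : has_deriv (fun _ => b) x 0.
Proof. exact: is_derive_cst. Qed.

Lemma has_deriv_id x : has_deriv (fun t => t) x 1.
Proof. exact: is_derive_id. Qed.

Lemma has_derivD f g x a b : has_deriv f x a -> has_deriv g x b ->
  has_deriv (fun t => f t + g t) x (a + b).
Proof. by move=> df dg; exact: (@is_deriveD _ _ _ f g x 1 a b df dg). Qed.

Lemma has_derivN f x a : has_deriv f x a -> has_deriv (fun t => - f t) x (- a).
Proof. by move=> df; exact: (@is_deriveN _ _ _ f x 1 a df). Qed.

Lemma has_derivM f g x a b : has_deriv f x a -> has_deriv g x b ->
  has_deriv (fun t => f t * g t) x (f x * b + g x * a).
Proof. by move=> df dg; exact: (@is_deriveM _ _ f g x 1 a b df dg). Qed.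

Lemma has_derivX f n x a : has_deriv f x a ->
  has_deriv (fun t => f t ^+ n.+1) x (n.+1%:R * f x ^+ n * a).
Proof.
move=> df; elim: n => [|n IH]; first by rewrite expr0 mulr1 mul1r.
rewrite (_ : (fun t => _) = (fun t => f t * f t ^+ n.+1)); last first.
  by apply/funext => t; rewrite exprS.
by apply: (has_deriv_eq (has_derivM df IH)); rewrite exprS -[n.+2%:R]natr1; ring.
Qed.

Lemma has_derivV f x a : f x != 0 -> has_deriv f x a ->
  has_deriv (fun t => (f t)^-1) x (- a / f x ^+ 2).
Proof.
move=> f0 df; apply: (has_deriv_eq (@is_deriveV _ f x a 1 f0 df)).
by rewrite /GRing.scale/= !mulNr mulrC.
Qed.

Lemma has_deriv_comp f g x a b :
  has_deriv f (g x) a -> has_deriv g x b ->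
  has_deriv (fun t => f (g t)) x (a * b).
Proof. by move=> df dg; exact: (@is_derive1_comp _ f g x a b df dg). Qed.

End derive_rules.

(** The value of the derivative is an existential variable filled in along the way; [has_deriv_eq]
    then leaves its comparison with the intended form to [ring] or [field]. Derivatives of
    non-polynomial parts are taken from the context. *)
Ltac deriv := first [ eassumption | eapply has_deriv_cst | eapply has_deriv_id
  | eapply has_derivD; [deriv|deriv] | eapply has_derivN; deriv
  | eapply has_derivX; deriv | eapply has_derivM; [deriv|deriv] ].

(** The remainder [h0] has second derivative [h2 t = F2 (y + t) - F2 y], bounded by [C |t|] through
    [F3] and by [2 C] through [F2]. Integrating each bound twice gives the cubic and the quadratic
    estimate. *)
Lemma taylor2_bound (R : realType) (F F1 F2 F3 : R -> R) (C y : R) :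
  (forall t : R, has_deriv F t (F1 t)) ->
  (forall t : R, has_deriv F1 t (F2 t)) ->
  (forall t : R, has_deriv F2 t (F3 t)) ->
  (forall t, `|F2 t| <= C) -> (forall t, `|F3 t| <= C) ->
  forall x, `|F (y + x) - F y - F1 y * x - F2 y * (x ^+ 2 / 2)| <=
    2 * C * Num.min (x ^+ 2) (`|x| ^+ 3).
Proof.
move=> d1 d2 d3 b2 b3 x.
have C0 : 0 <= C by exact: le_trans (b2 0).
have sh (G G' : R -> R) (t : R) : (forall t : R, has_deriv G t (G' t)) ->
    has_deriv (fun t => G (y + t)) t (G' (y + t)).
  move=> dG; rewrite -[G' _]mulr1; apply: (has_deriv_comp (dG _)).
  by apply: has_deriv_eq; [deriv|cbv beta; ring].
pose h2 t := F2 (y + t) - F2 y.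
pose h1 t := F1 (y + t) - F1 y - F2 y * t.
pose h0 t := F (y + t) - F y - F1 y * t - F2 y * (t ^+ 2 / 2).
have dh2 (t : R) : has_deriv h2 t (F3 (y + t)).
  by have ? := sh _ _ t d3; apply: has_deriv_eq; [rewrite /h2; deriv|cbv beta; ring].
have dh1 (t : R) : has_deriv h1 t (h2 t).
  have ? := sh _ _ t d2; apply: has_deriv_eq; first by rewrite /h1; deriv.
  by rewrite /h2; ring.
have dh0 (t : R) : has_deriv h0 t (h1 t).
  have ? := sh _ _ t d1; apply: has_deriv_eq; first by rewrite /h0; deriv.
  by rewrite /h1; field.
have z2 : h2 0 = 0 by rewrite /h2 addr0 subrr.
have z1 : h1 0 = 0 by rewrite /h1 addr0 subrr sub0r mulr0 oppr0.
have z0 : h0 0 = 0 by rewrite /h0 addr0 subrr expr0n/= mul0r !mulr0 !subr0.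
have B2 t : `|h2 t| <= C * `|t| ^+ 1.
  by apply: (derive_bound_power (n := 0) z2 (fun t _ _ => dh2 t)) => s _ _; rewrite expr0 mulr1.
have B2' t : `|h2 t| <= 2 * C * `|t| ^+ 0.
  rewrite expr0 mulr1 (le_trans (ler_normB _ _))// mulrDl mul1r lerD//.
have B1 t : `|h1 t| <= C * `|t| ^+ 2 by exact: derive_bound_power z1 (fun t _ _ => dh1 t) _.
have B1' t : `|h1 t| <= 2 * C * `|t| ^+ 1 by exact: derive_bound_power z1 (fun t _ _ => dh1 t) _.
have B0 t : `|h0 t| <= C * `|t| ^+ 3 by exact: derive_bound_power z0 (fun t _ _ => dh0 t) _.
have B0' t : `|h0 t| <= 2 * C * `|t| ^+ 2 by exact: derive_bound_power z0 (fun t _ _ => dh0 t) _.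
rewrite -/(h0 x); rewrite minEle; case: ifP => _.
  by have := B0' x; rewrite real_normK ?num_real.
apply: le_trans (B0 x) _; rewrite ler_wpM2r ?exprn_ge0//; lra.
Qed.

(** * The normal distribution function and the heat equation *)

Section gaussian.
Variable R : realType.
Implicit Types (x y a c s h r : R).

Definition gpdf : R -> R := normal_pdf 0 1.
Definition gcdf x : R := fine (normal_prob 0 1 `]-oo, x] : \bar R).

Lemma gpdfE x : gpdf x = normal_peak 1 * expR (- (x ^+ 2 / 2)).
Proof. by rewrite /gpdf normal_pdfE ?oner_neq0// /normal_fun subr0 expr1n mulNr. Qed.

Lemma gpdf_ge0 x : 0 <= gpdf x. Proof. exact: normal_pdf_ge0. Qed.

Lemma is_derive_gpdf x : has_deriv gpdf x (- x * gpdf x).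
Proof.
rewrite (_ : gpdf = (fun x => normal_peak 1 * expR (- (x ^+ 2 / 2)))); last first.
  by apply/funext => z; rewrite gpdfE.
have ? : has_deriv (fun x => expR (- (x ^+ 2 / 2))) x (expR (- (x ^+ 2 / 2)) * - x).
  apply: has_deriv_comp; first exact: is_derive_expR.
  by apply: has_deriv_eq; [deriv|cbv beta; field].
by apply: has_deriv_eq; [deriv|cbv beta; ring].
Qed.

Lemma is_derive_gcdf x : has_deriv gcdf x (gpdf x).
Proof.
have [||||d1 d2] := @continuous_FTC1 R gpdf -oo%O x (x + 1).
- by rewrite ltrDl.
- apply: (@integrableS _ _ R _ setT) => //.
  exact: integrable_normal_pdf.
- by rewrite ltNyr.
- by apply: continuous_normal_pdf; exact: oner_neq0.
- by apply: DeriveDef; [exact: d1|rewrite -derive1E].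
Qed.

(** Writing exp(-r^2/2) as exp(r^2/4)^(-2) and using exp(x) >= 1 + x reduces the bound to |r|^j <=
    16 (1 + r^2/4)^2 = 16 + 8 r^2 + r^4. *)
Lemma gpdf_moment (j : nat) r : (j <= 3)%N ->
  `|r| ^+ j * gpdf r <= 16 * normal_peak 1.
Proof.
move=> j3; rewrite gpdfE mulrCA mulrC ler_wpM2r ?normal_peak_ge0//.
have e0 : 0 < expR (r ^+ 2 / 4) by exact: expR_gt0.
have -> : expR (- (r ^+ 2 / 2)) = (expR (r ^+ 2 / 4) ^+ 2)^-1.
  by rewrite expRN; congr (_^-1); rewrite (expr2 (expR _)) -expRD; congr expR; field.
rewrite ler_pdivrMr ?exprn_gt0//.
have e1 : 1 + r ^+ 2 / 4 <= expR (r ^+ 2 / 4) by exact: expR_ge1Dx.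
have q0 : 0 <= `|r| by [].
have rr : r ^+ 2 = `|r| ^+ 2 by rewrite -normrX ger0_norm// sqr_ge0.
have {}e1 : (1 + r ^+ 2 / 4) ^+ 2 <= expR (r ^+ 2 / 4) ^+ 2.
  by rewrite lerXn2r ?nnegrE ?expR_ge0// addr_ge0// divr_ge0// sqr_ge0.
set E := expR _ ^+ 2 in e1 *; move: e1; rewrite rr.
set q := `|r| in q0 *; clearbody q E => e2.
apply: (@le_trans _ _ (16 * (1 + q ^+ 2 / 4) ^+ 2)); last by rewrite ler_wpM2l.
case: j j3 => [|[|[|[|//]]]] _; nra.
Qed.

End gaussian.

Section gaussian_cdf.
Context {R : realType}.
Implicit Types (x y a c : R).

Lemma gcdf_ge0 x : 0 <= gcdf x.
Proof. by rewrite /gcdf fine_ge0. Qed.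

Lemma gcdf_le1 x : gcdf x <= 1.
Proof. by rewrite /gcdf -lee_fin fineK ?fin_num_measure//; exact: probability_le1. Qed.

Lemma gcdf_le x y : x <= y -> gcdf x <= gcdf y.
Proof.
move=> xy; rewrite /gcdf fine_le ?fin_num_measure//.
by rewrite le_measure ?inE//; exact: subset_itvl.
Qed.

Lemma continuous_gcdf : continuous (@gcdf R).
Proof.
move=> x; apply: differentiable_continuous; apply/derivable1_diffP.
by have [] := is_derive_gcdf x.
Qed.

(** Under the normal law on the line, the identity is a random variable with distribution function
    [gcdf], whose limits at both infinities are read off it. *)
Let idR : {RV (normal_prob 0 1 : probability (measurableTypeR R) R) >-> R} :=
  MeasurableFun.Pack (MeasurableFun.Class
    (isMeasurableFun.Build _ _ (measurableTypeR R) R idfun (@measurable_id _ (measurableTypeR R) setT))).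

Lemma gcdf_cvgy : gcdf x @[x --> +oo] --> (1 : R).
Proof. by have /fine_cvg := cvg_cdfy1 idR. Qed.

Lemma gcdf_cvgNy : gcdf x @[x --> -oo] --> (0 : R).
Proof. by have /fine_cvg := cvg_cdfNy0 idR. Qed.

End gaussian_cdf.

Section heat.
Variable R : realType.
Implicit Types (x y a c s h r : R).

(* [gcdf ((a - y) / sqrt s)] solves the heat equation; its first two
   y-derivatives are [heat1] and [heat2]. *)
Definition heat a s y : R := gcdf ((a - y) / Num.sqrt s).
Definition heat1 a s y : R := - (gpdf ((a - y) / Num.sqrt s) / Num.sqrt s).
Definition heat2 a s y : R :=
  - (((a - y) / Num.sqrt s) * gpdf ((a - y) / Num.sqrt s) / s).
Definition heat3 a s y : R :=
  - (((a - y) / Num.sqrt s) ^+ 2 - 1) * gpdf ((a - y) / Num.sqrt s) / (s * Num.sqrt s).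
(** The derivative of [heat2] in [s], hence twice the second time derivative of [heat]; it controls
    the error of the first-order expansion in time. *)
Definition heat2s a s y : R := let r := (a - y) / Num.sqrt s in
  (3 * r / 2 - r ^+ 3 / 2) * gpdf r / s ^+ 2.

Lemma is_derive_scaled a s y :
  has_deriv (fun y => (a - y) / Num.sqrt s) y (- (Num.sqrt s)^-1).
Proof. by apply: has_deriv_eq; [deriv|cbv beta; ring]. Qed.

Lemma is_derive_heat a s y : has_deriv (heat a s) y (heat1 a s y).
Proof.
rewrite /heat /heat1 -mulrN.
exact: (has_deriv_comp (is_derive_gcdf _) (is_derive_scaled a s y)).
Qed.

Lemma is_derive_heat1 a s y : 0 < s -> has_deriv (heat1 a s) y (heat2 a s y).
Proof.
move=> s0; have q0 : Num.sqrt s != 0 by rewrite gt_eqF// sqrtr_gt0.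
have qq : s = Num.sqrt s ^+ 2 by rewrite sqr_sqrtr// ltW.
have dg := has_deriv_comp (is_derive_gpdf _) (is_derive_scaled a s y).
apply: has_deriv_eq; first by rewrite /heat1; deriv.
rewrite /heat2 [in X in _ = - (_ / X)]qq.
by move: (gpdf _) => G; move: (Num.sqrt s) q0 => q q0; field.
Qed.

Lemma is_derive_heat2 a s y : 0 < s -> has_deriv (heat2 a s) y (heat3 a s y).
Proof.
move=> s0; have q0 : Num.sqrt s != 0 by rewrite gt_eqF// sqrtr_gt0.
have qq : s = Num.sqrt s ^+ 2 by rewrite sqr_sqrtr// ltW.
have dr := is_derive_scaled a s y.
have dg := has_deriv_comp (is_derive_gpdf _) dr.
apply: has_deriv_eq; first by rewrite /heat2; deriv.
rewrite /heat3.
move: (gpdf _) => G; move: (Num.sqrt s) q0 => q q0; field.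
by rewrite q0 gt_eqF.
Qed.

Lemma is_derive_isqrt a y s : 0 < s ->
  has_deriv (fun s => (a - y) / Num.sqrt s) s (- ((a - y) / Num.sqrt s) / (2 * s)).
Proof.
move=> s0; have q0 : Num.sqrt s != 0 by rewrite gt_eqF// sqrtr_gt0.
have qq : s = Num.sqrt s ^+ 2 by rewrite sqr_sqrtr// ltW.
have di := has_derivV q0 ((is_derive1_sqrt s0 : has_deriv _ _ _)).
apply: has_deriv_eq; first by deriv.
rewrite [in X in _ = _ / (2 * X)]qq.
by move: (Num.sqrt s) q0 => q q0; field.
Qed.

Lemma is_derive_heats a y s : 0 < s ->
  has_deriv (heat a ^~ y) s (heat2 a s y / 2).
Proof.
move=> s0; rewrite /heat /heat2.
apply: (has_deriv_eq (has_deriv_comp (is_derive_gcdf _) (is_derive_isqrt a y s0))).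
by cbv beta; set r := _ / Num.sqrt s; move: (gpdf r) => G; move: r => r; field; rewrite gt_eqF.
Qed.

Lemma is_derive_heat2s a y s : 0 < s ->
  has_deriv (heat2 a ^~ y) s (heat2s a s y).
Proof.
move=> s0; rewrite /heat2 /heat2s.
have dr := is_derive_isqrt a y s0.
have dg := has_deriv_comp (is_derive_gpdf _) dr.
have di := has_derivV (lt0r_neq0 s0) (has_deriv_id s).
apply: has_deriv_eq; first by deriv.
by cbv beta; set r := _ / Num.sqrt s; move: (gpdf r) => G; move: r => r; field; rewrite gt_eqF.
Qed.

Lemma heat1_bound a c s y : 0 < c -> c <= s ->
  `|heat1 a s y| <= normal_peak 1 / Num.sqrt c.
Proof.
move=> c0 cs; have s0 : 0 < s by exact: lt_le_trans cs.
rewrite /heat1 normrN normrM normfV (ger0_norm (gpdf_ge0 _)) (ger0_norm (sqrtr_ge0 _)).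
rewrite ler_pM ?gpdf_ge0 ?invr_ge0 ?sqrtr_ge0//; first by rewrite normal_pdf_ub// oner_neq0.
by rewrite lef_pV2 ?posrE ?sqrtr_gt0// ler_wsqrtr.
Qed.

Lemma heat2_bound a c s y : 0 < c -> c <= s -> `|heat2 a s y| <= 16 * normal_peak 1 / c.
Proof.
move=> c0 cs; have s0 : 0 < s by exact: lt_le_trans cs.
rewrite /heat2; set r := _ / Num.sqrt s.
have := gpdf_moment r (isT : (1 <= 3)%N); have := gpdf_ge0 r.
move=> g0; rewrite expr1 => h.
rewrite normrN normrM normfV (gtr0_norm s0) normrM (ger0_norm g0).
by rewrite ler_pM ?mulr_ge0 ?invr_ge0 ?(ltW s0)// lef_pV2.
Qed.

Lemma heat3_bound a c s y : 0 < c -> c <= s ->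
  `|heat3 a s y| <= 32 * normal_peak 1 / (c * Num.sqrt c).
Proof.
move=> c0 cs; have s0 : 0 < s by exact: lt_le_trans cs.
have q0 : 0 < Num.sqrt c by rewrite sqrtr_gt0.
have q1 : 0 < Num.sqrt s by rewrite sqrtr_gt0.
rewrite /heat3; set r := _ / Num.sqrt s.
have := gpdf_moment r (isT : (2 <= 3)%N); have := gpdf_moment r (isT : (0 <= 3)%N).
have := gpdf_ge0 r.
move=> g0; rewrite expr0 mul1r => h1 h2.
rewrite normrM normfV (gtr0_norm (mulr_gt0 s0 q1)) normrM (ger0_norm g0).
rewrite ler_pM ?mulr_ge0 ?invr_ge0 ?(ltW s0) ?(ltW q1)//; last first; try by rewrite mulr_ge0 ?ltW.
  by rewrite lef_pV2 ?posrE ?mulr_gt0// ler_pM ?(ltW c0) ?(ltW q0)// ler_wsqrtr.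
have : `|- (r ^+ 2 - 1)| <= `|r| ^+ 2 + 1.
  by rewrite normrN (le_trans (ler_normB _ _))// normr1 normrX.
move=> /(ler_wpM2r g0)/le_trans; apply; rewrite mulrDl mul1r; lra.
Qed.

Lemma heat2s_bound a c s y : 0 < c -> c <= s ->
  `|heat2s a s y| <= 32 * normal_peak 1 / c ^+ 2.
Proof.
move=> c0 cs; have s0 : 0 < s by exact: lt_le_trans cs.
rewrite /heat2s; set r := _ / Num.sqrt s; rewrite /=.
have := gpdf_moment r (isT : (3 <= 3)%N); have := gpdf_moment r (isT : (1 <= 3)%N).
have := gpdf_ge0 r.
move=> g0; rewrite expr1 => h1 h2.
rewrite normrM normfV (gtr0_norm (exprn_gt0 2 s0)) normrM (ger0_norm g0).
rewrite ler_pM ?mulr_ge0 ?invr_ge0 ?exprn_ge0 ?(ltW s0)//; last first.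
  by rewrite lef_pV2 ?posrE ?exprn_gt0// lerXn2r// nnegrE ltW.
have : `|3 * r / 2 - r ^+ 3 / 2| <= 3 * `|r| / 2 + `|r| ^+ 3 / 2.
  by rewrite (le_trans (ler_normB _ _))// !normrM !normfV !(ger0_norm (ler0n _ _)) lerD// normrX.
move=> /(ler_wpM2r g0)/le_trans; apply; rewrite mulrDl; lra.
Qed.

(** Taylor's formula in [y] minus Taylor's formula in [s]. By the heat equation [x ^+ 2 / 2] and the
    time increment [h / 2] carry the same factor [heat2 a s y], and merge into a term that averages
    to 0 when [x] has second moment [h]. The constant is uniform because the derivative bounds hold
    for all times [s >= c]. *)
Lemma heat_step a c : 0 < c -> exists2 C, 0 <= C &
  forall s h y x, c <= s -> 0 <= h ->
  `|heat a s (y + x) - heat a (s + h) y - heat1 a s y * x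
     - heat2 a s y * ((x ^+ 2 - h) / 2)| <=
   C * (Num.min (x ^+ 2) (`|x| ^+ 3) + h ^+ 2).
Proof.
move=> c0; have p0 : 0 <= normal_peak 1 :> R by exact: normal_peak_ge0.
have q0 : 0 < Num.sqrt c by rewrite sqrtr_gt0.
pose C1 := 16 * normal_peak 1 / c + 32 * normal_peak 1 / (c * Num.sqrt c).
pose C2 := 32 * normal_peak 1 / c ^+ 2.
have C10 : 0 <= C1 by rewrite addr_ge0// divr_ge0 ?mulr_ge0 ?(ltW c0)//.
have C20 : 0 <= C2 by rewrite divr_ge0 ?mulr_ge0 ?exprn_ge0 ?(ltW c0)//.
exists (2 * C1 + C2); first by rewrite addr_ge0// mulr_ge0.
move=> s h y x cs h0; have s0 : 0 < s by exact: lt_le_trans cs.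
have T1 : `|heat a s (y + x) - heat a s y - heat1 a s y * x - heat2 a s y * (x ^+ 2 / 2)| <=
    2 * C1 * Num.min (x ^+ 2) (`|x| ^+ 3).
  apply: (@taylor2_bound _ (heat a s) (heat1 a s) (heat2 a s) (heat3 a s) _ y).
  - by move=> t; exact: is_derive_heat.
  - by move=> t; exact: is_derive_heat1.
  - by move=> t; exact: is_derive_heat2.
  - move=> t; apply: le_trans (heat2_bound _ _ c0 cs) _.
    by rewrite lerDl divr_ge0 ?mulr_ge0 ?(ltW c0)// ltW.
  - move=> t; apply: le_trans (heat3_bound _ _ c0 cs) _.
    by rewrite lerDr divr_ge0 ?mulr_ge0 ?(ltW c0)// ltW.
have sh (G : R -> R) (b t : R) : has_deriv G (s + t) b -> has_deriv (fun t => G (s + t)) t b.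
  move=> dG; rewrite -[b]mulr1; apply: (has_deriv_comp dG).
  by apply: (@has_deriv_eq R); [deriv|cbv beta; ring].
(* For [t = 0] the condition [0 <= u * t] says nothing, but then [|u| <= |t|] forces [u = 0]. *)
have sgn (u t : R) : 0 <= t -> `|u| <= `|t| -> 0 <= u * t -> 0 <= u.
  rewrite le_eqVlt => /predU1P[<-|t0 _]; last by rewrite (pmulr_lge0 _ t0).
  by rewrite normr0 normr_le0 => /eqP ->.
pose h1 t := heat2 a (s + t) y - heat2 a s y.
pose k0 t := heat a (s + t) y - heat a s y - heat2 a s y / 2 * t.
have B1 t : 0 <= t -> `|h1 t| <= C2 * `|t| ^+ 1.
  move=> t0; apply: (@derive_bound_power _ _ (fun t => heat2s a (s + t) y)).
  - by rewrite /h1 addr0 subrr.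
  - move=> u /(sgn _ _ t0)/[apply] u0.
    have su : 0 < s + u by rewrite ltr_wpDr.
    have ? := sh _ _ _ (is_derive_heat2s a y su).
    by apply: (@has_deriv_eq R); [rewrite /h1; deriv|cbv beta; ring].
  - move=> u /(sgn _ _ t0)/[apply] u0.
    by rewrite expr0 mulr1; apply: heat2s_bound => //; rewrite (le_trans cs)// lerDl.
have T2 : `|k0 h| <= C2 * `|h| ^+ 2.
  apply: (@derive_bound_power _ _ (fun t => h1 t / 2)).
  - by rewrite /k0 addr0 subrr mulr0 subr0.
  - move=> u /(sgn _ _ h0)/[apply] u0.
    have su : 0 < s + u by rewrite ltr_wpDr.
    have ? := sh _ _ _ (is_derive_heats a y su).
    apply: (@has_deriv_eq R); first by rewrite /k0; deriv.
    by rewrite /h1; field.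
  - move=> u /(sgn _ _ h0)/[apply] u0; apply: le_trans (B1 _ u0).
    by rewrite normrM [X in _ * X]ger0_norm ?invr_ge0// ler_piMr// invf_le1 ?ler1n.
rewrite (_ : _ - _ = (heat a s (y + x) - heat a s y - heat1 a s y * x - heat2 a s y * (x ^+ 2 / 2)) - k0 h); last first.
  by rewrite /k0; field.
apply: (le_trans (ler_normB _ _)); rewrite mulrDr lerD//.
  apply: (le_trans T1); rewrite ler_wpM2r// ?lerDl//.
  by rewrite le_min sqr_ge0 exprn_ge0.
apply: (le_trans T2); rewrite -normrX ger0_norm ?sqr_ge0// ler_wpM2r ?sqr_ge0//.
by rewrite lerDr mulr_ge0.
Qed.

Lemma heat_le1 (a c y : R) : `|heat a c y| <= 1.
Proof. by rewrite /heat ger0_norm ?gcdf_ge0 ?gcdf_le1. Qed.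

(** Beyond [a] the argument of [gcdf] is at most [- (e / Num.sqrt c)], which the subtracted term
    pays for; up to [a] it is enough that [heat] is at most 1. With the mirror image [heat_above],
    the indicator is trapped between two smooth functions. *)
Lemma heat_below (a e c y : R) : 0 < c ->
  heat (a - e) c y - gcdf (- (e / Num.sqrt c)) <= (y <= a)%R%:R.
Proof.
move=> c0; have q0 : 0 < Num.sqrt c by rewrite sqrtr_gt0.
have [ya|ya] := leP y a.
  by rewrite lerBlDr (le_trans (gcdf_le1 _))// lerDl gcdf_ge0.
rewrite subr_le0; apply: gcdf_le; rewrite -mulNr ler_pM2r; last by rewrite invr_gt0.
lra.
Qed.

Lemma heat_above (a e c y : R) : 0 < c ->
  (y <= a)%R%:R <= heat (a + e) c y + (1 - gcdf (e / Num.sqrt c)).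
Proof.
move=> c0; have q0 : 0 < Num.sqrt c by rewrite sqrtr_gt0.
have [ya|ya] := leP y a.
  rewrite addrCA lerDl subr_ge0; apply: gcdf_le; rewrite ler_pM2r; last by rewrite invr_gt0.
  lra.
by rewrite addr_ge0 ?gcdf_ge0// subr_ge0 gcdf_le1.
Qed.

End heat.

Lemma normal_prob_itv (R : realType) (a b : R) :
  fine (normal_prob 0 1 `]a, b] : \bar R) = if a <= b then gcdf b - gcdf a else 0.
Proof.
case: leP => ab; last by rewrite set_itv_ge ?measure0// bnd_simp -leNgt ltW.
apply/eqP; rewrite eq_sym subr_eq; apply/eqP; rewrite /gcdf.
rewrite -fineD ?fin_num_measure// -measureU//.
- congr (fine (_ _)); apply/seteqP; split => x /=; rewrite !in_itv/=.
    by case: (leP x a) => xa xb; [right|left].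
  by case => [/andP[]|/le_trans]; [|exact].
- apply/seteqP; split => // x [] /=; rewrite !in_itv/= => /andP[xa _].
  by rewrite leNgt xa.
Qed.

(** * Lindeberg replacement *)

Section probability_integral.
Context (R : realType) d (O : measurableType d) (P : probability O R).

Lemma probability_setT_lty : (P setT < +oo)%E.
Proof. by rewrite (le_lt_trans (probability_le1 _ _)) ?ltry. Qed.

Lemma Rintegral_probability_cst (r : R) : \int[P]_w r = r.
Proof.
rewrite Rintegral_cst// (_ : fine _ = 1) ?mulr1//.
by rewrite -[RHS]/(fine 1%E); congr fine; exact: probability_setT.
Qed.

Lemma integrable_bounded (f : O -> R) (M : R) :
  measurable_fun setT f -> (forall w, `|f w| <= M) -> P.-integrable setT (EFin \o f).
Proof.
move=> mf fM; apply: measurable_bounded_integrable => //.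
  exact: probability_setT_lty.
by exists M; split => [|x /ltW Mx w _]; [exact: num_real|exact: le_trans Mx].
Qed.

End probability_integral.

(** * Independence of a partial sum and the next summand *)

Section independence.
Context (R : realType) d (O : measurableType d) (P : probability O R).

Lemma measure_prod_unique d1 d2 (T1 : measurableType d1) (T2 : measurableType d2)
    (m1 m2 : {measure set (T1 * T2) -> \bar R}) :
  (m1 setT < +oo)%E ->
  (forall A B, measurable A -> measurable B -> m1 (A `*` B) = m2 (A `*` B)) ->
  forall W, measurable W -> m1 W = m2 W.
Proof.
move=> m1oo m12 W mW.
apply: (measure_unique [set A `*` B | A in measurable & B in measurable] (fun=> setT)) => //.
- exact: measurable_prod_measurableType.
- move=> _ _ [A mA [B mB <-]] [A' mA' [B' mB' <-]].
  exists (A `&` A'); first exact: measurableI.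
  by exists (B `&` B'); [exact: measurableI|rewrite setXI].
- by move=> _; exists setT => //; exists setT => //; rewrite setXTT.
- exact: bigcup_const.
- by move=> _ [A mA [B mB <-]]; exact: m12.
Qed.

(** Both sides are finite measures of [W]: the images under (U, V) of [P] restricted to [F] and of
    [P] scaled by [P F]. They agree on rectangles, hence everywhere. *)
Lemma indep_event_pair (U V : O -> R) (F : set O) :
  measurable_fun setT U -> measurable_fun setT V -> measurable F ->
  (forall A B, measurable A -> measurable B ->
    P (U @^-1` A `&` V @^-1` B `&` F) = P (U @^-1` A `&` V @^-1` B) * P F)%E ->
  forall W : set (R * R), measurable W ->
    P ((fun w => (U w, V w)) @^-1` W `&` F) = (P ((fun w => (U w, V w)) @^-1` W) * P F)%E.
Proof.
move=> mU mV mF UVF W mW.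
have mUV : measurable_fun setT (fun w => (U w, V w)) by exact: measurable_fun_pair.
pose m1_ := [the {measure set (R * R)%type -> \bar R} of
  pushforward (mrestr P mF) (fun w => (U w, V w))].
have p0 : 0 <= fine (P F) by rewrite fine_ge0.
pose p := NngNum p0.
pose m2_ := [the {measure set (R * R)%type -> \bar R} of
  pushforward (mscale p P) (fun w => (U w, V w))].
rewrite muleC; have := @measure_prod_unique _ _ _ _ (m1_ mUV) (m2_ mUV).
rewrite /m1_ /m2_/= /pushforward /mrestr /mscale/= fineK ?fin_num_measure//.
apply=> //.
  by rewrite (le_lt_trans (probability_le1 _ _)) ?ltry//= preimage_setT setTI.
by move=> A B mA mB; rewrite muleC -UVF.
Qed.

(** Independence means that (U, V) has the same law under [P] as [(U z.1, V z.2)] under [P \x P],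
    where Fubini's theorem splits the integral. Boundedness of [g] and integrability of [k \o V]
    give the integrability that the theorem requires. *)
Lemma indep_pair_expectation (U V : O -> R) (g k : R -> R) :
  measurable_fun setT U -> measurable_fun setT V ->
  measurable_fun setT g -> measurable_fun setT k ->
  (forall A B, measurable A -> measurable B ->
    P (U @^-1` A `&` V @^-1` B) = P (U @^-1` A) * P (V @^-1` B))%E ->
  [bounded g x | x in setT] -> P.-integrable setT (EFin \o k \o V) ->
  \int[P]_w (g (U w) * k (V w)) = \int[P]_w g (U w) * \int[P]_w k (V w).
Proof.
move=> mU mV mg mk UV [M [_ bg]] ik.
have {bg}bg x : `|g x| <= `|M| + 1.
  by apply: bg => //; rewrite (le_lt_trans (ler_norm M))// ltrDl.
have mgU : measurable_fun setT (g \o U) by exact: measurableT_comp.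
have mkV : measurable_fun setT (k \o V) by exact: measurableT_comp.
have mUV : measurable_fun setT (fun w => (U w, V w)) by exact: measurable_fun_pair.
have mUV' : measurable_fun setT (fun z : O * O => (U z.1, V z.2)).
  by apply: measurable_fun_pair; exact: measurableT_comp.
pose m1_ := [the {measure set (R * R)%type -> \bar R} of
  pushforward P (fun w => (U w, V w))].
pose m2_ := [the {measure set (R * R)%type -> \bar R} of
  pushforward (P \x P)%E (fun z : O * O => (U z.1, V z.2))].
have m12 W : measurable W -> m1_ mUV W = m2_ mUV' W.
  apply: measure_prod_unique => [|A B mA mB].
    by rewrite /m1_/= /pushforward (le_lt_trans (probability_le1 _ _)) ?ltry//= preimage_setT.
  rewrite /m1_ /m2_/= /pushforward.
  rewrite (_ : _ @^-1` _ = U @^-1` A `&` V @^-1` B)// UV//.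
  rewrite (_ : _ @^-1` _ = (U @^-1` A) `*` (V @^-1` B))// product_measure1E//.
    by rewrite -[X in measurable X]setTI; exact: mU.
  by rewrite -[X in measurable X]setTI; exact: mV.
have mgk : measurable_fun setT (fun z : R * R => g z.1 * k z.2).
  by apply: measurable_funM; exact: measurableT_comp.
have igk : P.-integrable setT (EFin \o (fun w => g (U w) * k (V w))).
  apply: (@le_integrable _ _ _ _ _ _ _ (fun w => ((`|M| + 1)%:E * `|k (V w)|%:E)%E)) => //.
  - by apply/measurable_EFinP; exact: measurable_funM.
  - move=> w _ /=; rewrite lee_fin [leRHS]ger0_norm ?mulr_ge0 ?addr_ge0// normrM.
    by rewrite ler_wpM2r.
  - by apply: integrableZl => //; exact: integrable_abse ik.
have igk2 : (P \x P)%E.-integrable setT (fun z => (g (U z.1) * k (V z.2))%:E).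
  have m2 : measurable_fun setT (fun z : O * O => (g (U z.1) * k (V z.2))%:E).
    by apply/measurable_EFinP; apply: measurable_funM; apply: measurableT_comp => //;
      exact: measurableT_comp.
  apply/integrable12ltyP => //=.
  apply: (@le_lt_trans _ _ (\int[P]_x ((`|M| + 1)%:E * \int[P]_y `|(k (V y))%:E|))%E).
    apply: ge0_le_integral => //.
    - by move=> x _; exact: integral_ge0.
    - apply: (@measurable_fun_fubini_tonelli_F _ _ _ _ _ P (fun z => `|(g (U z.1) * k (V z.2))%:E|%E)) => //.
      exact: measurableT_comp.
    - move=> x _; rewrite -ge0_integralZl//; last first.
      + by apply: measurableT_comp => //; apply/measurable_EFinP.
      apply: ge0_le_integral => //.
      + apply/measurable_EFinP; apply: measurableT_comp => //; apply: measurable_funM => //.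
      + apply: emeasurable_funM => //; apply: measurableT_comp => //; exact/measurable_EFinP.
      + by move=> y _; rewrite -EFinM lee_fin normrM ler_wpM2r.
  move/integrableP : ik => [_ ik].
  rewrite integral_cst//; apply: lte_mul_pinfty => //.
  - by rewrite mule_ge0 ?lee_fin ?addr_ge0//; exact: integral_ge0.
  - rewrite fin_numM// ge0_fin_numE//; exact: integral_ge0.
  - exact: probability_setT_lty.
have E1 : (\int[P]_w (g (U w) * k (V w))%:E = \int[m1_ mUV]_z (g z.1 * k z.2)%:E)%E.
  rewrite /m1_/= integral_pushforward//; exact/measurable_EFinP.
have E2 : (\int[(P \x P)%E]_z (g (U z.1) * k (V z.2))%:E = \int[m2_ mUV']_z (g z.1 * k z.2)%:E)%E.
  rewrite /m2_/= integral_pushforward//; exact/measurable_EFinP.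
have E3 : (\int[m1_ mUV]_z (g z.1 * k z.2)%:E = \int[m2_ mUV']_z (g z.1 * k z.2)%:E)%E.
  by apply: eq_measure_integral => W mW _; exact: m12.
have fk : (\int[P]_w (k (V w))%:E)%E \is a fin_num by exact: integrable_fin_num ik.
have igU : P.-integrable setT (EFin \o (g \o U)).
  exact: (integrable_bounded P mgU (fun w => bg (U w))).
rewrite /Rintegral E1 E3 -E2 -(integral12_prod_meas1 igk2).
transitivity (fine (\int[P]_x ((g (U x))%:E * (\int[P]_w (k (V w))%:E)))%E).
  congr fine; apply: eq_integral => x _ /=.
  by rewrite -integralZl.
rewrite -(fineK fk) integralZr// fineM//.
exact: integrable_fin_num igU.
Qed.

Definition partial_sum k (xi : 'I_k -> O -> R) (j : nat) (w : O) : R :=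
  \sum_(i < k | (i < j)%N) xi i w.

Lemma measurable_partial_sum k (xi : 'I_k -> O -> R) j :
  (forall i, measurable_fun setT (xi i)) -> measurable_fun setT (partial_sum xi j).
Proof.
move=> mxi; rewrite (_ : partial_sum xi j =
    (fun w => \sum_(i <- [seq i : 'I_k <- index_enum 'I_k | (i < j)%N]) xi i w)).
  exact: measurable_sum.
by apply/funext => w; rewrite /partial_sum big_filter.
Qed.

Lemma partial_sumS k (xi : 'I_k -> O -> R) (j : 'I_k) w :
  partial_sum xi j.+1 w = partial_sum xi j w + xi j w.
Proof.
rewrite /partial_sum (bigD1 j) //= addrC; congr (_ + _); apply: eq_bigl => i.
by rewrite ltnS andbC ltn_neqAle -(inj_eq val_inj).
Qed.

Let cylinder k (xi : 'I_k -> O -> R) (B : 'I_k -> set R) : set O :=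
  [set w | forall i, B i (xi i w)].

Let update k (B : 'I_k -> set R) (j : 'I_k) (B0 : set R) (i : 'I_k) : set R :=
  if i == j then B0 else B i.

Let measurable_cylinder k (xi : 'I_k -> O -> R) B :
  (forall i, measurable_fun setT (xi i)) -> (forall i, measurable (B i)) ->
  measurable (cylinder xi B).
Proof.
move=> mxi mB; rewrite (_ : cylinder xi B =
    \bigcap_(i in [set: 'I_k]) (xi i @^-1` B i)); last first.
  by apply/seteqP; split => w /= h i => [?|]; exact: h.
apply: fin_bigcap_measurable; first exact: finite_finset.
by move=> i _; rewrite -[X in measurable X]setTI; exact: mxi.
Qed.

Let cylinder_update k (xi : 'I_k -> O -> R) B j B0 : B j = setT ->
  cylinder xi (update B j B0) = xi j @^-1` B0 `&` cylinder xi B.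
Proof.
move=> Bj; apply/seteqP; split => w /=.
  move=> h; split; first by have := h j; rewrite /update eqxx.
  by move=> i; have := h i; rewrite /update; case: eqVneq => // ->; rewrite Bj.
by move=> [h1 h2] i; rewrite /update; case: eqVneq => [->//|ij].
Qed.

Let indep_cylinder k (xi : 'I_k -> O -> R) B j B0 :
  mutually_independent P xi -> (forall i, measurable (B i)) -> measurable B0 ->
  B j = setT ->
  P (xi j @^-1` B0 `&` cylinder xi B) = (P (xi j @^-1` B0) * P (cylinder xi B))%E.
Proof.
move=> indep mB mB0 Bj; rewrite -cylinder_update//.
have mU i : measurable (update B j B0 i) by rewrite /update; case: ifP.
rewrite /cylinder !indep// (bigD1 j)//= [in RHS](bigD1 j)//= /update eqxx Bj.
rewrite preimage_setT probability_setT mul1e; congr (_ * _)%E.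
by apply: eq_bigr => i /negbTE ->.
Qed.

(** Induction on [j]: the pair of the old partial sum and summand [j] is independent of a cylinder
    on later summands, since it is so on rectangles, and the new partial sum is a function of that
    pair. Cylinders on all later summands, not only the next one, make the induction hypothesis
    strong enough. *)
Lemma indep_partial_sum_cylinder k (xi : 'I_k -> O -> R) j A B :
  (forall i, measurable_fun setT (xi i)) -> mutually_independent P xi ->
  (j <= k)%N -> measurable A -> (forall i, measurable (B i)) ->
  (forall i : 'I_k, (i < j)%N -> B i = setT) ->
  P (partial_sum xi j @^-1` A `&` cylinder xi B) =
  (P (partial_sum xi j @^-1` A) * P (cylinder xi B))%E.
Proof.
move=> mxi indep; elim: j A B => [|j IH] A B jk mA mB Bj.
  have -> : partial_sum xi 0 @^-1` A = [set w | A 0].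
    by apply/seteqP; split => w /=; rewrite /partial_sum big_pred0.
  have [A0|A0] := pselect (A 0).
    by rewrite (_ : [set _ | _] = setT) ?setTI ?probability_setT ?mul1e//; apply/seteqP; split.
  by rewrite (_ : [set w | A 0] = set0) ?set0I ?measure0 ?mul0e//; apply/seteqP; split.
pose jj := Ordinal jk.
have Bjj : B jj = setT by exact: Bj.
have mupd B' B0 : (forall i, measurable (B' i)) -> measurable B0 ->
    forall i, measurable (update B' jj B0 i).
  by move=> mB' mB0 i; rewrite /update; case: ifP.
have updT B' B0 : (forall i : 'I_k, (i < j)%N -> B' i = setT) ->
    forall i : 'I_k, (i < j)%N -> update B' jj B0 i = setT.
  move=> BT i ij; rewrite /update; case: eqVneq => [ijj|_]; last exact: BT.
  by move: ij; rewrite ijj ltnn.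
have BjT (i : 'I_k) : (i < j)%N -> B i = setT by move=> ij; apply: Bj; exact: ltnW.
have cT : cylinder xi (fun=> setT) = setT by apply/seteqP; split.
have := @indep_event_pair (partial_sum xi j) (xi jj) (cylinder xi B)
  (measurable_partial_sum _ mxi) (mxi _) (measurable_cylinder mxi mB).
(* The induction hypothesis serves twice: with [B0] added to the cylinder at index [jj], and with
   [B0] as the only constraint. *)
have step A0 B0 : measurable A0 -> measurable B0 ->
    (P (partial_sum xi j @^-1` A0 `&` xi jj @^-1` B0 `&` cylinder xi B) =
     P (partial_sum xi j @^-1` A0 `&` xi jj @^-1` B0) * P (cylinder xi B))%E.
  move=> mA0 mB0; rewrite -setIA -cylinder_update// IH ?(ltnW jk)//; last 2 first.
  - exact: mupd.
  - exact: updT.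
  rewrite cylinder_update// indep_cylinder// muleA; congr (_ * _)%E.
  rewrite -[xi jj @^-1` B0]setIT -cT -(@cylinder_update _ _ (fun=> setT))// IH ?(ltnW jk)//.
  - exact: mupd.
  - exact: updT.
move=> /(_ step) /(_ ((fun z : R * R => z.1 + z.2) @^-1` A)).
have -> : (fun w => (partial_sum xi j w, xi jj w)) @^-1` ((fun z : R * R => z.1 + z.2) @^-1` A)
    = partial_sum xi j.+1 @^-1` A.
  by apply/seteqP; split => w /=; rewrite (partial_sumS xi jj).
apply; rewrite -[X in measurable X]setTI.
by apply: (@measurable_funD _ _ R setT fst snd).
Qed.

Lemma indep_partial_sum k (xi : 'I_k -> O -> R) (j : 'I_k) :
  (forall i, measurable_fun setT (xi i)) -> mutually_independent P xi ->
  forall A B, measurable A -> measurable B ->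
  P (partial_sum xi j @^-1` A `&` xi j @^-1` B) =
  (P (partial_sum xi j @^-1` A) * P (xi j @^-1` B))%E.
Proof.
move=> mxi indep A B mA mB.
have cT : cylinder xi (fun=> setT) = setT by apply/seteqP; split.
have := @indep_partial_sum_cylinder k xi j A (update (fun=> setT) j B) mxi indep (ltnW (ltn_ord j)) mA.
rewrite cylinder_update// cT setIT; apply.
  by move=> i; rewrite /update; case: ifP.
by move=> i ij; rewrite /update; case: eqVneq => // ijj; move: ij; rewrite ijj ltnn.
Qed.

End independence.

Section lindeberg.
Context (R : realType) d (O : measurableType d) (P : probability O R).

Lemma has_deriv_measurable (f f' : R -> R) : (forall x, has_deriv f x (f' x)) ->
  measurable_fun setT f.
Proof.
move=> df; apply: continuous_measurable_fun => x.
apply: differentiable_continuous; apply/derivable1_diffP.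
by have [] := df x.
Qed.

(** With S_j the sum of the first j summands, E[heat a (c + h (k - j)) S_j] runs from
    [heat a (c + h *+ k) 0] at j = 0 to the expectation at the full sum and time [c] at j = k. In
    each step the terms of order one and two in [heat_step] are products of a function of S_j and a
    centred function of [xi j], independent of S_j, so only the remainder counts. [C] depends on [a]
    and [c] alone and thus serves all rows of an array. *)
Lemma lindeberg_swap (a c : R) : 0 < c -> exists2 C : R, 0 <= C &
  forall k (xi : 'I_k -> O -> R) (h eps : R),
  (forall i, measurable_fun setT (xi i)) -> mutually_independent P xi ->
  0 <= h ->
  (forall i, P.-integrable setT (EFin \o xi i)) ->
  (forall i, P.-integrable setT (EFin \o (fun w => xi i w ^+ 2))) ->
  (forall i, \int[P]_w xi i w = 0) ->
  (forall i, \int[P]_w (xi i w ^+ 2) = h) ->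
  (forall i, \int[P]_w Num.min (xi i w ^+ 2) (`|xi i w| ^+ 3) <= eps) ->
  `|\int[P]_w heat a c (\sum_i xi i w) - heat a (c + h *+ k) 0| <=
    C * (eps + h ^+ 2) *+ k.
Proof.
move=> c0; have [C C0 step] := heat_step a c0; exists C => //.
move=> k xi h eps mxi indep h0 i1 i2 E1 E2 E3.
pose s j : R := c + h *+ (k - j).
pose S j w := partial_sum xi j w.
have cs j : c <= s j by rewrite lerDl mulrn_wge0.
have s0 j : 0 < s j by exact: lt_le_trans (cs j).
have mheat t : measurable_fun setT (heat a t).
  by apply: has_deriv_measurable => x; exact: is_derive_heat.
have mheat1 t : 0 < t -> measurable_fun setT (heat1 a t).
  by move=> t0; apply: has_deriv_measurable => x; exact: is_derive_heat1.
have mheat2 t : 0 < t -> measurable_fun setT (heat2 a t).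
  by move=> t0; apply: has_deriv_measurable => x; exact: is_derive_heat2.
have mS j : measurable_fun setT (S j) by exact: measurable_partial_sum.
have bheat t y : `|heat a t y| <= 1.
  exact: heat_le1.
have bheat1 t y : c <= t -> `|heat1 a t y| <= normal_peak 1 / Num.sqrt c.
  exact: heat1_bound.
have iheat t (U : O -> R) : measurable_fun setT U -> P.-integrable setT (EFin \o (heat a t \o U)).
  by move=> mU; apply: (@integrable_bounded _ _ _ _ _ 1) => [|w]; [exact: measurableT_comp|exact: bheat].
have one (j : 'I_k) : `|\int[P]_w heat a (s j.+1) (S j.+1 w) - \int[P]_w heat a (s j) (S j w)| <=
    C * (eps + h ^+ 2).
  have sS : s j = s j.+1 + h.
    by rewrite /s -addrA -mulrSr -subSn ?subSS// ltn_ord.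
  set t := s j.+1 in sS *; have ct : c <= t by exact: cs.
  have t0 : 0 < t by exact: s0.
  have ih : P.-integrable setT (EFin \o (fun=> h)).
    exact: (@integrable_bounded _ _ _ _ _ `|h|).
  have ihh : P.-integrable setT (EFin \o (fun=> h ^+ 2)).
    exact: (@integrable_bounded _ _ _ _ _ `|h ^+ 2|).
  have ixh : P.-integrable setT (EFin \o (fun w => xi j w ^+ 2 - h)).
    exact: integrableB (i2 j) ih.
  have ix2h : P.-integrable setT (EFin \o (fun w => (xi j w ^+ 2 - h) / 2)).
    exact: integrableZr ixh.
  have ex2h : \int[P]_w ((xi j w ^+ 2 - h) / 2) = 0.
    rewrite (RintegralZr _ measurableT ixh) (RintegralB measurableT (i2 j) ih).
    by rewrite E2 Rintegral_probability_cst subrr mul0r.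
  have i01 : P.-integrable setT (EFin \o (fun w => heat1 a t (S j w) * xi j w)).
    apply: (@le_integrable _ _ _ _ _ _ _ (fun w => ((normal_peak 1 / Num.sqrt c)%:E * (xi j w)%:E)%E)) => //.
    - apply/measurable_EFinP; apply: measurable_funM => //.
      by apply: measurableT_comp => //; exact: mheat1.
    - move=> w _; rewrite /= lee_fin !normrM ler_wpM2r//.
      by rewrite -normrM (le_trans (bheat1 _ _ ct))// ler_norm.
    - by apply: integrableZl => //; exact: i1.
  have i02 : P.-integrable setT (EFin \o (fun w => heat2 a t (S j w) * ((xi j w ^+ 2 - h) / 2))).
    apply: (@le_integrable _ _ _ _ _ _ _ (fun w => ((16 * normal_peak 1 / c)%:E * ((xi j w ^+ 2 - h) / 2)%:E)%E)) => //.
    - apply/measurable_EFinP; apply: measurable_funM => //.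
        by apply: measurableT_comp => //; exact: mheat2.
      by have /integrableP[/measurable_EFinP] := ix2h.
    - move=> w _; rewrite /= lee_fin [leLHS]normrM [leRHS]normrM ler_wpM2r//.
      by rewrite (le_trans (heat2_bound _ _ c0 ct))// ler_norm.
    - exact: integrableZl.
  have i03 : P.-integrable setT (EFin \o (fun w => heat a t (S j.+1 w))) by exact: iheat.
  have i04 : P.-integrable setT (EFin \o (fun w => heat a (t + h) (S j w))) by exact: iheat.
  have e01 : \int[P]_w (heat1 a t (S j w) * xi j w) = 0.
    rewrite (@indep_pair_expectation _ _ _ P (S j) (xi j) (heat1 a t) id)//.
    - by rewrite E1 mulr0.
    - exact: mheat1.
    - exact: indep_partial_sum.
    - exists (normal_peak 1 / Num.sqrt c); split; first exact: num_real.
      by move=> x /ltW xM y _; exact: le_trans (bheat1 _ _ ct) xM.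
  have e02 : \int[P]_w (heat2 a t (S j w) * ((xi j w ^+ 2 - h) / 2)) = 0.
    rewrite (@indep_pair_expectation _ _ _ P (S j) (xi j) (heat2 a t) (fun x => (x ^+ 2 - h) / 2))//.
    - by rewrite ex2h mulr0.
    - exact: mheat2.
    - by apply: measurable_funM => //; apply: measurable_funB.
    - exact: indep_partial_sum.
    - exists (16 * normal_peak 1 / c); split; first exact: num_real.
      by move=> x /ltW xM y _; exact: le_trans (heat2_bound _ _ c0 ct) xM.
  (* The last two terms have mean 0, so [D] has the expectation of the increment and is the quantity
     that [heat_step] bounds pointwise. *)
  pose D w := heat a t (S j.+1 w) - heat a (t + h) (S j w) - heat1 a t (S j w) * xi j w
     - heat2 a t (S j w) * ((xi j w ^+ 2 - h) / 2).
  have i05 : P.-integrable setT (EFin \o (fun w => heat a t (S j.+1 w) - heat a (t + h) (S j w))).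
    exact: integrableB i03 i04.
  have i06 : P.-integrable setT (EFin \o (fun w => heat a t (S j.+1 w) - heat a (t + h) (S j w) - heat1 a t (S j w) * xi j w)).
    exact: integrableB i05 i01.
  have iD : P.-integrable setT (EFin \o D) by exact: integrableB i06 i02.
  have -> : \int[P]_w heat a t (S j.+1 w) - \int[P]_w heat a (s j) (S j w) = \int[P]_w D w.
    rewrite sS /D; rewrite (RintegralB measurableT i06 i02) e02 subr0.
    by rewrite (RintegralB measurableT i05 i01) e01 subr0 (RintegralB measurableT i03 i04).
  apply: (le_trans (le_normr_Rintegral measurableT iD)).
  have imin : P.-integrable setT (EFin \o (fun w => Num.min (xi j w ^+ 2) (`|xi j w| ^+ 3))).
    apply: (le_integrable measurableT _ _ (i2 j)).
      by apply/measurable_EFinP; apply: measurable_minr; apply: measurable_funX => //;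
        apply: measurableT_comp.
    move=> w _; rewrite /= lee_fin [leLHS]ger0_norm ?le_min ?sqr_ge0 ?exprn_ge0//.
    by rewrite [leRHS]ger0_norm ?sqr_ge0// ge_min lexx.
  have imh : P.-integrable setT (EFin \o (fun w => Num.min (xi j w ^+ 2) (`|xi j w| ^+ 3) + h ^+ 2)).
    exact: integrableD imin ihh.
  apply: (@le_trans _ _ (\int[P]_w (C * (Num.min (xi j w ^+ 2) (`|xi j w| ^+ 3) + h ^+ 2)))).
    apply: le_Rintegral => //.
    - exact: integrable_abse iD.
    - exact: (integrableZl measurableT C imh).
    - by move=> w _; rewrite /D /S (partial_sumS xi j); exact: step.
  rewrite (RintegralZl _ measurableT imh) ler_wpM2l// (RintegralD measurableT imin ihh).
  by rewrite Rintegral_probability_cst lerD2r.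
have tele j : (j <= k)%N -> `|\int[P]_w heat a (s j) (S j w) - heat a (c + h *+ k) 0| <=
    C * (eps + h ^+ 2) *+ j.
  elim: j => [_|j IH jk].
    rewrite mulr0n /s subn0 (_ : \int[P]_w _ = heat a (c + h *+ k) 0) ?subrr ?normr0//.
    rewrite (@eq_Rintegral _ _ _ _ _ (fun=> heat a (c + h *+ k) 0)); last first.
      by move=> w _; rewrite /S /partial_sum big_pred0.
    exact: Rintegral_probability_cst.
  rewrite mulrSr; apply: (le_trans (ler_distD (\int[P]_w heat a (s j) (S j w)) _ _)).
  by rewrite addrC lerD// ?IH ?(ltnW jk)//; exact: (one (Ordinal jk)).
have := tele k (leqnn _); rewrite /s subnn mulr0n addr0.
rewrite (@eq_Rintegral _ _ _ _ _ (fun w => heat a c (\sum_i xi i w)))//.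
by move=> w _; rewrite /S /partial_sum; congr heat; apply: eq_bigl => i; rewrite ltn_ord.
Qed.

End lindeberg.

(** * The central limit theorem for triangular arrays *)

Section clt.
Context (R : realType) d (O : measurableType d) (P : probability O R).

Lemma cdf_sandwich_fun (S : O -> R) (g1 g2 : R -> R) (r1 r2 a : R) :
  measurable_fun setT S -> measurable_fun setT g1 -> measurable_fun setT g2 ->
  (forall y, `|g1 y| <= 1) -> (forall y, `|g2 y| <= 1) ->
  (forall y, g1 y - r1 <= (y <= a)%R%:R) ->
  (forall y, (y <= a)%R%:R <= g2 y + r2) ->
  \int[P]_w g1 (S w) - r1 <= fine (P [set w | S w <= a]) <=
  \int[P]_w g2 (S w) + r2.
Proof.
move=> mS mg1 mg2 b1 b2 l1 l2.
have mA : measurable [set w | S w <= a].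
  by rewrite -[X in measurable X]setTI; exact: measurable_fun_le.
have i1 : P.-integrable setT (EFin \o (fun w => g1 (S w))).
  by apply: (integrable_bounded P (M := 1)) => //; exact: measurableT_comp.
have i2 : P.-integrable setT (EFin \o (fun w => g2 (S w))).
  by apply: (integrable_bounded P (M := 1)) => //; exact: measurableT_comp.
have iA : P.-integrable setT (EFin \o (\1_[set w | S w <= a] : O -> R)).
  apply: (integrable_bounded P (M := 1)) => // w.
  by rewrite indicE; case: (_ \in _); rewrite ?normr0 ?normr1.
have ic (b : R) : P.-integrable setT (EFin \o (fun=> b)).
  exact: (integrable_bounded P (M := `|b|)).
have iE w : (\1_[set w | S w <= a] w : R) = (S w <= a)%R%:R.
  by rewrite indicE; congr (nat_of_bool _)%:R; apply/idP/idP; rewrite inE.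
have -> : fine (P [set w | S w <= a]) = \int[P]_w (\1_[set w | S w <= a] w : R).
  by rewrite /Rintegral integral_indic// setIT.
have -> : \int[P]_w g1 (S w) - r1 = \int[P]_w (g1 (S w) - r1).
  by rewrite (RintegralB measurableT i1 (ic r1)) Rintegral_probability_cst.
have -> : \int[P]_w g2 (S w) + r2 = \int[P]_w (g2 (S w) + r2).
  by rewrite (RintegralD measurableT i2 (ic r2)) Rintegral_probability_cst.
apply/andP; split; apply: le_Rintegral => //.
- exact: integrableB i1 (ic _).
- by move=> w _; rewrite iE.
- exact: integrableD i2 (ic _).
- by move=> w _; rewrite iE.
Qed.

Lemma cdf_sandwich (S : O -> R) (a e c : R) : measurable_fun setT S -> 0 < c ->
  \int[P]_w heat (a - e) c (S w) - gcdf (- (e / Num.sqrt c)) <=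
  fine (P [set w | S w <= a]) <=
  \int[P]_w heat (a + e) c (S w) + (1 - gcdf (e / Num.sqrt c)).
Proof.
move=> mS c0; have mh b : measurable_fun setT (heat b c).
  by apply: has_deriv_measurable => x; exact: is_derive_heat.
apply: (cdf_sandwich_fun mS (mh _) (mh _) (heat_le1 _ _) (heat_le1 _ _)) => y.
  exact: heat_below.
exact: heat_above.
Qed.

Lemma abs_le_of_sandwich (x1 x2 I1 I2 p y1 y2 g e : R) :
  `|1 - x1| <= e / 3 -> `|0 - x2| <= e / 3 ->
  `|y1 - I1| <= e / 3 -> `|y2 - I2| <= e / 3 ->
  `|g - y1| <= e / 3 -> `|g - y2| <= e / 3 ->
  I2 - x2 <= p -> p <= I1 + (1 - x1) -> `|g - p| <= e.
Proof.
rewrite !ler_norml => /andP[? ?] /andP[? ?] /andP[? ?] /andP[? ?] /andP[? ?] /andP[? ?] ? ?.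
apply/andP; split; lra.
Qed.

(** The sandwich is used with e = t and c = t^4: then e / sqrt(c) = 1/t is large, so that the error
    terms are small, while [a + t], [a - t] and [c + 1] stay close to [a] and 1, and [heat a 1 0] is
    [gcdf a]. One [t] is fixed before [n] grows. *)
Lemma cdf_cvg_of_heat (S : nat -> O -> R) :
  (forall n, measurable_fun setT (S n)) ->
  (forall a c, 0 < c -> \int[P]_w heat a c (S n w) @[n --> \oo] --> heat a (c + 1) 0) ->
  forall a, fine (P [set w | S n w <= a]) @[n --> \oo] --> gcdf a.
Proof.
move=> mS hS a; apply/cvgrPdist_le => e e0.
have e3 : 0 < e / 3 by rewrite divr_gt0.
have := @gcdf_cvgy R => /cvgrPdist_le/(_ _ e3)[M1 [_ HM1]].
have := @gcdf_cvgNy R => /cvgrPdist_le/(_ _ e3)[M2 [_ HM2]].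
have cu (b : R) : heat (a + b * t) (t ^+ 4 + 1) 0 @[t --> 0^'+] --> gcdf a.
  have -> : gcdf a = heat (a + b * 0) (0 ^+ 4 + 1) 0.
    by rewrite /heat mulr0 expr0n/= add0r sqrtr1 subr0 addr0 divr1.
  apply: cvg_at_right_filter.
  pose f (t : R) := (a + b * t - 0) / Num.sqrt (t ^+ 4 + 1).
  have cf : {for 0, continuous f}.
    apply: cvgM.
      apply: cvgB; last exact: cvg_cst.
      apply: cvgD; first exact: cvg_cst.
      by apply: cvgM; [exact: cvg_cst|exact: cvg_id].
    apply: cvgV; first by rewrite expr0n/= add0r sqrtr1 oner_neq0.
    apply: (@continuous_comp _ _ _ (fun t : R => t ^+ 4 + 1) Num.sqrt 0).
      by apply: cvgD; [exact: exprn_continuous|exact: cvg_cst].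
    exact: sqrt_continuous.
  by have := @continuous_comp _ _ _ f (@gcdf R) 0 cf (@continuous_gcdf R _).
have [t [t0 tM1 tM2 tp tn]] : exists t : R, [/\ 0 < t, M1 < t^-1, - t^-1 < M2,
    `|gcdf a - heat (a + t) (t ^+ 4 + 1) 0| <= e / 3 &
    `|gcdf a - heat (a - t) (t ^+ 4 + 1) 0| <= e / 3].
  near (0 : R)^'+ => t; exists t.
  have t0 : 0 < t by near: t; exact: nbhs_right_gt.
  split => //.
  - near: t; exists ((`|M1| + 1)^-1); rewrite /= ?invr_gt0// => t.
    rewrite /ball_/= sub0r normrN => tM t0'; rewrite (le_lt_trans (ler_norm M1))//.
    rewrite (@lt_trans _ _ (`|M1| + 1)) ?ltrDl// -[ltLHS]invrK ltf_pV2 ?posrE//.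
      by rewrite (le_lt_trans (ler_norm _)).
  - near: t; exists ((`|M2| + 1)^-1); rewrite /= ?invr_gt0// => t.
    rewrite /ball_/= sub0r normrN => tM t0'; rewrite ltrNl (le_lt_trans (ler_norm (- M2)))// normrN.
    rewrite (@lt_trans _ _ (`|M2| + 1)) ?ltrDl// -[ltLHS]invrK ltf_pV2 ?posrE//.
      by rewrite (le_lt_trans (ler_norm _)).
  - near: t; have /cvgrPdist_le/(_ _ e3) := cu 1.
    by apply: filterS => t; rewrite mul1r.
  - near: t; have /cvgrPdist_le/(_ _ e3) := cu (-1).
    by apply: filterS => t; rewrite mulN1r.
have t4 : 0 < t ^+ 4 by exact: exprn_gt0.
have tt : t / Num.sqrt (t ^+ 4) = t^-1.
  have -> : Num.sqrt (t ^+ 4) = t ^+ 2.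
    by rewrite (exprM t 2 2) sqrtr_sqr ger0_norm ?sqr_ge0.
  by field; rewrite gt_eqF.
have {}HM1 := HM1 _ tM1; have {}HM2 := HM2 _ tM2.
have /cvgrPdist_le/(_ _ e3) h1 := hS (a + t) _ t4.
have /cvgrPdist_le/(_ _ e3) h2 := hS (a - t) _ t4.
move: h1 h2; apply: filterS2 => n n1 n2.
have := cdf_sandwich a t (mS n) t4; rewrite tt => /andP[s1 s2].
exact: (abs_le_of_sandwich HM1 HM2 n1 n2 tp tn s1 s2).
Unshelve. all: by end_near. Qed.

(** [h n *+ k n] is the variance of a row sum, and the last hypothesis plays the part of Lindeberg's
    condition: it makes the error of [lindeberg_swap] vanish. What remains is continuity of [heat]
    in time at [c + 1]. The moment conditions are eventual, since the normalizers of the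
    applications may vanish for small [n]. *)
Theorem clt_array (k : nat -> nat) (xi : forall n, 'I_(k n) -> O -> R) (h eps : nat -> R) :
  (forall n i, measurable_fun setT (xi n i)) ->
  (forall n, mutually_independent P (xi n)) ->
  (\forall n \near \oo, 0 <= h n) ->
  (\forall n \near \oo, forall i, [/\ P.-integrable setT (EFin \o xi n i),
     P.-integrable setT (EFin \o (fun w => xi n i w ^+ 2)),
     \int[P]_w xi n i w = 0, \int[P]_w (xi n i w ^+ 2) = h n &
     \int[P]_w Num.min (xi n i w ^+ 2) (`|xi n i w| ^+ 3) <= eps n]) ->
  h n *+ k n @[n --> \oo] --> (1 : R) ->
  (eps n + h n ^+ 2) *+ k n @[n --> \oo] --> (0 : R) ->
  forall a, fine (P [set w | \sum_i xi n i w <= a]) @[n --> \oo] --> gcdf a.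
Proof.
move=> mxi indep h0 H hk epsk a; apply: (cdf_cvg_of_heat (S := fun n w => \sum_i xi n i w)).
  by move=> n; exact: measurable_sum.
move=> {}a c c0; have [C C0 HC] := lindeberg_swap P a c0.
have c1 : heat a (c + h n *+ k n) 0 @[n --> \oo] --> heat a (c + 1) 0.
  have ch : {for c + 1, continuous (heat a ^~ 0)}.
    apply: differentiable_continuous; apply/derivable1_diffP.
    by have [] := is_derive_heats a 0 (addr_gt0 c0 ltr01).
  have ck : c + h n *+ k n @[n --> \oo] --> c + 1 by apply: cvgD => //; exact: cvg_cst.
  exact: (cvg_comp _ _ ck ch).
have c2 : \int[P]_w heat a c (\sum_i xi n i w) - heat a (c + h n *+ k n) 0 @[n --> \oo] --> (0 : R).
  apply/cvgr0Pnorm_le => e e0.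
  have : C * ((eps n + h n ^+ 2) *+ k n) @[n --> \oo] --> (0 : R).
    by rewrite -(mulr0 C); apply: cvgM => //; exact: cvg_cst.
  move=> /cvgr0Pnorm_le/(_ _ e0) small; near=> n.
  have ne : `|C * ((eps n + h n ^+ 2) *+ k n)| <= e by near: n.
  apply: le_trans ne; apply: le_trans (ler_norm _); rewrite mulrnAr.
  have Hn : forall i, [/\ P.-integrable setT (EFin \o xi n i),
     P.-integrable setT (EFin \o (fun w => xi n i w ^+ 2)),
     \int[P]_w xi n i w = 0, \int[P]_w (xi n i w ^+ 2) = h n &
     \int[P]_w Num.min (xi n i w ^+ 2) (`|xi n i w| ^+ 3) <= eps n] by near: n.
  apply: HC => //; try by move=> i; have [] := Hn i.
  by near: n.
rewrite -[X in _ --> X]add0r.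
rewrite (_ : (fun n => _) = (fun n => \int[P]_w heat a c (\sum_i xi n i w) -
    heat a (c + h n *+ k n) 0) \+ (fun n => heat a (c + h n *+ k n) 0)).
  exact: cvgD.
by apply/funext => n /=; rewrite subrK.
Unshelve. all: by end_near. Qed.

End clt.

(** * Convergence in distribution from convergence on boxes *)

Section grid.
Context {R : realType} {d : nat}.
Implicit Types (x : 'rV[R]_d) (a b : 'I_d -> R).

(** Half-open in each coordinate, so that neighbouring cells of a grid tile a cube without
    overlap. *)
Definition in_box a b x : bool := [forall l, a l < x ord0 l <= b l].

Definition grid_lo N (L h : R) (j : {ffun 'I_d -> 'I_N}) (l : 'I_d) : R :=
  - L + h *+ j l.
Definition grid_hi N (L h : R) (j : {ffun 'I_d -> 'I_N}) (l : 'I_d) : R :=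
  - L + h *+ (j l).+1.

Lemma in_boxE a b x : (in_box a b x)%:R = \prod_l (a l < x ord0 l <= b l)%R%:R :> R.
Proof.
rewrite /in_box; case: forallP => [ab|/existsNP[l /negP/negbTE abl]].
  by rewrite big1// => l _; rewrite ab.
by rewrite (bigD1 l)//= abl mul0r.
Qed.

Lemma sum_intervals N (c h x : R) : 0 < h ->
  \sum_(i < N) (c + h *+ i < x <= c + h *+ i.+1)%R%:R =
  (c < x <= c + h *+ N)%R%:R :> R.
Proof.
move=> h0; elim: N => [|N IH].
  by rewrite big_ord0 mulr0n addr0; case: ltP => //= cx; rewrite leNgt cx.
rewrite big_ord_recr/= IH.
have cN : c <= c + h *+ N by rewrite lerDl mulrn_wge0// ltW.
have cN1 : c + h *+ N <= c + h *+ N.+1 by rewrite lerD2l mulrS lerDr ltW.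
have [xN|xN] := leP x (c + h *+ N).
  by rewrite (le_trans xN cN1) !andbT addr0.
by rewrite andbF add0r (le_lt_trans cN xN).
Qed.

(** In each coordinate the intervals tile the side of the cube; expanding the product over the
    coordinates of these sums yields one term per choice function [j], that is, per cell. *)
Lemma sum_grid N (L h : R) x : 0 < h ->
  \sum_(j : {ffun 'I_d -> 'I_N}) (in_box (grid_lo L h j) (grid_hi L h j) x)%:R =
  (in_box (fun=> - L) (fun=> - L + h *+ N) x)%:R :> R.
Proof.
move=> h0; rewrite in_boxE.
under [RHS]eq_bigr do rewrite -sum_intervals//.
rewrite bigA_distr_bigA/=; apply: eq_bigr => j _.
by rewrite in_boxE.
Qed.

(** As the cells tile the cube, [f x] differs from the step function by [f x - f corner] for the
    cell containing [x], or by [f x] itself when [x] lies outside the cube. *)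
Lemma grid_approx N (L h e M : R) (f : 'rV[R]_d -> R) x : 0 < h -> 0 <= e ->
  (forall x, `|f x| <= M) ->
  (forall j : {ffun 'I_d -> 'I_N}, in_box (grid_lo L h j) (grid_hi L h j) x ->
     `|f x - f (\row_l grid_hi L h j l)| <= e) ->
  `|f x - \sum_(j : {ffun 'I_d -> 'I_N}) f (\row_l grid_hi L h j l) *
     (in_box (grid_lo L h j) (grid_hi L h j) x)%:R| <=
  e + M * (1 - (in_box (fun=> - L) (fun=> - L + h *+ N) x)%:R).
Proof.
move=> h0 e0 fM fe.
set B := (in_box (fun=> - L) _ x)%:R; set S := \sum_j _.
have -> : f x - S = \sum_(j : {ffun 'I_d -> 'I_N}) (f x - f (\row_l grid_hi L h j l)) *
     (in_box (grid_lo L h j) (grid_hi L h j) x)%:R + f x * (1 - B).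
  under eq_bigr do rewrite mulrBl.
  rewrite sumrB -mulr_sumr sum_grid// -/B -/S; ring.
have B1 : 0 <= 1 - B by rewrite subr_ge0 /B; case: in_box.
rewrite (le_trans (ler_normD _ _))// lerD//; last first.
  by rewrite normrM (ger0_norm B1) ler_wpM2r.
rewrite (le_trans (ler_norm_sum _ _ _))//.
apply: (@le_trans _ _ (\sum_(j : {ffun 'I_d -> 'I_N}) e * (in_box (grid_lo L h j) (grid_hi L h j) x)%:R)).
  apply: ler_sum => j _; rewrite normrM normr_nat.
  by have [xj|xj] := boolP (in_box _ _ x); rewrite ?mulr0// !mulr1 fe.
by rewrite -mulr_sumr sum_grid// -/B ler_piMr// /B; case: in_box.
Qed.

Lemma grid_hi_ball N (L h e : R) (j : {ffun 'I_d -> 'I_N}) x : 0 < h -> h < e ->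
  in_box (grid_lo L h j) (grid_hi L h j) x -> ball x e (\row_l grid_hi L h j l).
Proof.
move=> h0 he /forallP xj; split=> [|i l]; first exact: lt_trans he.
rewrite (ord1 i) mxE /ball/=.
move: (xj l); rewrite /grid_lo /grid_hi mulrSr => /andP[x1 x2].
by rewrite ltr_norml; apply/andP; split; lra.
Qed.

(** The local radii are made uniform by the near-covering form of compactness, applied along radii
    decreasing to 0; only [x] is confined to [K]. *)
Lemma unif_continuous_compact (f : 'rV[R]_d -> R) (K : set 'rV[R]_d) (e : R) :
  continuous f -> compact K -> 0 < e ->
  exists2 r : R, 0 < r & forall x y, K x -> ball x r y -> `|f x - f y| <= e.
Proof.
move=> cf cK e0.
have e2 : 0 < e / 2 by rewrite divr_gt0.
have := (@compact_near_coveringP _ K).1 cK R (0 : R)^'+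
  (fun r x => forall y, ball x r y -> `|f x - f y| <= e) _.
case.
  move=> x _; have /cvgrPdist_le/(_ _ e2) := cf x.
  rewrite near_simpl => /nbhs_ballP[r /= r0 xr].
  exists (ball x (r / 2), [set t | 0 < t < r / 2]) => /=.
    split; first by apply: nbhsx_ballx; rewrite divr_gt0.
    near=> t; apply/andP; split; near: t; first exact: nbhs_right_gt.
    by apply: nbhs_right_lt; rewrite divr_gt0.
  move=> [z t] /= [xz /andP[t0 tr]] y zy.
  rewrite -(subrKA (f x)) (splitr e) (le_trans (ler_normD _ _))// lerD//.
    by rewrite distrC; apply: xr; apply: le_ball xz; rewrite ler_pdivrMr// ler_pMr// ler1n.
  apply: xr; rewrite (splitr r); apply: (ball_triangle xz).
  by apply: le_ball zy; exact: ltW.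
move=> r /= r0 H.
exists (r / 2); first by rewrite divr_gt0.
move=> x y Kx xy; apply: (H (r / 2)) => //=; last by rewrite divr_gt0.
by rewrite sub0r normrN gtr0_norm ?divr_gt0// ltr_pdivrMr// ltr_pMr// ltr1n.
Unshelve. all: by end_near. Qed.

Lemma compact_cube (L : R) : compact [set x : 'rV[R]_d | forall l, x ord0 l \in `[- L, L]].
Proof.
apply: (@rV_compact _  _ (fun=> `[(- L), L]%classic)) => _.
exact: segment_compact.
Qed.

End grid.

Section box_probability.
Context {R : realType} {d : nat} d0 (O : measurableType d0).
Implicit Types (S : O -> 'I_d -> R).

Lemma measurable_in_box S (a b : 'I_d -> R) :
  (forall l, measurable_fun setT (S ^~ l)) ->
  measurable [set w | in_box a b (\row_l S w l)].
Proof.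
move=> mS; rewrite (_ : [set w | _] =
    \bigcap_(l in [set: 'I_d]) ((S ^~ l) @^-1` `]a l, b l])); last first.
  apply/seteqP; split => w /=.
    by move=> /forallP h l _; have := h l; rewrite mxE /= in_itv.
  by move=> h; apply/forallP => l; rewrite mxE; have := h l I; rewrite /= in_itv.
apply: fin_bigcap_measurable; first exact: finite_finset.
by move=> l _; rewrite -[X in measurable X]setTI; exact: mS.
Qed.

Lemma measurable_in_box_natr S (a b : 'I_d -> R) :
  (forall l, measurable_fun setT (S ^~ l)) ->
  measurable_fun setT (fun w => (in_box a b (\row_l S w l))%:R : R).
Proof.
move=> mS; rewrite (_ : (fun w => _) = \1_[set w | in_box a b (\row_l S w l)]).
  exact/measurable_indic/measurable_in_box.
apply/funext => w; rewrite indicE; congr (nat_of_bool _)%:R.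
by apply/idP/idP; rewrite inE.
Qed.

(** Measurability is given coordinate by coordinate. It passes to finite sums over boxes, and [f] is
    the pointwise limit of such sums over grids of mesh 1/(n+1) on cubes of half-side n+1, which
    have 2(n+1)^2 intervals per side. *)
Lemma measurable_continuous_row (f : 'rV[R]_d -> R) S : continuous f ->
  (exists M, forall x, `|f x| <= M) ->
  (forall l, measurable_fun setT (S ^~ l)) ->
  measurable_fun setT (fun w => f (\row_l S w l)).
Proof.
move=> cf [M fM] mS.
pose L n : R := n.+1%:R; pose h n : R := n.+1%:R^-1; pose N n := (2 * n.+1 * n.+1)%N.
pose F n w := \sum_(j : {ffun 'I_d -> 'I_(N n)}) f (\row_l grid_hi (L n) (h n) j l) *
  (in_box (grid_lo (L n) (h n) j) (grid_hi (L n) (h n) j) (\row_l S w l))%:R.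
apply: (measurable_fun_cvg (h := F)) => //.
  move=> n; apply: measurable_sum => j.
  by apply: measurable_funM => //; exact: measurable_in_box_natr.
move=> w _; apply/cvgrPdist_le => e e0.
set x := \row_l S w l.
have /cvgrPdist_le/(_ _ e0) := cf x.
rewrite near_simpl => /nbhs_ballP[r /= r0 xr].
have [K xK] : exists K : R, forall l, `|x ord0 l| < K.
  exists (\sum_l `|x ord0 l| + 1) => l; rewrite (bigD1 l)//= -addrA ltrDl.
  by rewrite ltr_wpDl// sumr_ge0.
near=> n.
have h0 : 0 < h n by rewrite invr_gt0.
have hr : h n < r.
  by near: n; have := near_infty_natSinv_lt (PosNum r0); apply.
have LK : K < L n.
  near: n; have := nbhs_infty_gtr K; apply: filterS => n /lt_le_trans; apply.
  by rewrite ler_nat.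
have LN : - L n + h n *+ N n = L n.
  rewrite /h /N -[_^-1 *+ _]mulr_natl !natrM mulfK ?pnatr_eq0// /L; ring.
have inB : in_box (fun=> - L n) (fun=> - L n + h n *+ N n) x.
  rewrite LN; apply/forallP => l; have := xK l; rewrite ltr_norml => /andP[x1 x2].
  by rewrite (lt_trans _ x1) ?ltrN2// ltW// (lt_trans x2).
have := @grid_approx _ _ (N n) (L n) (h n) e M f x h0 (ltW e0) fM.
rewrite inB subrr mulr0 addr0; apply => j xj.
by apply: xr; exact: grid_hi_ball hr xj.
Unshelve. all: by end_near. Qed.

Lemma Rintegral_in_box (P : probability O R) S (a b : 'I_d -> R) :
  (forall l, measurable_fun setT (S ^~ l)) ->
  \int[P]_w ((in_box a b (\row_l S w l))%:R : R) =
  fine (P [set w | in_box a b (\row_l S w l)]).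
Proof.
move=> mS; rewrite (_ : (fun w => _) = \1_[set w | in_box a b (\row_l S w l)]).
  by rewrite /Rintegral integral_indic ?setIT//; exact: measurable_in_box.
apply/funext => w; rewrite indicE; congr (nat_of_bool _)%:R.
by apply/idP/idP; rewrite inE.
Qed.

End box_probability.

Section portmanteau.
Context {R : realType} {d : nat}.

Lemma integrable_sum_Rintegral d0 (O : measurableType d0) (P : probability O R)
    (I : Type) (s : seq I) (F : I -> O -> R) :
  (forall i, P.-integrable setT (EFin \o F i)) ->
  P.-integrable setT (EFin \o (fun w => \sum_(i <- s) F i w)) /\
  \int[P]_w (\sum_(i <- s) F i w) = \sum_(i <- s) \int[P]_w F i w.
Proof.
move=> iF; elim: s => [|i s [IH1 IH2]].
  rewrite (_ : (fun w => _) = (fun=> 0)); last by apply/funext => w; rewrite big_nil.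
  rewrite big_nil; split; last exact: Rintegral_probability_cst.
  by apply: (integrable_bounded P (M := 0)) => // w; rewrite normr0.
rewrite (_ : (fun w => _) = (fun w => F i w + \sum_(i <- s) F i w)); last first.
  by apply/funext => w; rewrite big_cons.
split; first exact: integrableD (iF i) IH1.
by rewrite big_cons (RintegralD measurableT (iF i) IH1) IH2.
Qed.

(** The integral of [grid_approx]: next to the expectation only finitely many box probabilities
    remain, and these converge by hypothesis in the application. *)
Lemma expectation_grid d0 (O : measurableType d0) (P : probability O R)
    (S : O -> 'I_d -> R) N (L h e M : R) (f : 'rV[R]_d -> R) :
  (forall l, measurable_fun setT (S ^~ l)) ->
  continuous f -> 0 < h -> 0 <= e -> (forall x, `|f x| <= M) ->
  (forall (j : {ffun 'I_d -> 'I_N}) x, in_box (grid_lo L h j) (grid_hi L h j) x ->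
     `|f x - f (\row_l grid_hi L h j l)| <= e) ->
  `|\int[P]_w f (\row_l S w l) - \sum_(j : {ffun 'I_d -> 'I_N}) f (\row_l grid_hi L h j l) *
     fine (P [set w | in_box (grid_lo L h j) (grid_hi L h j) (\row_l S w l)])| <=
  e + M * (1 - fine (P [set w | in_box (fun=> - L) (fun=> - L + h *+ N) (\row_l S w l)])).
Proof.
move=> mS cf h0 e0 fM fe.
have mf : measurable_fun setT (fun w => f (\row_l S w l)).
  by apply: measurable_continuous_row => //; exists M.
have if_ : P.-integrable setT (EFin \o (fun w => f (\row_l S w l))).
  exact: (integrable_bounded P (M := M)).
have ib a b : P.-integrable setT (EFin \o (fun w => (in_box a b (\row_l S w l))%:R)).
  apply: (integrable_bounded P (M := 1)); first exact: measurable_in_box_natr.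
  by move=> w; rewrite normr_nat; case: in_box.
pose F (j : {ffun 'I_d -> 'I_N}) w := f (\row_l grid_hi L h j l) *
  (in_box (grid_lo L h j) (grid_hi L h j) (\row_l S w l))%:R.
have iF j : P.-integrable setT (EFin \o F j) by exact: (integrableZl measurableT _ (ib _ _)).
have [isum Esum] := integrable_sum_Rintegral (index_enum {ffun 'I_d -> 'I_N}) iF.
have -> : \sum_(j : {ffun 'I_d -> 'I_N}) f (\row_l grid_hi L h j l) *
     fine (P [set w | in_box (grid_lo L h j) (grid_hi L h j) (\row_l S w l)]) =
    \int[P]_w (\sum_j F j w).
  rewrite Esum; apply: eq_bigr => j _.
  by rewrite (RintegralZl _ measurableT (ib _ _)) Rintegral_in_box.
rewrite -Rintegral_in_box// -(RintegralB measurableT if_ isum).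
pose D w := f (\row_l S w l) - \sum_j F j w.
have iD : P.-integrable setT (EFin \o D) by exact: integrableB if_ isum.
rewrite -[X in `|X|]/(Rintegral P setT D).
apply: (le_trans (le_normr_Rintegral measurableT iD)).
have i1 : P.-integrable setT (EFin \o (fun=> 1 : R)) by exact: (integrable_bounded P (M := `|1|)).
have ie : P.-integrable setT (EFin \o (fun=> e : R)) by exact: (integrable_bounded P (M := `|e|)).
set B := in_box _ _.
have i1B : P.-integrable setT (EFin \o (fun w => 1 - (B (\row_l S w l))%:R)) by exact: integrableB i1 (ib _ _).
have iMB : P.-integrable setT (EFin \o (fun w => M * (1 - (B (\row_l S w l))%:R))).
  exact: (integrableZl measurableT _ i1B).
rewrite (_ : e + _ = \int[P]_w (e + M * (1 - (B (\row_l S w l))%:R))); last first.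
  rewrite (RintegralD measurableT ie iMB) (RintegralZl _ measurableT i1B).
  by rewrite (RintegralB measurableT i1 (ib _ _)) !Rintegral_probability_cst.
apply: le_Rintegral => //.
- exact: integrable_abse iD.
- exact: integrableD ie iMB.
- move=> w _; apply: grid_approx => // j; exact: fe.
Qed.

Lemma cvg_sumr (I : Type) (s : seq I) (F : I -> nat -> R) (l : I -> R) :
  (forall i, F i n @[n --> \oo] --> l i) ->
  \sum_(i <- s) F i n @[n --> \oo] --> \sum_(i <- s) l i.
Proof.
move=> Fl; elim: s => [|i s IH].
  rewrite big_nil (_ : (fun n => _) = (fun=> 0)); first exact: cvg_cst.
  by apply/funext => n; rewrite big_nil.
rewrite big_cons (_ : (fun n => _) = (fun n => F i n + \sum_(i <- s) F i n)).
  exact: cvgD.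
by apply/funext => n; rewrite big_cons.
Qed.

Lemma dist_le_of_approx (IZ sZ mq In sn mp e : R) :
  `|IZ - sZ| <= e / 6 + mq -> `|In - sn| <= e / 6 + mp ->
  `|mq - mp| <= e / 6 -> `|sZ - sn| <= e / 6 -> mq <= e / 6 -> `|IZ - In| <= e.
Proof.
rewrite !ler_norml => /andP[? ?] /andP[? ?] /andP[? ?] /andP[? ?] ?.
apply/andP; split; lra.
Qed.

(** The cube is chosen for [Z] alone. As it is itself a box, [S n] eventually has little more mass
    outside it than [Z], which replaces tightness. Inside, uniform continuity leaves finitely many
    cells. Of the six errors [e / 6], one is the oscillation for [Z], one that for [S n], one the
    sum over cells, and three come from the mass outside the cube. *)
Theorem cvg_in_distribution_of_boxes dP (O : measurableType dP) (P : probability O R)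
    dQ (O' : measurableType dQ) (Q : probability O' R)
    (S : nat -> O -> 'I_d -> R) (Z : O' -> 'I_d -> R) :
  (forall n l, measurable_fun setT (S n ^~ l)) ->
  (forall l, measurable_fun setT (Z ^~ l)) ->
  (forall a b, fine (P [set w | in_box a b (\row_l S n w l)]) @[n --> \oo] -->
     fine (Q [set w | in_box a b (\row_l Z w l)])) ->
  cvg_in_distribution P (fun n w => \row_l S n w l) Q (fun w => \row_l Z w l).
Proof.
move=> mS mZ SZ f cf [M0 fM0].
pose M := `|M0| + 1.
have M1 : 0 < M by rewrite ltr_wpDl.
have fM x : `|f x| <= M.
  by rewrite (le_trans (fM0 x))// (le_trans (ler_norm M0))// lerDl.
have EP n : ('E_P[fun w => f (\row_l S n w l)] = (\int[P]_w f (\row_l S n w l))%:E)%E.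
  rewrite unlock /Rintegral fineK//; apply: integrable_fin_num => //.
  apply: (integrable_bounded P (M := M)) => //.
  by apply: measurable_continuous_row => //; exists M.
have EQ : ('E_Q[fun w => f (\row_l Z w l)] = (\int[Q]_w f (\row_l Z w l))%:E)%E.
  rewrite unlock /Rintegral fineK//; apply: integrable_fin_num => //.
  apply: (integrable_bounded Q (M := M)) => //.
  by apply: measurable_continuous_row => //; exists M.
rewrite EQ; under [X in X @ _ --> _]eq_fun do rewrite EP.
apply: cvg_EFin; first exact: nearW.
apply/cvgrPdist_le => e e0; rewrite /=.
have e6 : 0 < e / 6 by rewrite divr_gt0.
have [m qm] : exists m : nat, M * (1 - fine (Q [set w | in_box (fun=> - m.+1%:R) (fun=> m.+1%:R) (\row_l Z w l)])) <= e / 6.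
  have : fine (Q [set w | in_box (fun=> - n.+1%:R) (fun=> n.+1%:R) (\row_l Z w l)]) @[n --> \oo] --> (1 : R).
    apply: fine_cvg; rewrite -[X in _ --> X](probability_setT Q).
    pose F n := [set w | in_box (fun=> - n.+1%:R : R) (fun=> n.+1%:R) (\row_l Z w l)].
    have FT : \bigcup_n F n = setT.
      apply/seteqP; split => // w _.
      pose K := \sum_l `|Z w l|.
      have ZK l : `|Z w l| <= K by rewrite /K (bigD1 l)//= lerDl sumr_ge0.
      exists (Num.truncn K) => //; apply/forallP => l; rewrite mxE.
      have Kt : K < (Num.truncn K).+1%:R by exact: truncnS_gt.
      move: (ZK l); rewrite ler_norml => /andP[z1 z2].
      by rewrite (lt_le_trans _ z1) ?ltrN2//= (le_trans z2)// ltW.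
    rewrite -FT; apply: nondecreasing_cvg_mu.
    - by move=> n; exact: measurable_in_box.
    - by rewrite FT.
    - move=> n1 n2 n12; apply/subsetPset => w /forallP wn; apply/forallP => l.
      move: (wn l) => /andP[w1 w2]; have nn : n1.+1%:R <= n2.+1%:R :> R by rewrite ler_nat.
      by rewrite (le_lt_trans _ w1) ?lerN2// (le_trans w2).
  have eM : 0 < e / 6 / M by rewrite divr_gt0.
  move=> /cvgrPdist_le/(_ _ eM)[m _ /(_ m (leqnn _))]/= Hm; exists m.
  by rewrite mulrC -ler_pdivlMr// (le_trans _ Hm)// ler_norm.
pose L : R := m.+1%:R.
have L0 : 0 < L by rewrite ltr0n.
have [r r0 ur] := unif_continuous_compact cf (@compact_cube R d L) e6.
(* Enough cells for the mesh [h] to be smaller than the radius [r] of uniform continuity, with the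
   grid filling the cube exactly. *)
pose N := (Num.truncn (2 * L / r)).+1.
pose h : R := 2 * L / N%:R.
have N0 : 0 < N%:R :> R by rewrite ltr0n.
have h0 : 0 < h by rewrite divr_gt0// mulr_gt0.
have hr : h < r.
  rewrite /h ltr_pdivrMr// [ltRHS]mulrC -ltr_pdivrMr//; exact: truncnS_gt.
have LN : - L + h *+ N = L.
  by rewrite -mulr_natr /h mulfVK ?gt_eqF//; ring.
have fe (j : {ffun 'I_d -> 'I_N}) x : in_box (grid_lo L h j) (grid_hi L h j) x ->
     `|f x - f (\row_l grid_hi L h j l)| <= e / 6.
  move=> xj; apply: ur; last exact: grid_hi_ball xj.
  move=> l; have /forallP/(_ l)/andP[x1 x2] := xj; rewrite in_itv/=; apply/andP; split.
    by rewrite ltW// (le_lt_trans _ x1)// /grid_lo lerDl mulrn_wge0// ltW.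
  rewrite (le_trans x2)// -[leRHS]LN /grid_hi lerD2l ler_wpMn2l ?(ltW h0)//.
set q := fine _ in qm.
have c1 : M * (1 - fine (P [set w | in_box (fun=> - L) (fun=> L) (\row_l S n w l)])) @[n --> \oo] --> M * (1 - q).
  by apply: cvgM; [exact: cvg_cst|apply: cvgB; [exact: cvg_cst|exact: SZ]].
have c2 : \sum_(j : {ffun 'I_d -> 'I_N}) f (\row_l grid_hi L h j l) *
     fine (P [set w | in_box (grid_lo L h j) (grid_hi L h j) (\row_l S n w l)]) @[n --> \oo] -->
   \sum_(j : {ffun 'I_d -> 'I_N}) f (\row_l grid_hi L h j l) *
     fine (Q [set w | in_box (grid_lo L h j) (grid_hi L h j) (\row_l Z w l)]).
  apply: cvg_sumr => j; apply: cvgM; [exact: cvg_cst|exact: SZ].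
have gZ := expectation_grid Q mZ cf h0 (ltW e6) fM fe.
have gS n := expectation_grid P (mS n) cf h0 (ltW e6) fM fe.
move: c1 c2 => /cvgrPdist_le/(_ _ e6) c1 /cvgrPdist_le/(_ _ e6) c2.
move: c1 c2; apply: filterS2 => n n1 n2.
have gSn := gS n; rewrite LN in gSn; rewrite LN -/q in gZ.
exact: (dist_le_of_approx gZ gSn n1 n2 qm).
Qed.

End portmanteau.

(** * The central limit theorem along a path *)

Section uniform_law.
Context (R : realType) (T : time_domain R) d0 (O : measurableType d0) (P : probability O R).
Variables (A : set T) (u : O -> T).
Local Notation lambda := (td_measure T).
Hypotheses (mA : measurable A) (mu : measurable_fun setT u)
  (uA : uniformly_distributed P A u).

(** [fine] maps +oo to 0 and the inverse of 0 is 0, so a set of zero or infinite measure would give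
    [u] total probability 0. *)
Lemma uniform_lambda_gt0 : 0 < fine (lambda A).
Proof.
have := uA measurableT; rewrite preimage_setT setIT.
rewrite [P _](@probability_setT _ _ _ P) => /eqP.
rewrite lt_neqAle fine_ge0// andbT; apply: contraTneq => <-.
by rewrite invr0 mul0e eqe oner_eq0.
Qed.

Lemma uniform_lambda_lty : (lambda A < +oo)%E.
Proof.
rewrite ltey; apply: contraTneq uniform_lambda_gt0 => ->.
by rewrite ltxx.
Qed.

Let r := (fine (lambda A))^-1.
Let r0 : 0 < r. Proof. by rewrite invr_gt0 uniform_lambda_gt0. Qed.

Lemma uniform_ge0_integral (f : T -> \bar R) : measurable_fun setT f ->
  (forall t, 0 <= f t)%E ->
  (\int[P]_w f (u w) = r%:E * \int[lambda]_(t in A) f t)%E.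
Proof.
move=> mf f0.
have mcA : measurable (~` A) by exact: measurableC.
have mufu B : measurable B -> measurable (u @^-1` B).
  by move=> mB; rewrite -[X in measurable X]setTI; exact: mu.
have PcA : P (u @^-1` (~` A)) = 0%E.
  by rewrite uA// setICr measure0 mule0.
have mfu : measurable_fun setT (fun w => f (u w)) by exact: measurableT_comp.
rewrite (ge0_negligible_integral (N := u @^-1` (~` A)))//; last exact: mufu.
rewrite (_ : setT `\` _ = u @^-1` A); last first.
  by rewrite preimage_setC setTD setCK.
pose k := NngNum (ltW r0).
rewrite -[r]/(k%:num) -(@ge0_integral_mscale _ _ _ lambda A mA k f) => //; last exact: measurable_funTS.
have := @ge0_integral_pushforward _ _ _ _ R u mu P A f mA (measurable_funTS mf).
move=> <-; last by move=> t _; exact: f0.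
pose m1_ := [the {measure set T -> \bar R} of pushforward P u].
rewrite -[LHS]/(\int[m1_ mu]_(y in A) f y)%E.
apply: eq_measure_integral => B mB BA.
rewrite /m1_/= /pushforward /mscale/= uA//.
by rewrite setIidr.
Qed.

Lemma uniform_integrable (f : T -> R) : measurable_fun setT f ->
  P.-integrable setT (EFin \o (f \o u)) <-> lambda.-integrable A (EFin \o f).
Proof.
move=> mf.
have E : (\int[P]_w `|(f (u w))%:E| = r%:E * \int[lambda]_(t in A) `|(f t)%:E|)%E.
  rewrite (@uniform_ge0_integral (fun t => `|(f t)%:E|%E))//.
  by apply/measurable_EFinP; exact: measurableT_comp.
have I0 : (0 <= \int[lambda]_(t in A) `|(f t)%:E|)%E by exact: integral_ge0.
split=> /integrableP[mf' fi]; apply/integrableP; split.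
- by apply/measurable_EFinP; exact: measurable_funTS.
- move: fi I0; rewrite /= E; case: (\int[_]_(_ in _) _)%E => //= [s _ _|]; first exact: ltry.
  by rewrite gt0_muley ?lte_fin.
- by apply/measurable_EFinP; exact: measurableT_comp.
- rewrite /= E; move: fi I0; rewrite /=; case: (\int[_]_(_ in _) _)%E => //= s _ _.
  exact: ltry.
Qed.

Lemma uniform_average (f : T -> R) : measurable_fun setT f ->
  P.-integrable setT (EFin \o (f \o u)) -> \int[P]_w f (u w) = average A f.
Proof.
move=> mf ifu; have ifA := (uniform_integrable mf).1 ifu.
rewrite /average /Rintegral.
have := integrable_pos_fin_num mA ifA; have := integrable_neg_fin_num mA ifA.
rewrite [in LHS]integralE [in RHS]integralE.
have mfE : measurable_fun setT (EFin \o f) by exact/measurable_EFinP.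
have -> : (\int[P]_w ((fun w => (f (u w))%:E)^\+) w =
    r%:E * \int[lambda]_(t in A) ((EFin \o f)^\+) t)%E.
  rewrite -(uniform_ge0_integral (measurable_funepos mfE) (fun t => funepos_ge0 _ t)).
  by apply: eq_integral => w _; rewrite !funeposE.
have -> : (\int[P]_w ((fun w => (f (u w))%:E)^\-) w =
    r%:E * \int[lambda]_(t in A) ((EFin \o f)^\-) t)%E.
  rewrite -(uniform_ge0_integral (measurable_funeneg mfE) (fun t => funeneg_ge0 _ t)).
  by apply: eq_integral => w _; rewrite !funenegE.
rewrite -[(fun x0 : T => (f x0)%:E)]/(EFin \o f).
set a := (\int[lambda]_(t in A) ((EFin \o f)^\+) t)%E.
set b := (\int[lambda]_(t in A) ((EFin \o f)^\-) t)%E => fb fa.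
by rewrite -(fineK fa) -(fineK fb) -!EFinM -!EFinB /= mulrBr.
Qed.

Definition tail_sqr (a y : R) : R := if a < `|y| then y ^+ 2 else 0.

Lemma measurable_tail_sqr a : measurable_fun setT (tail_sqr a).
Proof.
apply: measurable_fun_if => //.
by apply: measurable_fun_ltr => //; exact: measurableT_comp.
Qed.

Lemma tail_sqr_ge0 a y : 0 <= tail_sqr a y.
Proof. by rewrite /tail_sqr; case: ifP => // _; exact: sqr_ge0. Qed.

Lemma tail_sqr_le a y : tail_sqr a y <= y ^+ 2.
Proof. by rewrite /tail_sqr; case: ifP => // _; exact: sqr_ge0. Qed.

(** For |y| <= a the cubic bound is used, with |y - M| <= a + |M|, and k k^(-3/2) leaves k^(-1/2).
    For |y| > a the quadratic bound is used; since a >= 1 gives y^2 >= 1, one has (y - M)^2 <= 2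
    (y^2 + M^2) <= 2 (1 + M^2) y^2. *)
Lemma lindeberg_term (a c k M y z : R) : 1 <= a -> 0 < c -> 0 < k ->
  z = (y - M) / (Num.sqrt k * c) ->
  k * Num.min (z ^+ 2) (`|z| ^+ 3) <=
  (a + `|M|) ^+ 3 / c ^+ 3 * (Num.sqrt k)^-1 + 2 * (1 + M ^+ 2) / c ^+ 2 * tail_sqr a y.
Proof.
move=> a1 c0 k0 zE; have q0 : 0 < Num.sqrt k by rewrite sqrtr_gt0.
have qk : k = Num.sqrt k ^+ 2 by rewrite sqr_sqrtr// ltW.
have a0 : 0 <= a by exact: le_trans a1.
rewrite /tail_sqr; case: ltP => ya.
  apply: (@le_trans _ _ (2 * (1 + M ^+ 2) / c ^+ 2 * y ^+ 2)); last first.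
    by rewrite lerDr !mulr_ge0 ?invr_ge0 ?exprn_ge0 ?addr_ge0 ?(ltW c0) ?(ltW q0).
  apply: (@le_trans _ _ (k * z ^+ 2)).
    by rewrite ler_pM2l// ge_min lexx.
  have -> : k * z ^+ 2 = (y - M) ^+ 2 / c ^+ 2.
    by rewrite {1}qk zE; field; rewrite !gt_eqF.
  rewrite [leRHS]mulrAC ler_pM2r ?invr_gt0 ?exprn_gt0//.
  have y1 : 1 <= y ^+ 2.
    by rewrite -real_normK ?num_real// exprn_ege1// ltW// (le_lt_trans a1).
  have := sqr_ge0 (y + M); have := sqr_ge0 M; nra.
rewrite mulr0 addr0.
apply: (@le_trans _ _ (k * `|z| ^+ 3)).
  by rewrite ler_pM2l// ge_min lexx orbT.
have -> : k * `|z| ^+ 3 = `|y - M| ^+ 3 / c ^+ 3 * (Num.sqrt k)^-1.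
  rewrite zE normrM normfV (gtr0_norm (mulr_gt0 q0 c0)) {1}qk.
  by field; rewrite !gt_eqF.
rewrite ler_pM2r ?invr_gt0// ler_pM2r ?invr_gt0 ?exprn_gt0//.
rewrite lerXn2r ?nnegrE ?addr_ge0// (le_trans (ler_normB _ _))// lerD2r//.
Qed.

Variable x : T -> R.
Hypotheses (mx : measurable_fun setT x)
  (ix2 : lambda.-integrable A (EFin \o (fun t => x t ^+ 2))).
Let M := average A x.

Let mxu : measurable_fun setT (x \o u). Proof. exact: measurableT_comp. Qed.
Let mx2 : measurable_fun setT (fun t => x t ^+ 2). Proof. exact: measurable_funX. Qed.

Let ixu2 : P.-integrable setT (EFin \o (fun w => x (u w) ^+ 2)).
Proof. exact: (uniform_integrable mx2).2 ix2. Qed.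

Let icst (b : R) : P.-integrable setT (EFin \o (fun=> b)).
Proof. exact: (integrable_bounded P (M := `|b|)). Qed.

Let ixu : P.-integrable setT (EFin \o (x \o u)).
Proof.
apply: (@le_integrable _ _ _ _ _ _ _ (EFin \o (fun w => 1 + x (u w) ^+ 2))) => //.
- exact/measurable_EFinP.
- move=> w _; rewrite /= lee_fin [leRHS]ger0_norm ?addr_ge0 ?sqr_ge0//.
  rewrite -(real_normK (num_real (x (u w)))).
  by have := sqr_ge0 (`|x (u w)| - 1); have := normr_ge0 (x (u w)); nra.
- exact: integrableD (icst 1) ixu2.
Qed.

Lemma centered_integrable : P.-integrable setT (EFin \o (fun w => x (u w) - M)).
Proof. exact: integrableB ixu (icst M). Qed.

Lemma centered_mean0 : \int[P]_w (x (u w) - M) = 0.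
Proof.
rewrite (RintegralB measurableT ixu (icst M)) Rintegral_probability_cst.
by rewrite (uniform_average mx ixu) subrr.
Qed.

Let sqrE : (fun w => (x (u w) - M) ^+ 2) = (fun w => x (u w) ^+ 2 - (2 * M) * x (u w) + M ^+ 2).
Proof. by apply/funext => w; ring. Qed.

Let i2Mx : P.-integrable setT (EFin \o (fun w => (2 * M) * x (u w))).
Proof. exact: (integrableZl measurableT _ ixu). Qed.

Let isub : P.-integrable setT (EFin \o (fun w => x (u w) ^+ 2 - (2 * M) * x (u w))).
Proof. exact: integrableB ixu2 i2Mx. Qed.

Lemma centered_sqr_integrable : P.-integrable setT (EFin \o (fun w => (x (u w) - M) ^+ 2)).
Proof. rewrite sqrE; exact: integrableD isub (icst _). Qed.

Lemma centered_sqr_mean : \int[P]_w ((x (u w) - M) ^+ 2) = average_var A x.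
Proof.
apply: (@uniform_average (fun t => (x t - M) ^+ 2)); last exact: centered_sqr_integrable.
by apply: measurable_funX; exact: measurable_funB.
Qed.

(** An average over [A] is an expectation at the uniform point [u], where the usual expansion of a
    variance applies. *)
Lemma average_varE : average_var A x = average A (fun t => x t ^+ 2) - M ^+ 2.
Proof.
rewrite -centered_sqr_mean sqrE (RintegralD measurableT isub (icst _)).
rewrite (RintegralB measurableT ixu2 i2Mx) (RintegralZl _ measurableT ixu).
rewrite (uniform_average mx ixu) (uniform_average mx2 ixu2) Rintegral_probability_cst -/M.
ring.
Qed.

Lemma lindeberg_average (a c k : R) : 1 <= a -> 0 < c -> 0 < k ->
  k * average A (fun t => let z := (x t - M) / (Num.sqrt k * c) in
    Num.min (z ^+ 2) (`|z| ^+ 3)) <=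
  (a + `|M|) ^+ 3 / c ^+ 3 * (Num.sqrt k)^-1 +
  2 * (1 + M ^+ 2) / c ^+ 2 * average A (fun t => tail_sqr a (x t)).
Proof.
move=> a1 c0 k0; set b1 := _ * (Num.sqrt k)^-1; set b2 := _ / c ^+ 2.
have mt : measurable_fun setT (fun t => tail_sqr a (x t)).
  by apply: measurableT_comp mx; exact: measurable_tail_sqr.
have itl : P.-integrable setT (EFin \o (fun w => tail_sqr a (x (u w)))).
  apply: (le_integrable measurableT _ _ ixu2).
    by apply/measurable_EFinP; exact: (measurableT_comp mt mu).
  move=> w _; rewrite /= lee_fin !ger0_norm ?sqr_ge0 ?tail_sqr_ge0//.
  exact: tail_sqr_le.
pose f t := let z := (x t - M) / (Num.sqrt k * c) in Num.min (z ^+ 2) (`|z| ^+ 3).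
have mf : measurable_fun setT f.
  have mz : measurable_fun setT (fun t => (x t - M) / (Num.sqrt k * c)).
    by apply: measurable_funM => //; exact: measurable_funB.
  by apply: measurable_minr; apply: measurable_funX => //; exact: measurableT_comp.
have f0 t : 0 <= f t by rewrite le_min sqr_ge0 exprn_ge0.
have ib : P.-integrable setT (EFin \o (fun w => b1 + b2 * tail_sqr a (x (u w)))).
  exact: integrableD (icst _) (integrableZl measurableT _ itl).
have kf w : k * f (u w) <= b1 + b2 * tail_sqr a (x (u w)) by exact: lindeberg_term.
have ikf : P.-integrable setT (EFin \o (fun w => k * f (u w))).
  apply: (le_integrable measurableT _ _ ib).
    by apply/measurable_EFinP; apply: measurable_funM => //; exact: (measurableT_comp mf mu).
  move=> w _; rewrite /= lee_fin ger0_norm ?mulr_ge0 ?(ltW k0)//.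
  by rewrite (le_trans (kf w))// ler_norm.
have ifu : P.-integrable setT (EFin \o (f \o u)).
  have := integrableZl measurableT k^-1 ikf; apply: eq_integrable => // w _.
  by rewrite /= -EFinM mulKf ?gt_eqF.
rewrite -(uniform_average mf ifu) -(uniform_average mt itl).
rewrite -(RintegralZl _ measurableT ifu) -(RintegralZl _ measurableT itl).
rewrite -[X in X + _](Rintegral_probability_cst P).
have itl2 : P.-integrable setT (EFin \o (fun w => b2 * tail_sqr a (x (u w)))).
  exact: (integrableZl measurableT _ itl).
rewrite -(RintegralD measurableT (icst _) itl2).
by apply: le_Rintegral => // w _; exact: kf.
Qed.

End uniform_law.

Section clt_along_path.
Context (R : realType) (T : time_domain R) d0 (O : measurableType d0) (P : probability O R).

Lemma average_ge0 (A : set T) (f : T -> R) : (forall t, 0 <= f t) -> 0 <= average A f.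
Proof.
move=> f0; apply: mulr_ge0; first by rewrite invr_ge0 fine_ge0.
by apply: Rintegral_ge0 => t _.
Qed.

(** All that the central limit theorem uses of a path. The last clause is an averaged uniform
    integrability of the squares, with a level [a] that may depend on the path. Square integrability
    is conditional on finite measure because finiteness is deduced from the existence of a uniformly
    distributed point, hence when [k n] is positive. *)
Definition good_path (A : nat -> set T) (x : T -> R) (m s : R) : Prop :=
  [/\ measurable_fun setT x,
      forall n, (td_measure T (A n) < +oo)%E ->
        (td_measure T).-integrable (A n) (EFin \o (fun t => x t ^+ 2)),
      average (A n) x @[n --> \oo] --> m,
      average (A n) (fun t => x t ^+ 2) @[n --> \oo] --> s &
      m ^+ 2 < s /\ forall e, 0 < e -> exists a g : R,
        [/\ 1 <= a, g < e & average (A n) (fun t => tail_sqr a (x t)) @[n --> \oo] --> g]].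

Variables (A : nat -> set T) (k : nat -> nat) (tau : forall n, 'I_(k n) -> O -> T).
Arguments tau : clear implicits.
Hypotheses (mA : forall n, measurable (A n)) (koo : k n @[n --> \oo] --> \oo)
  (mtau : forall n i, measurable_fun setT (tau n i))
  (utau : forall n i, uniformly_distributed P (A n) (tau n i))
  (itau : forall n, mutually_independent P (tau n)).

Lemma cvg_exp (f : nat -> R) (l : R) j : f n @[n --> \oo] --> l ->
  f n ^+ j @[n --> \oo] --> l ^+ j.
Proof.
move=> fl; have h := @exprn_continuous R j l.
exact: (cvg_comp f (fun y => y ^+ j) fl h).
Qed.

Lemma good_path_var x m s : good_path A x m s ->
  average_var (A n) x @[n --> \oo] --> s - m ^+ 2.
Proof.
move=> [mx ix xm xs _].
have : average (A n) (fun t => x t ^+ 2) - average (A n) x ^+ 2 @[n --> \oo] --> s - m ^+ 2.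
  by apply: cvgB => //; apply: cvg_exp.
apply: cvg_trans; apply: near_eq_cvg.
have /cvgnyPgt/(_ 0%N) := koo; apply: filterS => n kn.
pose i := Ordinal kn.
rewrite (average_varE (mA n) (mtau i) (utau i) mx)//.
by apply: ix; exact: uniform_lambda_lty (utau i).
Qed.

(** The row variance is [average_var (A n) x / c n ^+ 2], which tends to 1 for any [c] with the
    stated limit; its Lindeberg term is bounded by [lindeberg_average]. *)
Lemma clt_along_path x m s (c : nat -> R) : good_path A x m s ->
  c n @[n --> \oo] --> Num.sqrt (s - m ^+ 2) ->
  forall b, fine (P [set w | (\sum_i (x (tau n i w) - average (A n) x)) /
      (Num.sqrt (k n)%:R * c n) <= b]) @[n --> \oo] --> gcdf b.
Proof.
move=> gx cs b; have Vs := good_path_var gx.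
have [mx ix xm xs [v0 Hx]] := gx.
set sg := Num.sqrt _ in cs.
have sg0 : 0 < sg by rewrite sqrtr_gt0 subr_gt0.
have sg2 : sg ^+ 2 = s - m ^+ 2 by rewrite sqr_sqrtr// ltW// subr_gt0.
have k0 : \forall n \near \oo, (0 < k n)%N by have /cvgnyPgt/(_ 0%N) := koo.
have kroo : (k n)%:R @[n --> \oo] --> (+oo : set_system R).
  apply/cvgryPge => B; have /cvgnyPge/(_ (Num.truncn `|B|).+1) := koo.
  apply: filterS => n kn; rewrite (le_trans (ler_norm B))// ltW//.
  by rewrite (lt_le_trans (truncnS_gt _))// ler_nat.
have c0 : \forall n \near \oo, 0 < c n by exact: (cvgr_gt _ cs).
pose z n i w : R := (x (tau n i w) - average (A n) x) / (Num.sqrt (k n)%:R * c n).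
pose h n : R := average_var (A n) x / ((k n)%:R * c n ^+ 2).
pose eps n : R := average (A n) (fun t => let z := (x t - average (A n) x) / (Num.sqrt (k n)%:R * c n) in
    Num.min (z ^+ 2) (`|z| ^+ 3)).
have fin n (i : 'I_(k n)) : (td_measure T (A n) < +oo)%E by exact: uniform_lambda_lty (utau i).
have mz n : measurable_fun setT (fun t => (x t - average (A n) x) / (Num.sqrt (k n)%:R * c n)).
  by apply: measurable_funM => //; exact: measurable_funB.
have kV0 : (k n)%:R^-1 @[n --> \oo] --> (0 : R) by apply/gtr0_cvgV0 => //; near=> n; rewrite ltr0n; near: n.
have hk1 : h n *+ k n @[n --> \oo] --> (1 : R).
  have : average_var (A n) x / c n ^+ 2 @[n --> \oo] --> (s - m ^+ 2) / sg ^+ 2.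
    by apply: cvgM => //; apply: cvgV; [rewrite gt_eqF// exprn_gt0|apply: cvg_exp].
  rewrite -sg2 divff ?gt_eqF ?exprn_gt0//; apply: cvg_trans; apply: near_eq_cvg.
  near=> n; rewrite /h -mulr_natr; field.
  have -> : c n != 0 by rewrite gt_eqF//; near: n.
  by rewrite pnatr_eq0 -lt0n; near: n.
have epsk0 : eps n *+ k n @[n --> \oo] --> (0 : R).
  apply/cvgr0Pnorm_le => e e0.
  (* The limit of the coefficient of the tail average in [lindeberg_average]. The level [a] is
     chosen with [C * g < e]; the other term there vanishes like the inverse square root of
     [k n]. *)
  pose C := 2 * (1 + m ^+ 2) / sg ^+ 2.
  have C0 : 0 < C by rewrite divr_gt0 ?exprn_gt0// mulr_gt0// ltr_pwDl// sqr_ge0.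
  have [a [g [a1 ge ga]]] := Hx (e / C) (divr_gt0 e0 C0).
  have bound : (a + `|average (A n) x|) ^+ 3 / c n ^+ 3 * (Num.sqrt (k n)%:R)^-1 +
      2 * (1 + average (A n) x ^+ 2) / c n ^+ 2 * average (A n) (fun t => tail_sqr a (x t))
      @[n --> \oo] --> (a + `|m|) ^+ 3 / sg ^+ 3 * Num.sqrt 0 + C * g.
    apply: cvgD; apply: cvgM => //.
    - apply: cvgM.
        by apply: cvg_exp; apply: cvgD; [exact: cvg_cst|exact: cvg_norm].
      by apply: cvgV; [rewrite gt_eqF// exprn_gt0|apply: cvg_exp].
    - under [X in X @ _ --> _]eq_fun do rewrite -sqrtrV//.
      by apply: (cvg_comp _ _ kV0); exact: sqrt_continuous.
    - apply: cvgM.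
        apply: cvgM; first exact: cvg_cst.
        by apply: cvgD; [exact: cvg_cst|apply: cvg_exp].
      by apply: cvgV; [rewrite gt_eqF// exprn_gt0|apply: cvg_exp].
  rewrite sqrtr0 mulr0 add0r in bound.
  have Cge : C * g < e by rewrite mulrC -ltr_pdivlMr.
  have blt := cvgr_lt _ bound e Cge.
  near=> n.
  have kn : (0 < k n)%N by near: n.
  have cn : 0 < c n by near: n.
  have kn' : 0 < (k n)%:R :> R by rewrite ltr0n.
  pose i := Ordinal kn.
  have ixn := ix n (fin n i).
  have L := lindeberg_average (mA n) (mtau i) (utau i) mx ixn a1 cn kn'.
  rewrite ger0_norm; last first.
    rewrite mulrn_wge0//; apply: average_ge0 => t.
    by rewrite le_min sqr_ge0 exprn_ge0.
  rewrite -mulr_natl (le_trans L)// ltW//; near: n; exact: blt.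
have zsum n w : (\sum_i (x (tau n i w) - average (A n) x)) / (Num.sqrt (k n)%:R * c n) =
    \sum_i z n i w by rewrite mulr_suml.
under [X in X @ _ --> _]eq_fun do (under [X in P X]eq_set do rewrite zsum).
apply: (@clt_array _ _ _ P k z h eps).
- by move=> n i; exact: (measurableT_comp (mz n) (mtau i)).
- move=> n B mB; apply: (@itau n (fun i => (fun t => (x t - average (A n) x) /
    (Num.sqrt (k n)%:R * c n)) @^-1` B i)) => i.
  by rewrite -[X in measurable X]setTI; exact: mz.
- near=> n.
  have kn : (0 < k n)%N by near: n.
  rewrite /h; apply: divr_ge0; last by rewrite mulr_ge0// sqr_ge0.
  by apply: average_ge0 => t; exact: sqr_ge0.
- near=> n => i.
  have kn : (0 < k n)%N by near: n.
  have cn : 0 < c n by near: n.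
  have kn' : 0 < (k n)%:R :> R by rewrite ltr0n.
  have ixn := ix n (fin n i).
  have qc : 0 < Num.sqrt (k n)%:R * c n by rewrite mulr_gt0// sqrtr_gt0.
  have I1 := centered_integrable (mA n) (mtau i) (utau i) mx ixn.
  have I2 := centered_sqr_integrable (mA n) (mtau i) (utau i) mx ixn.
  have sqrE w : z n i w ^+ 2 = (x (tau n i w) - average (A n) x) ^+ 2 * ((k n)%:R * c n ^+ 2)^-1.
    by rewrite /z expr_div_n exprMn sqr_sqrtr.
  have i1 : P.-integrable setT (EFin \o z n i) by exact: (integrableZr measurableT _ I1).
  have i2 : P.-integrable setT (EFin \o (fun w => z n i w ^+ 2)).
    under [X in EFin \o X]eq_fun do rewrite sqrE.
    exact: (integrableZr measurableT _ I2).
  split => //.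
  + by rewrite (RintegralZr _ measurableT I1) (centered_mean0 (mA n))// mul0r.
  + under eq_Rintegral do rewrite sqrE.
    by rewrite (RintegralZr _ measurableT I2) (centered_sqr_mean (mA n)).
  + rewrite (@uniform_average _ _ _ _ _ _ _ (mA n) (mtau i) (utau i)
      (fun t => let z := (x t - average (A n) x) / (Num.sqrt (k n)%:R * c n) in
        Num.min (z ^+ 2) (`|z| ^+ 3)))//.
      by apply: measurable_minr; apply: measurable_funX => //; exact: measurableT_comp.
    apply: (le_integrable measurableT _ _ i2).
      apply/measurable_EFinP; apply: measurable_minr; apply: measurable_funX;
        [|apply: measurableT_comp => //]; exact: (measurableT_comp (mz n) (mtau i)).
    move=> w _; rewrite /= lee_fin [leLHS]ger0_norm ?le_min ?sqr_ge0 ?exprn_ge0//.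
    by rewrite [leRHS]ger0_norm ?sqr_ge0// ge_min lexx.
- exact: hk1.
(* With q = k n one has q h^2 = (h q)^2 / q, and h q tends to 1. *)
- have : eps n *+ k n + (h n *+ k n) ^+ 2 * (k n)%:R^-1 @[n --> \oo] --> (0 + 1 ^+ 2 * 0 : R).
    by apply: cvgD => //; apply: cvgM => //; apply: cvg_exp.
  rewrite mulr0 addr0; apply: cvg_trans; apply: near_eq_cvg; near=> n.
  have kn : (k n)%:R != 0 :> R by rewrite pnatr_eq0 -lt0n; near: n.
  have gen (y q : R) : q != 0 -> (y * q) ^+ 2 * q^-1 = y ^+ 2 * q by move=> q0; field.
  by rewrite mulrnDl -[h n *+ _]mulr_natr -[h n ^+ 2 *+ _]mulr_natr gen.
Unshelve. all: by end_near. Qed.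

End clt_along_path.

(** * Conditional expectations and almost every path *)

Section invariant_sigma_algebra.
Context (R : realType) (T : time_domain R) d0 (O : measurableType d0) (P : probability O R).
Variable Y : T -> O -> R.
Hypothesis mY : forall t, measurable_fun setT (Y t).

Lemma measurable_path (Z : T -> O -> R) (A : set (T -> R)) :
  (forall t, measurable_fun setT (Z t)) -> path_measurable A ->
  measurable [set w | A (fun s => Z s w)].
Proof.
move=> mZ pA; pose G : set (set (T -> R)) := [set A | measurable [set w | A (fun s => Z s w)]].
apply: (pA G); split.
  split; rewrite /G /=.
  - by rewrite (_ : [set w | _] = set0).
  - move=> B mB; rewrite (_ : [set w | _] = ~` [set w | B (fun s => Z s w)]).
      exact: measurableC.
    by apply/seteqP; split => w /=; [move=> []|].
  - move=> F mF; rewrite (_ : [set w | _] = \bigcup_n [set w | F n (fun s => Z s w)])//.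
    exact: bigcup_measurable.
move=> _ [t [B [mB ->]]]; rewrite /G /=.
by rewrite -[X in measurable X]setTI; exact: (mZ t).
Qed.

Lemma invariant_sigma_measurable : invariant_sigma P Y `<=` measurable.
Proof. by move=> _ [A [pA -> _]]; exact: measurable_path. Qed.

Let shift_measurable (A : set (T -> R)) t : path_measurable A ->
  measurable [set w | A (fun s => Y (td_add s t) w)].
Proof. by move=> pA; apply: (measurable_path (Z := fun s => Y (td_add s t))). Qed.

(** Passing to complements leaves the symmetric difference with the shifted event unchanged, and the
    symmetric difference of two unions lies in the union of the symmetric differences, here a
    countable union of null sets. *)
Lemma invariant_sigma_sigma_algebra : sigma_algebra setT (invariant_sigma P Y).
Proof.
have pm : sigma_algebra setT (@path_measurable R T) by exact: smallest_sigma_algebra.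
have [p0 pC pU] := pm; split.
- exists set0; split => // t.
  by rewrite (_ : _ `+` _ = set0) ?measure0// setYK.
- move=> _ [A [pA -> AE]]; exists (setT `\` A); split; [exact: pC|by []|move=> t].
  rewrite -(AE t); congr (P _); apply/seteqP; split => w;
    rewrite /setY /=; have [a|a] := pselect (A (Y^~ w));
    have [b|b] := pselect (A (fun s => Y (td_add s t) w)); tauto.
- move=> F /choice[A HA]; exists (\bigcup_n A n); split.
  + by apply: pU => n; have [] := HA n.
  + apply/seteqP; split => w [n _ Fn]; exists n => //; have [_ E _] := HA n.
      by move: Fn; rewrite E.
    by rewrite E.
  + move=> t; have mF n : measurable (F n).
      by have [pA -> _] := HA n; exact: measurable_path.
    have mS : measurable [set w | (\bigcup_n A n) (fun s => Y (td_add s t) w)].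
      by apply: shift_measurable; apply: pU => n; have [] := HA n.
    apply/negligibleP.
      apply: measurableU; apply: measurableD => //; exact: bigcup_measurable.
    apply: (@negligibleS _ _ _ _ (\bigcup_n (F n `+` [set w | A n (fun s => Y (td_add s t) w)]))).
      move=> w [[[n _ Fn] nA]|[[n _ An] nF]]; exists n => //.
        by left; split => // An; apply: nA; exists n.
      by right; split => // Fn; apply: nF; exists n.
    apply: negligible_bigcup => n; have [pA FE AE] := HA n.
    apply/negligibleP; last exact: AE.
    by apply: measurableU; apply: measurableD => //; exact: shift_measurable.
Qed.

End invariant_sigma_algebra.

Lemma ge_of_cvg (R : realType) (u : nat -> R) (l x : R) :
  u n @[n --> \oo] --> l -> (forall n, x <= u n) -> x <= l.
Proof.
move=> ul xu; rewrite -(cvg_lim (@Rhausdorff R) ul).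
by apply: limr_ge; [apply/cvg_ex; exists l|exact: nearW].
Qed.

(** * Conditional expectations given a sigma-field *)

Section conditional_expectation_facts.
Context d (O : measurableType d) (R : realType) (P : probability O R).
Variable G : set (set O).
Hypotheses (sG : sigma_algebra setT G) (mG : G `<=` measurable).

(** A copy of the space that carries [G] alone: measurability there is [G]-measurability, so the
    closure rules for measurable functions yield events of [G]. *)
Let OG := g_sigma_algebraType G.
Let GE : @measurable _ OG = G. Proof. exact: sigma_algebra_id. Qed.

Let measurable_OG (g : O -> R) : (forall B, measurable B -> G (g @^-1` B)) ->
  measurable_fun setT (g : OG -> R).
Proof. by move=> gG _ B mB; rewrite setTI GE; exact: gG. Qed.

Lemma is_cond_exp_Rintegral xi g A : is_cond_exp P G xi g -> G A ->
  \int[P]_(w in A) g w = \int[P]_(w in A) xi w.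
Proof. by move=> [_ _ H] GA; rewrite /Rintegral H. Qed.

Lemma is_cond_exp_measurable xi g : is_cond_exp P G xi g -> measurable_fun setT g.
Proof. by move=> [H _ _] _ B mB; rewrite setTI; exact/mG/H. Qed.

Let prob_Rint_ge (A : set O) (f : O -> R) (r : R) : measurable A ->
  P.-integrable setT (EFin \o f) -> (forall w, A w -> r <= f w) ->
  r * fine (P A) <= \int[P]_(w in A) f w.
Proof.
move=> mA if_ rf; rewrite -Rintegral_cst//.
apply: le_Rintegral => //; last exact: integrableS if_.
apply: (@integrableS _ _ _ _ setT) => //; exact: (integrable_bounded P (M := `|r|)).
Qed.

Let fine_P0 (A : set O) : measurable A -> fine (P A) <= 0 -> P A = 0%E.
Proof.
move=> mA PA; apply/eqP; rewrite eq_le measure_ge0 andbT.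
by rewrite -[X in (X <= _)%E]fineK ?fin_num_measure// lee_fin.
Qed.

(** If the event g >= E + 1/(n+1) of [G] had probability 1, integrating over it would give E >= E +
    1/(n+1), as [g] and [xi] have equal integrals over events of [G]. So all these events are
    null. *)
Lemma cond_exp_trivial_le xi g : (forall E, G E -> P E = 0%E \/ P E = 1%E) ->
  P.-integrable setT (EFin \o xi) -> is_cond_exp P G xi g ->
  {ae P, forall w, g w <= \int[P]_w xi w}.
Proof.
move=> triv ixi ce; have [gG ig gE] := ce; set E := \int[P]_w xi w.
have N n : P.-negligible [set w | E + n.+1%:R^-1 <= g w].
  have GB : G [set w | E + n.+1%:R^-1 <= g w].
    rewrite (_ : [set w | _] = g @^-1` `[E + n.+1%:R^-1, +oo[); first exact: gG.
    by apply/seteqP; split => w /=; rewrite in_itv/= andbT.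
  apply/negligibleP; first exact: mG.
  have [//|B1] := triv _ GB; exfalso.
  have := prob_Rint_ge (mG GB) ig (fun w => id).
  rewrite (is_cond_exp_Rintegral ce GB) B1 mulr1 => h.
  have : \int[P]_(w in [set w | E + n.+1%:R^-1 <= g w]) xi w = E.
    rewrite /E /Rintegral; congr fine.
    rewrite [RHS](negligible_integral (N := ~` [set w | E + n.+1%:R^-1 <= g w]))//.
    - by rewrite setTD setCK.
    - exact/measurableC/mG.
    - have h0 := @probability_setC _ _ _ P _ (mG GB).
      by rewrite [LHS]h0 B1 subee.
  move=> h'; move: h; rewrite h' gerDl leNgt invr_gt0 ltr0n//.
have := negligible_bigcup N; apply: negligibleS => w /= /negP.
rewrite -ltNge => gw; have g0 : 0 < g w - E by rewrite subr_gt0.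
have [n _ /(_ n (leqnn _)) Hn] := near_infty_natSinv_lt (PosNum g0).
by exists n => //=; rewrite -lerBrDl ltW.
Qed.

Lemma is_cond_expN xi g : P.-integrable setT (EFin \o xi) -> is_cond_exp P G xi g ->
  is_cond_exp P G (fun w => - xi w) (fun w => - g w).
Proof.
move=> ixi ce; have [gG ig gE] := ce; split.
- move=> B mB; rewrite (_ : _ @^-1` B = g @^-1` ((fun x => - x) @^-1` B))//.
  by apply: gG; rewrite -[X in measurable X]setTI; exact: (@oppr_measurable R setT).
- exact: integrableN ig.
- move=> A GA; have mA := mG GA.
  have opp (f : O -> R) : P.-integrable setT (EFin \o f) ->
      (\int[P]_(w in A) (- f w)%:E = (-1)%:E * \int[P]_(w in A) (f w)%:E)%E.
    move=> if_; rewrite -integralZl//; last exact: integrableS if_.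
    by apply: eq_integral => w _; rewrite -EFinM mulN1r.
  by rewrite !opp// gE.
Qed.

Lemma cond_exp_trivial xi g : (forall E, G E -> P E = 0%E \/ P E = 1%E) ->
  P.-integrable setT (EFin \o xi) -> is_cond_exp P G xi g ->
  {ae P, forall w, g w = \int[P]_w xi w}.
Proof.
move=> triv ixi ce; have N1 := cond_exp_trivial_le triv ixi ce.
have := cond_exp_trivial_le triv (integrableN ixi) (is_cond_expN ixi ce).
move: N1; apply: filterS2 => w h1 h2; apply/eqP; rewrite eq_le h1/=.
move: h2; have -> : \int[P]_w - xi w = - \int[P]_w xi w.
  have := RintegralZl (-1) measurableT ixi; rewrite mulN1r => <-.
  by apply: eq_Rintegral => w' _; rewrite mulN1r.
by rewrite lerN2.
Qed.

Variable xi : O -> R.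
Hypotheses (mxi : measurable_fun setT xi)
  (ixi2 : P.-integrable setT (EFin \o (fun w => xi w ^+ 2))).
(** Let p be the probability that g_a >= r for all [a]. The defining identity on the event g_a >= r
    gives r p <= E[tail_sqr (a+1) xi] for each [a]; the right side tends to 0 by dominated
    convergence, so p = 0. The levels start at 1, as [lindeberg_term] requires. *)
Lemma cond_exp_tail_small (g : nat -> O -> R) :
  (forall a, is_cond_exp P G (fun w => tail_sqr a.+1%:R (xi w)) (g a)) ->
  {ae P, forall w, forall e, 0 < e -> exists a, g a w < e}.
Proof.
move=> cg.
have tail0 : \int[P]_w tail_sqr a.+1%:R (xi w) @[a --> \oo] --> (0 : R).
  have mt a : measurable_fun setT (fun w => (tail_sqr a.+1%:R (xi w))%:E).
    by apply/measurable_EFinP; apply: measurableT_comp mxi; exact: measurable_tail_sqr.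
  have [] := @dominated_convergence _ _ _ P setT measurableT
    (fun a w => (tail_sqr a.+1%:R (xi w))%:E) (cst 0%E) (fun w => (xi w ^+ 2)%:E) mt.
  - exact: measurable_cst.
  - apply: aeW => w _; apply: cvg_near_cst.
    have := nbhs_infty_gtr `|xi w|; apply: filterS => a ha.
    rewrite /tail_sqr ltNge (le_trans (ltW ha))//= ler_nat//.
  - exact: ixi2.
  - apply: aeW => w a _; rewrite /= lee_fin ger0_norm ?tail_sqr_ge0//.
    exact: tail_sqr_le.
  - move=> _ _; rewrite integral_cst// mul0e => /fine_cvg; exact.
pose r n : R := n.+1%:R^-1.
have r0 n : 0 < r n by rewrite invr_gt0.
pose B n a := [set w | r n <= g a w].
have GB n a : G (B n a).
  have [gG _ _] := cg a.
  rewrite (_ : B n a = g a @^-1` `[r n, +oo[); first exact: gG.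
  by apply/seteqP; split => w /=; rewrite in_itv/= andbT.
have mBB n : measurable (\bigcap_a B n a) by apply: bigcap_measurable => // a _; exact: mG.
have PB n : P (\bigcap_a B n a) = 0%E.
  apply: fine_P0 => //; rewrite -(pmulr_rle0 _ (r0 n)).
  apply: (ge_of_cvg tail0) => a.
  have [_ iga _] := cg a.
  apply: (@le_trans _ _ (r n * fine (P (B n a)))).
    rewrite ler_pM2l// fine_le ?fin_num_measure//; first exact: mG.
    by apply: le_measure; rewrite ?inE//; [exact: mG|exact: bigcap_inf].
  have h1 : r n * fine (P (B n a)) <= \int[P]_(w in B n a) g a w.
    by apply: prob_Rint_ge => //; exact: mG.
  apply: (le_trans h1); rewrite (is_cond_exp_Rintegral (cg a) (GB n a)).
  have it : P.-integrable setT (EFin \o (fun w => tail_sqr a.+1%:R (xi w))).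
    apply: (le_integrable measurableT _ _ ixi2).
      by apply/measurable_EFinP; apply: measurableT_comp mxi; exact: measurable_tail_sqr.
    move=> w _; rewrite /= lee_fin !ger0_norm ?sqr_ge0 ?tail_sqr_ge0//.
    exact: tail_sqr_le.
  rewrite /Rintegral fine_le//.
  - by apply: integrable_fin_num => //; [exact: mG|apply: integrableS it => //; exact: mG].
  - exact: integrable_fin_num it.
  - apply: ge0_subset_integral => //; [exact: mG|exact: measurable_int it|].
    by move=> w _; rewrite lee_fin tail_sqr_ge0.
have NN : P.-negligible (\bigcup_n \bigcap_a B n a).
  by apply: negligible_bigcup => n; apply/negligibleP; [exact: mBB|exact: PB].
apply: negligibleS NN => w /= /existsNP[e /not_implyP[e0 /forallNP H]].
have [n _ /(_ n (leqnn _)) Hn] := near_infty_natSinv_lt (PosNum e0).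
exists n => // a _; rewrite /B/=.
by have /negP := H a; rewrite -leNgt => /(lt_le_trans Hn)/ltW.
Qed.

Variables m s : O -> R.
Hypotheses (cm : is_cond_exp P G xi m)
  (cs : is_cond_exp P G (fun w => xi w ^+ 2) s).

Let ixi : P.-integrable setT (EFin \o xi).
Proof.
have i1 : P.-integrable setT (EFin \o (fun=> 1 : R)).
  exact: (integrable_bounded P (M := `|1|)).
apply: (@le_integrable _ _ _ _ _ _ _ (EFin \o (fun w => 1 + xi w ^+ 2))) => //.
- exact/measurable_EFinP.
- move=> w _; rewrite /= lee_fin [leRHS]ger0_norm ?addr_ge0 ?sqr_ge0//.
  rewrite -(real_normK (num_real (xi w))).
  by have := sqr_ge0 (`|xi w| - 1); have := normr_ge0 (xi w); nra.
- exact: integrableD i1 ixi2.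
Qed.

(* On an event of [G] where [m] is within [e] of a constant [q] and [s <= m ^ 2],
   [E (xi - q)^2 = E (s - 2 q m + q^2) <= E (m - q)^2 <= e^2]. *)
Lemma cell_sqr_deviation B q e : G B -> P.-integrable setT (EFin \o (fun w => (xi w - m w) ^+ 2)) ->
  (forall w, B w -> s w <= m w ^+ 2 /\ `|m w - q| <= e) ->
  \int[P]_(w in B) ((xi w - m w) ^+ 2) <= 4 * e ^+ 2 * fine (P B).
Proof.
move=> GB iD HB; have mB := mG GB.
have [_ im _] := cm; have [_ is_ _] := cs.
have S (f : O -> R) : P.-integrable setT (EFin \o f) -> P.-integrable B (EFin \o f).
  by move=> if_; apply: integrableS if_.
have ic (r : R) : P.-integrable B (EFin \o (fun=> r)).
  by apply: S; exact: (integrable_bounded P (M := `|r|)).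
have mm := is_cond_exp_measurable cm.
have mq2 w : B w -> (m w - q) ^+ 2 <= e ^+ 2.
  move=> /HB[_ h]; rewrite -real_normK ?num_real// lerXn2r// nnegrE//.
  exact: le_trans h.
have lin (f1 f2 : O -> R) : P.-integrable B (EFin \o f1) -> P.-integrable B (EFin \o f2) ->
    P.-integrable B (EFin \o (fun w => f1 w - (2 * q) * f2 w + q ^+ 2)) /\
    \int[P]_(w in B) (f1 w - (2 * q) * f2 w + q ^+ 2) =
    \int[P]_(w in B) f1 w - (2 * q) * \int[P]_(w in B) f2 w + q ^+ 2 * fine (P B).
  move=> i1 i2; have i2' : P.-integrable B (EFin \o (fun w => (2 * q) * f2 w)).
    exact: (integrableZl mB _ i2).
  have i3 : P.-integrable B (EFin \o (fun w => f1 w - (2 * q) * f2 w)) by exact: integrableB i1 i2'.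
  split; first exact: integrableD i3 (ic _).
  by rewrite (RintegralD mB i3 (ic _)) (RintegralB mB i1 i2') (RintegralZl _ mB i2) Rintegral_cst.
have [iq Eq] := lin _ _ (S _ ixi2) (S _ ixi).
have [ir Er] := lin _ _ (S _ is_) (S _ im).
have sq2 w : xi w ^+ 2 - (2 * q) * xi w + q ^+ 2 = (xi w - q) ^+ 2 by ring.
have E1 : \int[P]_(w in B) (xi w ^+ 2 - (2 * q) * xi w + q ^+ 2) <= e ^+ 2 * fine (P B).
  rewrite Eq -(is_cond_exp_Rintegral cs GB) -(is_cond_exp_Rintegral cm GB) -Er.
  rewrite -Rintegral_cst//; apply: le_Rintegral => // w Bw.
  apply: le_trans (mq2 w Bw); have [h _] := HB w Bw.
  rewrite (_ : (m w - q) ^+ 2 = m w ^+ 2 - (2 * q) * m w + q ^+ 2); last by ring.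
  by rewrite !lerD2r.
have i2q : P.-integrable B (EFin \o (fun w => 2 * (xi w ^+ 2 - (2 * q) * xi w + q ^+ 2))).
  exact: (integrableZl mB _ iq).
apply: (@le_trans _ _ (\int[P]_(w in B) (2 * (xi w ^+ 2 - (2 * q) * xi w + q ^+ 2) + 2 * e ^+ 2))).
  apply: le_Rintegral => //; first exact: S.
    exact: integrableD i2q (ic _).
  move=> w Bw; rewrite sq2.
  (* (x - m)^2 <= 2 (x - q)^2 + 2 (m - q)^2, the difference being the square of (x - q) + (m - q).
     Each part contributes 2 e^2, whence the factor 4. *)
  have := mq2 w Bw; have := sqr_ge0 ((xi w - q) + (m w - q)).
  move: (xi w) (m w) => x y; nra.
rewrite (RintegralD mB i2q (ic _)) (RintegralZl _ mB iq) Rintegral_cst//.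
have := E1; set I := Rintegral _ _ _; set p := fine _; move: I p => I p; lra.
Qed.

(** Take r = 1/(n+1) and a cell where cv >= r, s <= m^2 and m is within r/4 of a constant; let p be
    its probability. The identity defining [cv] and [cell_sqr_deviation] give r p <= 4 (r/4)^2 p =
    r^2 p / 4, so p = 0 because r <= 1. Countably many cells cover the event that cv > 0 and s <=
    m^2. *)
Lemma cond_var_gt0_gap cv : is_cond_exp P G (fun w => (xi w - m w) ^+ 2) cv ->
  P.-integrable setT (EFin \o (fun w => (xi w - m w) ^+ 2)) ->
  {ae P, forall w, 0 < cv w -> m w ^+ 2 < s w}.
Proof.
move=> ccv iD; have [gm im _] := cm; have [gs is_ _] := cs; have [gcv icv _] := ccv.
pose r n : R := n.+1%:R^-1.
have r0 n : 0 < r n by rewrite invr_gt0.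
have r1 n : r n <= 1 by rewrite invf_le1// ler1n.
(* [b] gives the sign of the centre and [j] its distance from 0 in units of r/4; the truncation of
   |m| / (r/4) later selects a cell. *)
pose N n (b : bool) (j : nat) : set O := [set w | [/\ r n <= cv w, s w <= m w ^+ 2 &
  `|m w - (-1) ^+ b * (r n / 4 * j%:R)| <= r n / 4]].
have GN n b j : G (N n b j).
  rewrite -GE (_ : N n b j = [set w : OG | r n <= cv w] `&` [set w : OG | s w <= m w ^+ 2] `&`
      [set w : OG | `|m w - (-1) ^+ b * (r n / 4 * j%:R)| <= r n / 4]); last first.
    by apply/seteqP; split => w /=; [move=> [? ? ?]|move=> [[? ?] ?]].
  have mm : measurable_fun setT (m : OG -> R) by exact: measurable_OG.
  have ms : measurable_fun setT (s : OG -> R) by exact: measurable_OG.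
  have mc : measurable_fun setT (cv : OG -> R) by exact: measurable_OG.
  apply: measurableI; first apply: measurableI.
  - by rewrite -[X in measurable X]setTI; exact: measurable_fun_le.
  - rewrite -[X in measurable X]setTI; apply: measurable_fun_le => //; exact: measurable_funX.
  - rewrite -[X in measurable X]setTI; apply: measurable_fun_le => //.
    by apply: measurableT_comp => //; exact: measurable_funB.
have PN n b j : P (N n b j) = 0%E.
  apply: fine_P0; first exact: mG.
  have h1 : r n * fine (P (N n b j)) <= \int[P]_(w in N n b j) cv w.
    by apply: prob_Rint_ge => // [|w []//]; exact: mG.
  rewrite (is_cond_exp_Rintegral ccv (GN n b j)) in h1.
  have h2 := cell_sqr_deviation (GN n b j) iD (q := (-1) ^+ b * (r n / 4 * j%:R)) (e := r n / 4) _.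
  have {h2}h2 := le_trans h1 (h2 (fun w Nw => let: And3 _ a b := Nw in conj a b)).
  have p0 : 0 <= fine (P (N n b j)) by rewrite fine_ge0.
  have := r0 n; have := r1 n; move: h2 p0; set p := fine _; move: (r n) p => q p h p0 q1 q0.
  have q4 : 0 < q - 4 * (q / 4) ^+ 2 by nra.
  by rewrite -(pmulr_rle0 _ q4) mulrBl subr_le0.
have NN : P.-negligible (\bigcup_n \bigcup_j (N n true j `|` N n false j)).
  apply: negligible_bigcup => n; apply: negligible_bigcup => j; apply: negligibleU.
    by apply/negligibleP; [exact/mG/GN|exact: PN].
  by apply/negligibleP; [exact/mG/GN|exact: PN].
apply: negligibleS NN => w /= /not_implyP[cw /negP]; rewrite -leNgt => sw.
have [n _ /(_ n (leqnn _)) Hn] := near_infty_natSinv_lt (PosNum cw).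
exists n => //; exists (Num.truncn (`|m w| / (r n / 4))) => //.
suff : N n (m w < 0) (Num.truncn (`|m w| / (r n / 4))) w by case: (m w < 0); [left|right].
split => //; first exact: ltW.
have e0 : 0 < r n / 4 by rewrite divr_gt0.
have mr0 : 0 <= `|m w| / (r n / 4) by rewrite divr_ge0 ?(ltW e0).
have /andP[t1 t2] := truncn_itv mr0.
rewrite [X in X - _](realEsign (num_real (m w))) -mulrBr normrM normr_sign mul1r.
rewrite ler_pdivlMr// in t1; rewrite ltr_pdivrMr// in t2.
rewrite -natr1 in t2.
move: t1 t2; set j := (Num.truncn _)%:R; move: (r n / 4) j `|m w| => e j y t1 t2.
by rewrite ler_norml; apply/andP; split; lra.
Qed.

End conditional_expectation_facts.

(** * Almost every path of a homogeneous field *)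

Section homogeneous_component.
Context (R : realType) (T : time_domain R) d0 (O : measurableType d0) (P : probability O R).
Local Notation lambda := (td_measure T).
Variables (Y : T -> O -> R) (A : nat -> set T).
Hypotheses (rY : random_field Y) (hY : homogeneous P Y)
  (mY : measurable_fun [set: T * O] (fun p => Y p.1 p.2))
  (add0t : forall t : T, td_add (td_zero T) t = t)
  (Y2 : ('E_P[fun w => (`|Y (td_zero T) w| ^+ 2)%R] < +oo)%E)
  (avgA : pointwise_averaging A).
Let Y0 := Y (td_zero T).
Let I := invariant_sigma P Y.
Let mYt t : measurable_fun setT (Y t). Proof. by case: rY. Qed.

Lemma homogeneous_law t (B : set R) : measurable B -> P (Y t @^-1` B) = P (Y0 @^-1` B).
Proof.
move=> mB.
have mB1 : measurable [set y : 1.-tuple R | B (tnth y ord0)].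
  by rewrite -[X in measurable X]setTI; exact: measurable_tnth.
have := hY (fun _ : 'I_1 => td_zero T) t mB1; rewrite /= add0t.
rewrite (_ : [set w | B _] = Y t @^-1` B); last first.
  by apply/seteqP; split => w /=; rewrite tnth_mktuple.
by rewrite (_ : [set w | B _] = Y0 @^-1` B)//; apply/seteqP; split => w /=; rewrite tnth_mktuple.
Qed.

Lemma sqr_integral_const t :
  (\int[P]_w (Y t w ^+ 2)%:E = \int[P]_w (Y0 w ^+ 2)%:E)%E.
Proof.
have mf : measurable_fun setT (fun y : R => (y ^+ 2)%:E).
  by apply/measurable_EFinP; exact: measurable_funX.
have pf u : (\int[P]_w (Y u w ^+ 2)%:E = \int[pushforward P (Y u)]_y (y ^+ 2)%:E)%E.
  rewrite (ge0_integral_pushforward (mYt u))// => y _.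
  by rewrite lee_fin sqr_ge0.
rewrite pf [RHS]pf.
pose m_ u := [the {measure set R -> \bar R} of pushforward P (Y u)].
rewrite -[LHS]/(\int[m_ mYt t]_y (y ^+ 2)%:E)%E -[RHS]/(\int[m_ mYt (td_zero T)]_y (y ^+ 2)%:E)%E.
by apply: eq_measure_integral => B mB _; exact: homogeneous_law.
Qed.

Let iY02 : P.-integrable setT (EFin \o (fun w => Y0 w ^+ 2)).
Proof.
apply/integrableP; split.
  by apply/measurable_EFinP; apply: measurable_funX; exact: mYt.
move: Y2; rewrite unlock; apply: le_lt_trans; apply: ge0_le_integral => //.
- by apply: measurableT_comp => //; apply/measurable_EFinP; apply: measurable_funX; exact: mYt.
- apply/measurable_EFinP; apply: measurable_funX; apply: measurableT_comp => //; exact: mYt.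
- by move=> w _; rewrite /= normrX.
Qed.

Let iY0 : P.-integrable setT (EFin \o Y0).
Proof.
have i1 : P.-integrable setT (EFin \o (fun=> 1 : R)).
  exact: (integrable_bounded P (M := `|1|)).
apply: (@le_integrable _ _ _ _ _ _ _ (EFin \o (fun w => 1 + Y0 w ^+ 2))) => //.
- by apply/measurable_EFinP; exact: mYt.
- move=> w _; rewrite /= lee_fin [leRHS]ger0_norm ?addr_ge0 ?sqr_ge0//.
  rewrite -(real_normK (num_real (Y0 w))).
  by have := sqr_ge0 (`|Y0 w| - 1); have := normr_ge0 (Y0 w); nra.
- exact: integrableD i1 iY02.
Qed.

(** By homogeneity the second moment does not depend on [t], so by Tonelli's theorem the expected
    integral of the squares over [D] is [lambda D] times E[Y(0)^2], which is finite. *)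
Lemma path_sqr_integrable (D : set T) : measurable D -> (lambda D < +oo)%E ->
  {ae P, forall w, lambda.-integrable D (EFin \o (fun t => Y t w ^+ 2))}.
Proof.
move=> mD Doo.
pose f (p : O * T) : \bar R := (\1_D p.2 * Y p.2 p.1 ^+ 2)%:E.
have mf : measurable_fun setT f.
  apply/measurable_EFinP; apply: measurable_funM.
    by apply: measurableT_comp => //; exact: measurable_indic.
  apply: measurable_funX.
  have sw : measurable_fun [set: O * T] (fun p : O * T => (p.2, p.1)).
    by apply: measurable_fun_pair; [exact: measurable_snd|exact: measurable_fst].
  exact: (measurableT_comp mY sw).
have fE w t : `|f (w, t)|%E = ((\1_D t)%:E * (Y t w ^+ 2)%:E)%E.
  by rewrite /f /= ger0_norm ?EFinM// mulr_ge0 ?sqr_ge0.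
have int_f : (P \x lambda)%E.-integrable setT f.
  apply/(integrable21ltyP P lambda mf).
  under eq_integral => t _.
    under eq_integral do rewrite fE.
    rewrite ge0_integralZl//; last 2 first.
    - by apply/measurable_EFinP; exact: measurable_funX.
    - by move=> w _; rewrite lee_fin sqr_ge0.
    rewrite sqr_integral_const.
    over.
  rewrite ge0_integralZr//; last 2 first.
  - by apply/measurable_EFinP; exact: measurable_indic.
  - by apply: integral_ge0 => w _; rewrite lee_fin sqr_ge0.
  rewrite integral_indic// setIT lte_mul_pinfty ?ge0_fin_numE//.
  have /integrableP[_] := iY02; apply: le_lt_trans.
  rewrite le_eqVlt; apply/orP; left; apply/eqP; apply: eq_integral => w _.
  by rewrite /= ger0_norm ?sqr_ge0.
have := ae_integrable1 int_f; apply: filterS => w.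
rewrite (integrable_mkcond _ mD); apply: eq_integrable => // t _.
by rewrite /f /= patchE indicE; case: ifP => _; rewrite ?mul1r ?mul0r.
Qed.

Hypothesis cvY : {ae P, forall w, 0 < cond_var P I Y0 w}.

Let sI : sigma_algebra setT I. Proof. exact: invariant_sigma_sigma_algebra. Qed.
Let mI : I `<=` measurable. Proof. exact: invariant_sigma_measurable. Qed.

Definition limit_mean : O -> R := cond_exp P I Y0.
Definition limit_sqr : O -> R := cond_exp P I (fun w => Y0 w ^+ 2).

Let cm : is_cond_exp P I Y0 limit_mean. Proof. exact: cond_expP. Qed.
Let cs : is_cond_exp P I (fun w => Y0 w ^+ 2) limit_sqr. Proof. exact: cond_expP. Qed.

(* Were [(Y0 - E[Y0 | I]) ^ 2] not integrable, no version would exist and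
   [cond_var] would take its default value 0. *)
Lemma cond_var_is_cond_exp :
  is_cond_exp P I (fun w => (Y0 w - limit_mean w) ^+ 2) (cond_var P I Y0).
Proof.
pose D := fun w => (Y0 w - limit_mean w) ^+ 2.
have E : cond_var P I Y0 = cond_exp P I D by [].
move: cvY; rewrite E -/D /cond_exp.
case: xgetP => [g _ //|_ F]; exfalso.
have : P.-negligible [set: O].
  by apply: negligibleS F => w _ /=; rewrite /= ltxx.
move=> /(negligibleP _ measurableT).
by rewrite [LHS](@probability_setT _ _ _ P) => /eqP; rewrite onee_eq0.
Qed.

(** The identity defining a conditional expectation, taken on the whole space, equates the integral
    of this nonnegative function with that of the integrable [cond_var]. *)
Lemma deviation_sqr_integrable :
  P.-integrable setT (EFin \o (fun w => (Y0 w - limit_mean w) ^+ 2)).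
Proof.
have [_ icv icvE] := cond_var_is_cond_exp.
have [g0 gC _] := sI.
have IT : I setT by have := gC _ g0; rewrite setD0.
have mm := is_cond_exp_measurable mI cm.
have md : measurable_fun setT (fun w => (Y0 w - limit_mean w) ^+ 2).
  by apply: measurable_funX; apply: measurable_funB => //; exact: mYt.
apply/integrableP; split; first exact/measurable_EFinP.
under eq_integral => w _.
  rewrite /= ger0_norm ?sqr_ge0//.
  over.
by rewrite -(icvE _ IT) -ge0_fin_numE ?icvE//; [rewrite -icvE//; exact: integrable_fin_num icv
  |apply: integral_ge0 => w _; rewrite lee_fin sqr_ge0].
Qed.

Lemma averaging_integrable (f : R -> R) : measurable_fun setT f ->
  P.-integrable setT (EFin \o (f \o Y0)) ->
  {ae P, forall w, average (A n) (fun t => f (Y t w)) @[n --> \oo] -->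
     cond_exp P I (fun w' => f (Y0 w')) w}.
Proof.
move=> mf ifY; have [_ _ H] := avgA; apply: H => //.
by have /integrableP[_] := ifY; rewrite unlock.
Qed.

(** Only countably many averaging limits are invoked: for y, y^2 and the tails at levels 1, 2, 3,
    and so on. Along a remaining path the level is chosen by the smallness of the conditional
    tails. *)
Lemma good_path_ae : {ae P, forall w, good_path A (Y ^~ w) (limit_mean w) (limit_sqr w)}.
Proof.
have [HA _ _] := avgA.
have itail a : P.-integrable setT (EFin \o (tail_sqr a.+1%:R \o Y0)).
  apply: (le_integrable measurableT _ _ iY02).
    by apply/measurable_EFinP; apply: measurableT_comp; [exact: measurable_tail_sqr|exact: mYt].
  move=> w _; rewrite /= lee_fin !ger0_norm ?sqr_ge0 ?tail_sqr_ge0//.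
  exact: tail_sqr_le.
have N1 := averaging_integrable (@measurable_id _ _ setT) iY0.
have N2 := averaging_integrable (@exprn_measurable R setT 2) iY02.
have N3 : {ae P, forall w, forall a, average (A n) (fun t => tail_sqr a.+1%:R (Y t w)) @[n --> \oo] -->
     cond_exp P I (fun w' => tail_sqr a.+1%:R (Y0 w')) w}.
  apply: ae_foralln => a; apply: averaging_integrable => //; exact: measurable_tail_sqr.
have N4 := cond_var_gt0_gap sI mI (mYt _) iY02 cm cs cond_var_is_cond_exp deviation_sqr_integrable.
have N5 := cond_exp_tail_small mI (mYt _) iY02 (fun a => cond_expP sI mI (itail a)).
have N6 : {ae P, forall w, forall n, (lambda (A n) < +oo)%E ->
    lambda.-integrable (A n) (EFin \o (fun t => Y t w ^+ 2))}.
  apply: ae_foralln => n; have [mAn _ _] := HA n.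
  have [Aoo|Aoo] := pselect (lambda (A n) < +oo)%E.
    by have := path_sqr_integrable mAn Aoo; apply: filterS => w h _.
  exact: aeW.
move: N1 N2 N3 N4 N5 N6 cvY => N1 N2 N3 N4 N5 N6 N7.
have FF : Filter (nbhs (almost_everywhere P)) by exact: _.
pose I_ := @filterI _ (nbhs (almost_everywhere P)) FF.
have := I_ _ _ (I_ _ _ (I_ _ _ N1 N2) (I_ _ _ N3 N4)) (I_ _ _ (I_ _ _ N5 N6) N7).
apply: filterS => w [[[h1 h2] [h3 h4]] [[h5 h6] h7]]; split => //.
- by have := measurableT_comp mY (pair2_measurable w).
- split; first exact: h4.
  move=> e e0; have [a ha] := h5 e e0.
  exists a.+1%:R; exists (cond_exp P I (fun w' => tail_sqr a.+1%:R (Y0 w')) w); split => //.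
  by rewrite ler1n.
Qed.

(** Invariant events being trivial, both conditional expectations are almost surely plain
    expectations. *)
Lemma ergodic_limits : ergodic P Y ->
  {ae P, forall w, limit_sqr w - limit_mean w ^+ 2 = fine 'V_P[Y0]}.
Proof.
move=> erg.
have E1 := cond_exp_trivial mI erg iY0 cm.
have E2 := cond_exp_trivial mI erg iY02 cs.
move: E1 E2; apply: filterS2 => w -> ->.
have ic (r : R) : P.-integrable setT (EFin \o (fun=> r)).
  exact: (integrable_bounded P (M := `|r|)).
have -> : fine 'V_P[Y0] = \int[P]_w ((Y0 w - \int[P]_w Y0 w) ^+ 2).
  rewrite /variance covariance.unlock expectation.unlock /Rintegral.
  by congr fine.
set q := Rintegral P setT Y0.
have i2 : P.-integrable setT (EFin \o (fun w => (2 * q) * Y0 w)) by exact: (integrableZl measurableT _ iY0).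
have i3 : P.-integrable setT (EFin \o (fun w => Y0 w ^+ 2 - (2 * q) * Y0 w)) by exact: integrableB iY02 i2.
rewrite [RHS](_ : _ = \int[P]_w (Y0 w ^+ 2 - (2 * q) * Y0 w + q ^+ 2)); last first.
  by apply: eq_Rintegral => w' _; ring.
rewrite (RintegralD measurableT i3 (ic _)) (RintegralB measurableT iY02 i2).
rewrite (RintegralZl _ measurableT iY0) Rintegral_probability_cst -/q; ring.
Qed.

End homogeneous_component.

(** * Randomized sums *)

(** For random denominators that may vanish: 1/f is written as f times the power -1 of f^2, and the
    factor f gives the value 0 where f = 0. *)
Lemma measurable_fun_inv (R : realType) d (O : measurableType d) (f : O -> R) :
  measurable_fun setT f -> measurable_fun setT (fun w => (f w)^-1).
Proof.
move=> mf; have E w : (f w)^-1 = f w * (f w ^+ 2) `^ (-1).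
  rewrite powR_inv1 ?sqr_ge0//; have [->|f0] := eqVneq (f w) 0.
    by rewrite invr0 mul0r.
  by rewrite expr2 invfM mulrA mulfV// mul1r.
rewrite (funext E); apply: measurable_funM => //.
by apply: (measurableT_comp (measurable_powR _)); exact: measurable_funX.
Qed.

Section box_laws.
Context (R : realType) (d : nat).
Implicit Types a b : 'I_d -> R.

(** The zero factor is for an empty interval, where the difference of [gcdf] values would not be its
    probability. *)
Definition normal_box a b : R :=
  \prod_l (if a l <= b l then gcdf (b l) - gcdf (a l) else 0).

Lemma measurable_itv_oc (a b : R) : measurable [set y : R | a < y <= b].
Proof.
rewrite (_ : [set y : R | _] = `]a, b]%classic); first exact: measurable_itv.
by apply/seteqP; split => y /=; rewrite in_itv.
Qed.

Lemma in_box_normal dO (O : measurableType dO) (P : probability O R)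
    (Z : 'I_d -> O -> R) a b : (forall l, standard_normal P (Z l)) ->
  mutually_independent P Z ->
  fine (P [set w | in_box a b (\row_l Z l w)]) = normal_box a b.
Proof.
move=> nZ iZ; have mI l := measurable_itv_oc (a l) (b l).
have := iZ _ mI; rewrite [X in P X](_ : _ = [set w | in_box a b (\row_l Z l w)]); last first.
  by apply/seteqP; split => w /=; [move=> h; apply/forallP => l|move=> /forallP h l];
    have := h l; rewrite mxE.
move=> ->; have E l : P (Z l @^-1` [set y | a l < y <= b l]) =
    (if a l <= b l then gcdf (b l) - gcdf (a l) else 0)%:E.
  have [mZ ZE] := nZ l; have -> : [set y | a l < y <= b l] = `]a l, b l]%classic.
    by apply/seteqP; split => y /=; rewrite in_itv.
  by rewrite ZE// -normal_prob_itv fineK ?fin_num_measure.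
by rewrite (eq_bigr _ (fun l _ => E l)) prodEFin.
Qed.

Lemma box_along_path (T : time_domain R) dO (O : measurableType dO) (P : probability O R)
    (A : 'I_d -> nat -> set T) (k : nat -> nat)
    (tau : forall n, 'I_d -> 'I_(k n) -> O -> T)
    (x : 'I_d -> T -> R) (m s : 'I_d -> R) (c : nat -> 'I_d -> R) a b :
  (forall l n, measurable (A l n)) -> k n @[n --> \oo] --> \oo ->
  randomizing_points P A tau ->
  (forall l, good_path (A l) (x l) (m l) (s l)) ->
  (forall l, c n l @[n --> \oo] --> Num.sqrt (s l - m l ^+ 2)) ->
  fine (P [set w | in_box a b (\row_l ((\sum_(i < k n) (x l (tau n l i w) - average (A l n) (x l)))
     / (Num.sqrt (k n)%:R * c n l)))]) @[n --> \oo] --> normal_box a b.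
Proof.
move=> mA koo ran gx cc.
pose S n l w : R := (\sum_(i < k n) (x l (tau n l i w) - average (A l n) (x l)))
     / (Num.sqrt (k n)%:R * c n l).
have mx l : measurable_fun setT (x l) by case: (gx l).
have mtau n l i : measurable_fun setT (tau n l i) by have [] := ran n.
have mS n l : measurable_fun setT (S n l).
  apply: measurable_funM => //; apply: measurable_sum => i.
  by apply: measurable_funB => //; exact: measurableT_comp (mtau n l i).
have Sb l y : fine (P [set w | S n l w <= y]) @[n --> \oo] --> gcdf y.
  apply: (clt_along_path (mA l) koo (tau := fun n => tau n l) _ _ _ (gx l) (cc l)).
  - by move=> n i; have [] := ran n.
  - by move=> n i; have [] := ran n.
  - by move=> n; have [] := ran n.
have mle n l y : measurable [set w | S n l w <= y].
  by rewrite -[X in measurable X]setTI; exact: measurable_fun_le.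
have Sab l : fine (P [set w | a l < S n l w <= b l]) @[n --> \oo] -->
    (if a l <= b l then gcdf (b l) - gcdf (a l) else 0).
  case: leP => ab.
    rewrite (_ : (fun n => _) = (fun n => fine (P [set w | S n l w <= b l]) - fine (P [set w | S n l w <= a l]))).
      exact: cvgB.
    apply/funext => n; apply/eqP; rewrite eq_sym subr_eq; apply/eqP.
    have mab : measurable [set w | a l < S n l w <= b l].
      by rewrite -[X in measurable X]setTI; exact: (mS n l) (measurable_itv_oc _ _).
    rewrite -fineD ?fin_num_measure// -measureU//.
      congr (fine (_ _)); apply/seteqP; split => w /=.
        by case: (leP (S n l w) (a l)) => xa xb; [right|left].
      by case => [/andP[]|/le_trans]; [|exact].
    by apply/seteqP; split => // w [] /= /andP[xa _]; rewrite leNgt xa.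
  rewrite (_ : (fun n => _) = (fun=> 0)); first exact: cvg_cst.
  apply/funext => n; rewrite (_ : [set w | _] = set0) ?measure0//.
  by apply/seteqP; split => // w /= /andP[h1 h2]; move: (lt_le_trans h1 h2); rewrite ltNge (ltW ab).
rewrite (_ : (fun n => _) = (fun n => \prod_l fine (P [set w | a l < S n l w <= b l]))).
  rewrite /normal_box; elim: (index_enum _) => [|l r IH].
    rewrite big_nil (_ : (fun n => _) = (fun=> 1)); first exact: cvg_cst.
    by apply/funext => n; rewrite big_nil.
  rewrite big_cons (_ : (fun n => _) = (fun n => fine (P [set w | a l < S n l w <= b l]) *
    \prod_(j <- r) fine (P [set w | a j < S n j w <= b j]))); first exact: cvgM.
  by apply/funext => n; rewrite big_cons.
apply/funext => n; have [_ _ _ ind] := ran n.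
(* The normalized sum as a function of the whole vector of points, since it is these vectors that
   are independent over [l]. *)
pose g l (t : (k n).-tuple T) : R := (\sum_(i < k n) (x l (tnth t i) - average (A l n) (x l)))
     / (Num.sqrt (k n)%:R * c n l).
have mg l : measurable_fun setT (g l).
  apply: measurable_funM => //; apply: measurable_sum => i.
  by apply: measurable_funB => //; apply: measurableT_comp => //; exact: measurable_tnth.
have gS l w : g l [tuple tau n l i w | i < k n] = S n l w.
  by rewrite /g /S; congr (_ / _); apply: eq_bigr => i _; rewrite tnth_mktuple.
have mB l : measurable [set t | a l < g l t <= b l].
  by rewrite -[X in measurable X]setTI; exact: (mg l) (measurable_itv_oc _ _).
have := ind _ mB; rewrite [X in P X](_ : _ = [set w | in_box a b (\row_l S n l w)]); last first.
  by apply/seteqP; split => w /=; [move=> h; apply/forallP => l|move=> /forallP h l];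
    have := h l; rewrite mxE gS.
move=> ->; have E l : P ((fun w => [tuple tau n l i w | i < k n]) @^-1` [set t | a l < g l t <= b l]) =
    (fine (P [set w | a l < S n l w <= b l]))%:E.
  rewrite fineK ?fin_num_measure//.
    by congr (P _); apply/seteqP; split => w /=; rewrite gS.
  by rewrite -[X in measurable X]setTI; exact: (mS n l) (measurable_itv_oc _ _).
by rewrite (eq_bigr _ (fun l _ => E l)) prodEFin.
Qed.

End box_laws.

Section product_space.
Context (R : realType) d1 (O1 : measurableType d1) (P1 : probability O1 R)
  d2 (O2 : measurableType d2) (P2 : probability O2 R).

Lemma product_probability_cvg (D : nat -> set (O1 * O2)) (L : R) :
  (forall n, measurable (D n)) ->
  {ae P1, forall w, fine (P2 [set w' | D n (w, w')]) @[n --> \oo] --> L} ->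
  fine ((P1 \x P2)%E (D n)) @[n --> \oo] --> L.
Proof.
move=> mD DL.
have mf n : measurable_fun setT (fun w => P2 (xsection (D n) w)).
  exact: measurable_fun_xsection.
have [] := @dominated_convergence _ _ _ P1 setT measurableT
    (fun n w => P2 (xsection (D n) w)) (cst L%:E) (cst 1%E) mf.
- exact: measurable_cst.
- move: DL; apply: filterS => w Dw _.
  have fin n : P2 (xsection (D n) w) \is a fin_num.
    by rewrite fin_num_measure//; exact: measurable_xsection.
  rewrite (_ : (fun n => _) = (fun n => (fine (P2 [set w' | D n (w, w')]))%:E)).
    by apply/fine_cvgP; split; [exact: nearW|exact: Dw].
  by apply/funext => n; rewrite -[LHS]fineK//; congr (fine (P2 _))%:E; apply/seteqP; split => w' /=;
    rewrite xsectionP.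
- by apply: (integrable_bounded P1 (f := cst 1) (M := 1)) => // w; rewrite normr1.
- apply: aeW => w n _; rewrite gee0_abs// probability_le1//; exact: measurable_xsection.
- move=> _ _; rewrite integral_cst//.
  by rewrite [X in (_ * X)%E](@probability_setT _ _ _ P1) mule1 => /fine_cvg; exact.
Qed.

End product_space.

(** The positive and negative parts have measurable integrals by Tonelli's theorem, and [fine] of
    their difference is measurable in [w], whatever default value it takes on paths that are not
    integrable. *)
Lemma measurable_Rintegral_snd (R : realType) d1 (O1 : measurableType d1) d2 (O2 : measurableType d2)
    (mu : {sigma_finite_measure set O2 -> \bar R})
    (D : set O2) (g : O1 * O2 -> R) : measurable D -> measurable_fun setT g ->
  measurable_fun setT (fun w => \int[mu]_(t in D) g (w, t)).
Proof.
move=> mD mg.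
pose h (p : O1 * O2) : \bar R := (\1_D p.2 * g p)%:E.
have mh : measurable_fun setT h.
  apply/measurable_EFinP; apply: measurable_funM => //.
  by apply: measurableT_comp => //; exact: measurable_indic.
have E w : \int[mu]_(t in D) g (w, t) =
    fine (\int[mu]_t (h^\+ (w, t)) - \int[mu]_t (h^\- (w, t)))%E.
  rewrite /Rintegral integral_mkcond; transitivity (fine (\int[mu]_t h (w, t))).
    congr fine; apply: eq_integral => t _; rewrite /h patchE indicE /=.
    by case: ifP => _; rewrite ?mul1r ?mul0r.
  rewrite [X in fine X = _](integralE mu setT (fun t => h (w, t))).
  congr (fine (_ - _)%E); apply: eq_integral => t _; by rewrite ?funeposE ?funenegE.
rewrite (funext E); apply: measurableT_comp => //; apply: emeasurable_funB.
  by apply: (measurable_fun_fubini_tonelli_F (h^\+)%E) => //; exact: measurable_funepos.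
by apply: (measurable_fun_fubini_tonelli_F (h^\-)%E) => //; exact: measurable_funeneg.
Qed.

Lemma cvg_sqrt (R : realType) (f : nat -> R) (l : R) : f n @[n --> \oo] --> l ->
  Num.sqrt (f n) @[n --> \oo] --> Num.sqrt l.
Proof.
move=> fl; have h := @sqrt_continuous R l.
exact: (cvg_comp f Num.sqrt fl h).
Qed.

(** The indices are embedded in the natural numbers, where a countable intersection of full events
    is full; from [n] on the condition is vacuous. *)
Lemma ae_forall_ord (R : realType) dO (O : measurableType dO) (P : probability O R)
    n (Q : 'I_n -> O -> Prop) :
  (forall i, {ae P, forall w, Q i w}) -> {ae P, forall w, forall i, Q i w}.
Proof.
move=> HQ; have N j : {ae P, forall w, forall i, val i = j -> Q i w}.
  have [jn|nj] := ltnP j n; last first.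
    by apply: aeW => w i ij; have := ltn_ord i; rewrite [X in (X < _)%N]ij ltnNge nj.
  have := HQ (Ordinal jn); apply: filterS => w Qw i ij.
  by rewrite (_ : i = Ordinal jn)//; exact: val_inj.
have := ae_foralln N; apply: filterS => w h i; exact: h.
Qed.

(** * The two index sets *)

Section domains.
Context (R : realType) (m : nat) (T : time_domain R)
  (hT : T = real_domain R m \/ T = int_domain R m).

Lemma td_add0 (t : T) : td_add (td_zero T) t = t.
Proof.
by move: t; case: hT => -> t; apply: eq_from_tnth => i; rewrite !tnth_mktuple add0r.
Qed.

(** On R^m joint measurability is part of [random_field]. On the lattice, a preimage is a countable
    union, over the points [t], of the products of [{t}] with a measurable event. *)
Lemma random_field_measurable dO (O : measurableType dO) dE (E : measurableType dE)
    (X : T -> O -> E) : random_field X ->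
  measurable_fun [set: T * O] (fun p => X p.1 p.2).
Proof.
move: X; case: hT => -> X [mX jX]; first exact: jX.
move=> _ B mB; rewrite setTI.
pose F n : set (int_lattice m * O) :=
  if unpickle n is Some t then [set t] `*` (X t @^-1` B) else set0.
rewrite (_ : _ @^-1` B = \bigcup_n F n); last first.
  apply/seteqP; split => -[t w] /=.
    by move=> XB; exists (pickle t) => //; rewrite /F pickleK.
  move=> [n _]; rewrite /F; case: (unpickle n) => [u|//].
  by move=> [/= -> XB].
apply: bigcup_measurable => n _; rewrite /F; case: (unpickle n) => [t|].
  apply: measurableX => //.
  by rewrite -[X in measurable X]setTI; exact: mX.
exact: measurable0.
Qed.

End domains.

Section randomized_sums.
Context (R : realType) (d : nat) (T : time_domain R).
Context dX (OX : measurableType dX) (PX : probability OX R).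
Context dtau (Otau : measurableType dtau) (Ptau : probability Otau R).
Context dZ (OZ : measurableType dZ) (PZ : probability OZ R).
Variables (Y : 'I_d -> T -> OX -> R) (A : 'I_d -> nat -> set T) (k : nat -> nat)
  (tau : forall n, 'I_d -> 'I_(k n) -> Otau -> T) (Z : 'I_d -> OZ -> R).
Arguments tau : clear implicits.
Hypotheses (add0t : forall t : T, td_add (td_zero T) t = t)
  (rY : forall l, random_field (Y l))
  (mY : forall l, measurable_fun [set: T * OX] (fun p => Y l p.1 p.2))
  (hY : forall l, homogeneous PX (Y l))
  (Y2 : forall l, ('E_PX[fun w => (`|Y l (td_zero T) w| ^+ 2)%R] < +oo)%E)
  (cvY : forall l, {ae PX, forall w,
     0 < cond_var PX (invariant_sigma PX (Y l)) (Y l (td_zero T)) w})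
  (avgA : forall l, pointwise_averaging (A l))
  (koo : k n @[n --> \oo] --> \oo)
  (ran : randomizing_points Ptau A tau)
  (nZ : forall l, standard_normal PZ (Z l))
  (iZ : mutually_independent PZ Z).

Let mA l n : measurable (A l n).
Proof. by have [HA _ _] := avgA l; have [] := HA n. Qed.

Let swapY l : measurable_fun [set: OX * T] (fun p => Y l p.2 p.1).
Proof.
have sw : measurable_fun [set: OX * T] (fun p : OX * T => (p.2, p.1)).
  by apply: measurable_fun_pair; [exact: measurable_snd|exact: measurable_fst].
exact: (measurableT_comp (mY l) sw).
Qed.

Lemma measurable_path_average l n :
  measurable_fun setT (fun w => average (A l n) (fun t => Y l t w)).
Proof.
apply: measurable_funM => //.
exact: (measurable_Rintegral_snd _ (mA l n) (swapY l)).
Qed.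

Lemma measurable_path_average_var l n :
  measurable_fun setT (fun w => average_var (A l n) (fun t => Y l t w)).
Proof.
apply: measurable_funM => //.
apply: (measurable_Rintegral_snd _ (mA l n)
  (g := fun p => (Y l p.2 p.1 - average (A l n) (fun t => Y l t p.1)) ^+ 2)).
apply: measurable_funX; apply: measurable_funB => //.
exact: measurableT_comp (measurable_path_average l n) measurable_fst.
Qed.

Lemma all_good_path_ae : {ae PX, forall w, forall l,
  good_path (A l) (fun t => Y l t w) (limit_mean PX (Y l) w) (limit_sqr PX (Y l) w)}.
Proof.
apply: ae_forall_ord => l.
exact: good_path_ae (rY l) (hY l) (mY l) add0t (Y2 l) (avgA l) (cvY l).
Qed.

Let S n l (w : OX * Otau) : R :=
  \sum_(i < k n) (Y l (tau n l i w.2) w.1 - average (A l n) (fun t => Y l t w.1)).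

(** The normalizers depend on the path only, so that fixing the path turns them into numbers with
    the limit that [box_along_path] requires. *)
Lemma cvg_normalized_sums (c : nat -> 'I_d -> OX -> R) :
  (forall n l, measurable_fun setT (c n l)) ->
  {ae PX, forall w, forall l, c n l w @[n --> \oo] -->
     Num.sqrt (limit_sqr PX (Y l) w - limit_mean PX (Y l) w ^+ 2)} ->
  cvg_in_distribution (PX \x Ptau)%E
    (fun n w => \row_l (S n l w / (Num.sqrt (k n)%:R * c n l w.1)))
    PZ (fun w => \row_l Z l w).
Proof.
move=> mc cc.
have mS n l : measurable_fun setT (fun w => S n l w / (Num.sqrt (k n)%:R * c n l w.1)).
  have mtau i : measurable_fun setT (tau n l i) by have [] := ran n.
  apply: measurable_funM.
    apply: measurable_sum => i; apply: measurable_funB.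
      have mt : measurable_fun setT (fun w : OX * Otau => (tau n l i w.2, w.1)).
        apply: measurable_fun_pair; last exact: measurable_fst.
        exact: measurableT_comp (mtau i) measurable_snd.
      exact: (measurableT_comp (mY l) mt).
    exact: measurableT_comp (measurable_path_average l n) measurable_fst.
  apply: measurable_fun_inv; apply: measurable_funM => //.
  exact: measurableT_comp (mc n l) measurable_fst.
apply: (cvg_in_distribution_of_boxes (Z := fun w l => Z l w)) => //.
  by move=> l; have [] := nZ l.
move=> a b; rewrite (in_box_normal a b nZ iZ).
apply: product_probability_cvg.
  by move=> n; exact: measurable_in_box.
have FF : Filter (nbhs (almost_everywhere PX)) by exact: _.
move: all_good_path_ae cc; apply: filterS2 => w gw cw.
have := @box_along_path R d T _ Otau Ptau A k tau (fun l t => Y l t w) _ _ (fun n l => c n l w)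
  a b mA koo ran gw cw.
exact.
Qed.

End randomized_sums.

Unset Implicit Arguments.
Theorem theorem2 (R : realType) (m d : nat) (hm : (0 < m)%N) (hd : (0 < d)%N)
    (T : time_domain R) (hT : T = real_domain R m \/ T = int_domain R m)
    (dX dtau dZ : measure_display)
    (OX : measurableType dX) (PX : probability OX R)
    (Otau : measurableType dtau) (Ptau : probability Otau R)
    (OZ : measurableType dZ) (PZ : probability OZ R)
    (X : T -> OX -> d.-tuple R)
    (A : 'I_d -> nat -> set T) (k : nat -> nat)
    (tau : forall n, 'I_d -> 'I_(k n) -> Otau -> T)
    (Z : 'I_d -> OZ -> R) :
  let Xc (l : 'I_d) (t : T) (w : OX) : R := tnth (X t w) l in
  let M (n : nat) (l : 'I_d) (w : OX) : R :=
    average (A l n) (fun t => Xc l t w) in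
  let V (n : nat) (l : 'I_d) (w : OX) : R :=
    average_var (A l n) (fun t => Xc l t w) in
  let sigma (l : 'I_d) : R := Num.sqrt (fine 'V_PX[Xc l (td_zero T)]%E) in
  let S (n : nat) (l : 'I_d) (w : OX * Otau) : R :=
    \sum_(i < k n) (Xc l (tau n l i w.2) w.1 - M n l w.1) in
  random_field X ->
  (forall l, homogeneous PX (Xc l)) ->
  (forall l, ('E_PX[fun w => (`|Xc l (td_zero T) w| ^+ 2)%R] < +oo)%E) ->
  (forall l, {ae PX, forall w,
     0 < cond_var PX (invariant_sigma PX (Xc l)) (Xc l (td_zero T)) w}) ->
  (forall l, pointwise_averaging (A l)) ->
  {homo k : a b / (a <= b)%N} ->
  k n @[n --> \oo] --> \oo ->
  randomizing_points Ptau A tau ->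
  (forall l, standard_normal PZ (Z l)) ->
  mutually_independent PZ Z ->
  cvg_in_distribution (PX \x Ptau)%E
    (fun n w => \row_l (S n l w / (Num.sqrt (k n)%:R * Num.sqrt (V n l w.1))))
    PZ (fun w => \row_l Z l w)
  /\ ((forall l, ergodic PX (Xc l)) ->
      cvg_in_distribution (PX \x Ptau)%E
        (fun n w => \row_l (S n l w / (Num.sqrt (k n)%:R * sigma l)))
        PZ (fun w => \row_l Z l w)).
Proof.
move=> Xc M V sigma S rX hX X2 cvX avgA _ koo ran nZ iZ.
have rXc l : random_field (Xc l).
  have [mX jX] := rX; split => [t|Tc].
    exact: (measurableT_comp (measurable_tnth l) (mX t)).
  exact: (measurableT_comp (measurable_tnth l) (jX Tc)).
have mXc l := random_field_measurable hT (rXc l).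
have add0 := td_add0 hT.
have FF : Filter (nbhs (almost_everywhere PX)) by exact: _.
have good := all_good_path_ae add0 rXc mXc hX X2 cvX avgA.
have clt := cvg_normalized_sums add0 rXc mXc hX X2 cvX avgA koo ran nZ iZ.
split.
  apply: (clt (fun n l w => Num.sqrt (V n l w))).
    move=> n l; apply: measurableT_comp; last exact: measurable_path_average_var.
    by apply: continuous_measurable_fun; exact: sqrt_continuous.
  move: good; apply: filterS => w gw l.
  have mA n : measurable (A l n) by have [HA _ _] := avgA l; have [] := HA n.
  have mt n i : measurable_fun setT (tau n l i) by have [] := ran n.
  have ut n i : uniformly_distributed Ptau (A l n) (tau n l i) by have [] := ran n.
  exact: cvg_sqrt (good_path_var (tau := fun n => tau n l) mA koo mt ut (gw l)).
(* Under ergodicity the limit sqrt(s - m^2) is almost surely the constant [sigma l], so the constant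
   normalizer is admissible. *)
move=> erg; apply: (clt (fun _ l _ => sigma l)) => //.
have E := ae_forall_ord (fun l => ergodic_limits (rXc l) (X2 l) (erg l)).
move: E; apply: filterS => w Ew l; rewrite Ew; exact: cvg_cst.
Qed.
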